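(* Let $0<q<1$, let $p,r$ be real-valued functions defined on $[0,a]$, continuous at zero, with $p,r\in L_q^1(0,a)$, and let $k_{ij}$ ($i,j=1,2$) be real numbers. Let $\{\lambda_n\}_{n=-\infty}^{\infty}$ be the eigenvalues of the $q$-Dirac boundary value problem $$-\tfrac1q D_{q^{-1}}y_2+p(x)y_1=\lambda y_1,\qquad D_q y_1+r(x)y_2=\lambda y_2,$$ $$k_{11}y_1(0)+k_{12}y_2(0)=0,\qquad k_{21}y_1(a)+k_{22}y_2(aq^{-1})=0.$$ For $\lambda\in\mathbb{C}$ let $\phi(x,\lambda)=\begin{pmatrix}\phi_1(x,\lambda)\\ \phi_2(x,\lambda)\end{pmatrix}$ be the unique solution of the two $q$-difference equations above satisfying $\phi_1(0,\lambda)=k_{12}$, $\phi_2(0,\lambda)=-k_{11}$, and let $$\omega(\lambda)=k_{21}\phi_1(a,\lambda)+k_{22}\phi_2(aq^{-1},\lambda).$$ Let $f(x)=\begin{pmatrix}f_1(x)\\ f_2(x)\end{pmatrix}\in H_q$ and let $F(\lambda)$ be the $q$-type transform $$F(\lambda)=\int_0^a f^{\top}(x)\,\phi(x,\lambda)\,d_qx,\qquad \lambda\in\mathbb{C}.$$ Then $F(\lambda)$ is an entire function that can be reconstructed using its values at the points $\{\lambda_n\}_{n=-\infty}^{\infty}$ by means of the sampling form $$F(\lambda)=\sum_{n=-\infty}^{\infty}F(\lambda_n)\,\frac{\omega(\lambda)}{(\lambda-\lambda_n)\,\omega'(\lambda_n)}.$$ The series converges absolutely on $\mathbb{C}$ and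 uniformly on compact subsets of $\mathbb{C}$.
   Context: Throughout $0<q<1$. **$q$-derivatives.** For $x\neq0$, $D_qf(x)=\dfrac{f(x)-f(qx)}{x(1-q)}$, and $D_qf(0)=\lim_{n\to\infty}\dfrac{f(xq^n)-f(0)}{xq^n}$ if the limit exists and does not depend on $x$. Also $D_{q^{-1}}f(x)=\dfrac{f(x)-f(q^{-1}x)}{x(1-q^{-1})}$ for $x\ne0$, and $D_{q^{-1}}f(0)=D_qf(0)$ provided that $D_qf(0)$ exists. Thus $D_{q^{-1}}f(x)=(D_qf)(xq^{-1})$. The component $y_2$ is also evaluated at points $xq^{-1}$, in particular at $aq^{-1}$. **$q$-regularity.** A function $f$ is $q$-regular at zero if $\lim_{n\to\infty}f(xq^n)=f(0)$ for all $x$ in its domain. Throughout, only functions that are $q$-regular at zero are dealt with. **Jackson integral.** $\displaystyle\int_0^x f(t)\,d_qt=x(1-q)\sum_{n=0}^\infty q^nf(xq^n)$, provided the series converges. **Spaces.** $L_q^1(0,a)$ is the space of functions on $[0,a]$ with $\int_0^a|f(x)|\,d_qx<\infty$. $L_q^2(0,a)$ is the space of complex-valued functions on $[0,a]$ with $\left(\int_0^a|f(x)|^2d_qx\right)^{1/2}<\infty$. $H_q$ is the space of vector-valued functions $y=\begin{pmatrix} y_1 \\ y_2 \end{pmatrix}$ with $y_1,y_2\in L_q^2(0,a)$. The symbol $\top$ denotes matrix transpose, so $f^\top\phi=f_1\phi_1+f_2\phi_2$. **Eigenvalues.** An eigenvalue is a number $\lambda\in\mathbb{C}$ for which the boundary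 value problem has a nontrivial solution. It is taken as known that the eigenvalues are real, simple and countable, indexed as $\{\lambda_n\}_{n=-\infty}^{\infty}$, that they are the zeros of $\omega$, and that the initial value problem defining $\phi(\cdot,\lambda)$ has a unique solution. **Convention.** At $\lambda=\lambda_n$ the quotient $\dfrac{\omega(\lambda)}{(\lambda-\lambda_n)\omega'(\lambda_n)}$ is understood as its limit as $\lambda\to\lambda_n$.
   Formalization: When k22 = 0 the formal statement also assumes f1(a) = 0; without it the sampling formula fails, e.g. for f2 = 0 and f1 the indicator of {a}, where F is a nonzero multiple of ω and vanishes at every λ_n. *)

(* Defs.v *)
From Stdlib Require Import Reals ZArith List.
From Coquelicot Require Import Coquelicot.
Open Scope R_scope.

(** Functions on [0,b] are total functions on [R] whose values off [0,b] are
    never used; [b] is passed explicitly where a quantifier ranges over it. *)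

Definition q_regular (q b : R) (f : R -> C) : Prop :=
  forall x, 0 <= x <= b ->
    filterlim (fun n : nat => f (x * q ^ n)) eventually (locally (f 0)).

(** [is_Dq q b f x l]: the q-derivative of [f] on [0,b] exists at [x] and is [l].
    At 0 the limit has to be the same along every orbit [t * q ^ n]. *)
Definition is_Dq (q b : R) (f : R -> C) (x : R) (l : C) : Prop :=
  (x <> 0 -> l = ((f x - f (q * x)%R) / RtoC (x * (1 - q)))%C) /\
  (x = 0 -> forall t, 0 < t <= b ->
     filterlim (fun n : nat => ((f (t * q ^ n)%R - f 0) / RtoC (t * q ^ n))%C)
               eventually (locally l)).

Definition is_Dqinv (q b : R) (f : R -> C) (x : R) (l : C) : Prop :=
  (x <> 0 -> l = ((f x - f (x / q)%R) / RtoC (x * (1 - / q)))%C) /\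
  (x = 0 -> is_Dq q b f 0 l).

Definition CSeries (u : nat -> C) : C :=
  (Series (fun n => Re (u n)), Series (fun n => Im (u n))).

Definition ex_jackson (q : R) (f : R -> C) (x : R) : Prop :=
  ex_series (fun n : nat => (RtoC (q ^ n) * f (x * q ^ n)%R)%C).

Definition jackson (q : R) (f : R -> C) (x : R) : C :=
  (RtoC (x * (1 - q)) *
   CSeries (fun n : nat => (RtoC (q ^ n) * f (x * q ^ n)%R)%C))%C.

Definition Lq1 (q a : R) (f : R -> R) : Prop :=
  ex_series (fun n : nat => q ^ n * Rabs (f (a * q ^ n))).

Definition Lq2 (q a : R) (f : R -> C) : Prop :=
  ex_series (fun n : nat => q ^ n * Cmod (f (a * q ^ n)) ^ 2).

Definition Hq (q a : R) (f1 f2 : R -> C) : Prop := Lq2 q a f1 /\ Lq2 q a f2.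

Definition continuous_at_zero (a : R) (f : R -> R) : Prop :=
  filterlim f (within (fun x => 0 <= x <= a) (locally 0)) (locally (f 0)).

(** The equations hold on [0,a]; since the first one involves [y2 (x / q)],
    the second component lives on [0, a / q]. *)
Definition q_dirac_solution (q a : R) (p r : R -> R) (lam : C)
    (y1 y2 : R -> C) : Prop :=
  q_regular q a y1 /\ q_regular q (a / q) y2 /\
  forall x, 0 <= x <= a ->
    exists d1 d2 : C,
      is_Dq q a y1 x d1 /\ is_Dqinv q (a / q) y2 x d2 /\
      (- RtoC (1 / q) * d2 + RtoC (p x) * y1 x = lam * y1 x)%C /\
      (d1 + RtoC (r x) * y2 x = lam * y2 x)%C.

Definition q_dirac_eigenvalue (q a : R) (p r : R -> R) (k11 k12 k21 k22 : R)
    (lam : C) : Prop :=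
  exists y1 y2 : R -> C,
    q_dirac_solution q a p r lam y1 y2 /\
    (RtoC k11 * y1 0 + RtoC k12 * y2 0 = 0)%C /\
    (RtoC k21 * y1 a + RtoC k22 * y2 (a / q)%R = 0)%C /\
    ((exists x, 0 <= x <= a /\ y1 x <> 0%C) \/
     (exists x, 0 <= x <= a / q /\ y2 x <> 0%C)).

Definition q_omega (q a k21 k22 : R) (phi1 phi2 : R -> C -> C) (lam : C) : C :=
  (RtoC k21 * phi1 a lam + RtoC k22 * phi2 (a / q)%R lam)%C.

Definition q_transform (q a : R) (phi1 phi2 : R -> C -> C) (f1 f2 : R -> C)
    (lam : C) : C :=
  jackson q (fun x => f1 x * phi1 x lam + f2 x * phi2 x lam)%C a.

(** [w z / ((z - l) * w' l)], extended to [z = l] by its limit. *)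
Definition sampling_kernel (w : C -> C) (l z : C) : C :=
  let g := fun u : C => (w u / ((u - l) * C_derive w l))%C in
  if Ceq_dec z l then C_lim g l else g z.

Definition entire (f : C -> C) : Prop := forall z : C, ex_derive f z.

(** The partial sum of [u] over the integers from [- (M + 1)] to [N]. *)
Definition Zpartial (u : Z -> C) (M N : nat) : C :=
  (sum_n (fun n => u (Z.of_nat n)) N
   + sum_n (fun m => u (- Z.of_nat (S m))%Z) M)%C.

Definition is_Zseries (u : Z -> C) (l : C) : Prop :=
  filterlim (fun MN : nat * nat => Zpartial u (fst MN) (snd MN))
            (filter_prod eventually eventually) (locally l).

Definition Zseries_abs_cv (u : Z -> C) : Prop :=
  ex_series (fun n : nat => Cmod (u (Z.of_nat n))) /\
  ex_series (fun m : nat => Cmod (u (- Z.of_nat (S m))%Z)).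

Definition compactC (K : C -> Prop) : Prop :=
  forall (I : Type) (U : I -> C -> Prop),
    (forall i, open (U i)) ->
    (forall z, K z -> exists i, U i z) ->
    exists s : list I, forall z, K z -> exists i, In i s /\ U i z.

Definition Zseries_unif_cv_on (K : C -> Prop) (u : Z -> C -> C) (F : C -> C)
    : Prop :=
  forall eps : posreal, exists N0 : nat, forall M N : nat,
    (N0 <= M)%nat -> (N0 <= N)%nat ->
    forall z, K z -> Cmod (Zpartial (fun n => u n z) M N - F z)%C < eps.

(* Main.v *)
Require Import Defs.
From Stdlib Require Import Reals ZArith.
From Coquelicot Require Import Coquelicot.
From Stdlib Require Import List Lra Lia FunctionalExtensionality.
Open Scope R_scope.

(** Why the theorem holds. On the orbit [a * q ^ n] the two first-order equations
    interleave into one three-term recurrence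
    [z (j + 2) = z j + (-1) ^ j * w j * ((lam - p j) * z (j + 1))],
    where [z] lists [y2 (a / q), y1 a, y2 a, y1 (a * q), ...], the weights [w] are
    those of the Jackson integral, and [w] and [w * p] are summable. The transform
    becomes [F lam = sum_j w j * f j * phi lam (j + 1)], a pairing in the weighted space
    of square-summable sequences, and [omega] is a combination of
    [phi lam 0] and [phi lam 1].

    Gronwall's inequality bounds solutions by their data at infinity (that is, at
    [x = 0]), locally uniformly in the parameter. This gives uniqueness on every orbit,
    hence the identification of the eigenvalues with the zeros of [omega]
    ([eigenvalue_charfun]), and it makes [F] entire: a difference quotient of [phi] in
    [lam] solves the inhomogeneous recurrence with zero data at infinity, and so does
    the difference of two such quotients ([family_quotient]).

    Green's identity ([Green_family]) at an eigenvalue [mu] reads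
    [omega lam = d * (lam - mu) * <phi lam, phi mu>] with [d <> 0]. Therefore the zeros
    of [omega] are simple, the eigenfunctions are orthogonal, and the sampling kernel is
    [<phi lam, phi mu> / |phi mu| ^ 2]. The sampling series is thus Parseval's identity
    for [f] and [phi lam] in the orthogonal family of eigenfunctions.

    What remains is completeness ([no_orthogonal_complement]). Suppose that [v] is
    orthogonal to all eigenfunctions. Then the resolvent [y x] of [v] has no pole on the
    real line: its only denominator is [omega x], and the transform of [v] vanishes at
    the zeros of [omega], which are simple. The function [N x = <y x, v>] is hence
    differentiable on the whole line, and by the resolvent identity and the
    Cauchy-Schwarz inequality [N' = |y x| ^ 2 >= N ^ 2 / |v| ^ 2]. A nonzero solution of
    this Riccati inequality blows up in finite time, so [N] vanishes; then [N'] does,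
    and [y] and [v] with it.

    Uniformity on compact sets comes from Bessel's inequality: in each term of the
    series one factor is square summable and does not depend on [lam], while the
    other one has a square sum bounded by [|phi lam| ^ 2]. *)

(** * Real series *)

(** Extensionality lemmas for series leave equations typed in a normed module, which [ring]
    does not recognize as equations between reals. *)
Ltac as_real := match goal with |- ?a = ?b => change (@eq R a b) end.

Lemma sum_n_nonneg_mono (a : nat -> R) (n m : nat) :
  (forall j, 0 <= a j) -> (n <= m)%nat -> sum_n a n <= sum_n a m.
Proof.
  intros Ha Hnm; induction Hnm as [|m _ IH]; [lra|].
  rewrite sum_Sn; unfold plus; simpl; specialize (Ha (S m)); lra.
Qed.

Lemma ex_series_bounded (a : nat -> R) (B : R) :
  (forall j, 0 <= a j) -> (forall n, sum_n a n <= B) ->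
  ex_series a /\ Series a <= B.
Proof.
  intros Ha HB.
  destruct (ex_finite_lim_seq_incr (sum_n a) B) as [l Hl]; [|exact HB|].
  { intros n; apply sum_n_nonneg_mono; [exact Ha|lia]. }
  assert (Hs : is_series a l) by exact Hl.
  split; [now exists l|].
  rewrite (is_series_unique a l Hs).
  now apply (is_lim_seq_le (sum_n a) (fun _ => B) l B HB Hl (is_lim_seq_const B)).
Qed.

Lemma is_lim_seq_sum_n (a : nat -> R) :
  ex_series a -> is_lim_seq (sum_n a) (Series a).
Proof. intros Ha; exact (Series_correct a Ha). Qed.

Lemma is_series_zero (a : nat -> R) : (forall n, a n = 0) -> is_series a 0.
Proof.
  intros Ha; change (is_lim_seq (sum_n a) 0).
  apply is_lim_seq_ext with (fun _ => 0); [|apply is_lim_seq_const].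
  intros n; rewrite (sum_n_ext _ (fun _ => 0)) by exact Ha.
  rewrite sum_n_const; ring.
Qed.

Lemma sum_n_le_Series (a : nat -> R) (n : nat) :
  (forall j, 0 <= a j) -> ex_series a -> sum_n a n <= Series a.
Proof.
  intros Ha Hs.
  apply (is_lim_seq_incr_compare (sum_n a) (Series a)).
  - now apply is_lim_seq_sum_n.
  - intros k; apply sum_n_nonneg_mono; [exact Ha|lia].
Qed.

Lemma Series_nonneg (a : nat -> R) :
  (forall j, 0 <= a j) -> ex_series a -> 0 <= Series a.
Proof.
  intros Ha Hs; apply Rle_trans with (sum_n a 0); [|now apply sum_n_le_Series].
  rewrite sum_O; apply Ha.
Qed.

Lemma Series_term_le (a : nat -> R) (j : nat) :
  (forall j, 0 <= a j) -> ex_series a -> a j <= Series a.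
Proof.
  intros Ha Hs; apply Rle_trans with (sum_n a j); [|now apply sum_n_le_Series].
  destruct j; [rewrite sum_O; lra|].
  rewrite sum_Sn; unfold plus; simpl.
  enough (0 <= sum_n a j) by lra.
  apply Rle_trans with (sum_n a 0); [rewrite sum_O; apply Ha|].
  apply sum_n_nonneg_mono; [exact Ha|lia].
Qed.

Lemma ex_series_dom (a b : nat -> R) :
  (forall j, Rabs (a j) <= b j) -> ex_series b -> ex_series a.
Proof. intros H Hb; exact (ex_series_le a b H Hb). Qed.

Lemma Series_Rabs_le (a b : nat -> R) :
  (forall j, Rabs (a j) <= b j) -> ex_series b -> Rabs (Series a) <= Series b.
Proof.
  intros H Hb.
  assert (Ha : ex_series (fun j => Rabs (a j))).
  { apply ex_series_dom with b; [|exact Hb].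
    intros j; now rewrite Rabs_Rabsolu. }
  apply Rle_trans with (Series (fun j => Rabs (a j))); [now apply Series_Rabs|].
  apply Series_le; [|exact Hb].
  intros j; split; [apply Rabs_pos|apply H].
Qed.

Lemma Series_tail_small (a : nat -> R) (eps : R) :
  ex_series a -> 0 < eps ->
  exists N, forall n, (N <= n)%nat -> Rabs (Series a - sum_n a n) < eps.
Proof.
  intros Ha He.
  assert (H := is_lim_seq_sum_n a Ha); apply is_lim_seq_spec in H.
  destruct (H (mkposreal eps He)) as [N HN]; exists N; intros n Hn.
  rewrite Rabs_minus_sym; now apply HN.
Qed.

Lemma parity_case (P : nat -> Prop) :
  (forall n, P (2 * n)%nat) -> (forall n, P (2 * n + 1)%nat) -> forall j, P j.
Proof.
  intros H0 H1 j; destruct (Nat.Even_or_Odd j) as [[n ->]|[n ->]]; auto.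
Qed.

Lemma sum_n_double (a : nat -> R) (n : nat) :
  sum_n a (2 * n + 1) = sum_n (fun k => a (2 * k)%nat + a (2 * k + 1)%nat) n.
Proof.
  induction n as [|n IH].
  - simpl Nat.mul; simpl Nat.add; rewrite sum_Sn, !sum_O; reflexivity.
  - replace (2 * S n + 1)%nat with (S (S (2 * n + 1))) by lia.
    rewrite !sum_Sn, IH.
    replace (S (S (2 * n + 1))) with (2 * S n + 1)%nat by lia.
    replace (S (2 * n + 1)) with (2 * S n)%nat by lia.
    symmetry; exact (plus_assoc (G := R_AbelianMonoid) _ _ _).
Qed.

Lemma Series_parity (a : nat -> R) :
  ex_series (fun j => Rabs (a j)) ->
  ex_series (fun n => Rabs (a (2 * n)%nat)) /\
  ex_series (fun n => Rabs (a (2 * n + 1)%nat)) /\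
  Series a = Series (fun n => a (2 * n)%nat) + Series (fun n => a (2 * n + 1)%nat).
Proof.
  intros Ha.
  assert (Hb : forall b : nat -> R, (forall j, 0 <= b j) -> ex_series b ->
    ex_series (fun n => b (2 * n)%nat + b (2 * n + 1)%nat)).
  { intros b Hb0 Hb; apply (ex_series_bounded _ (Series b)).
    - intros j; generalize (Hb0 (2 * j)%nat) (Hb0 (2 * j + 1)%nat); lra.
    - intros n; rewrite <- sum_n_double; now apply sum_n_le_Series. }
  specialize (Hb _ (fun j => Rabs_pos (a j)) Ha); simpl in Hb.
  assert (H0 : ex_series (fun n => Rabs (a (2 * n)%nat))).
  { apply ex_series_dom with (2 := Hb); intros j; rewrite Rabs_Rabsolu.
    generalize (Rabs_pos (a (2 * j + 1)%nat)); simpl; lra. }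
  assert (H1 : ex_series (fun n => Rabs (a (2 * n + 1)%nat))).
  { apply ex_series_dom with (2 := Hb); intros j; rewrite Rabs_Rabsolu.
    generalize (Rabs_pos (a (2 * j)%nat)); simpl; lra. }
  split; [exact H0|split; [exact H1|]].
  rewrite <- Series_plus by now apply ex_series_Rabs.
  symmetry; apply is_series_unique.
  assert (Hl := is_lim_seq_sum_n a (ex_series_Rabs a Ha)).
  apply is_lim_seq_subseq with (phi := fun n => (2 * n + 1)%nat) in Hl.
  - apply (is_lim_seq_ext _ _ _ (sum_n_double a) Hl).
  - apply eventually_subseq; intros n; lia.
Qed.

Definition interleave {T : Type} (A B : nat -> T) (j : nat) : T :=
  if Nat.even j then A (Nat.div2 j) else B (Nat.div2 j).

Lemma interleave_even {T : Type} (A B : nat -> T) (n : nat) :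
  interleave A B (2 * n) = A n.
Proof.
  unfold interleave; now rewrite Nat.even_mul, Nat.div2_double.
Qed.

Lemma interleave_odd {T : Type} (A B : nat -> T) (n : nat) :
  interleave A B (2 * n + 1) = B n.
Proof.
  unfold interleave.
  rewrite Nat.even_add, Nat.even_mul; cbn -[Nat.mul Nat.div2 Nat.add].
  now rewrite Nat.add_1_r, Nat.div2_succ_double.
Qed.

Lemma ex_series_interleave (A B : nat -> R) :
  (forall n, 0 <= A n) -> (forall n, 0 <= B n) ->
  ex_series A -> ex_series B -> ex_series (interleave A B).
Proof.
  intros HA0 HB0 HA HB.
  assert (H0 : forall j, 0 <= interleave A B j).
  { intros j; unfold interleave; destruct (Nat.even j); auto. }
  apply (ex_series_bounded _ (Series A + Series B) H0); intros n.
  apply Rle_trans with (sum_n (interleave A B) (2 * n + 1)).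
  { apply sum_n_nonneg_mono; [exact H0|lia]. }
  rewrite sum_n_double.
  rewrite (sum_n_ext _ (fun k => plus (A k) (B k)))
    by (intros k; now rewrite interleave_even, interleave_odd).
  rewrite sum_n_plus; apply Rplus_le_compat; now apply sum_n_le_Series.
Qed.

(** Only the limit along even indices is assumed: the Casoratians to which this applies are
    computed from the two parity subsequences of a solution. *)
Lemma Series_telescope (a W : nat -> R) (L : R) :
  (forall j, a j = W j - W (S j)) -> ex_series a ->
  is_lim_seq (fun n => W (2 * n)%nat) L -> Series a = W 0%nat - L.
Proof.
  intros HaW Ha HL.
  assert (Hs : forall n, sum_n a n = W 0%nat - W (S n)).
  { induction n as [|n IH]; [now rewrite sum_O|].
    rewrite sum_Sn, IH, HaW; unfold plus; simpl; ring. }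
  assert (Hl := is_lim_seq_sum_n a Ha).
  apply is_lim_seq_subseq with (phi := fun n => (2 * n + 1)%nat) in Hl;
    [|apply eventually_subseq; intros n; lia].
  apply is_lim_seq_incr_1 in HL.
  assert (HL' : is_lim_seq (fun n => sum_n a (2 * n + 1)) (W 0%nat - L)).
  { apply is_lim_seq_ext with (fun n => W 0%nat - W (2 * S n)%nat).
    - intros n; rewrite Hs; do 2 f_equal; lia.
    - now apply is_lim_seq_minus'; [apply is_lim_seq_const|]. }
  apply is_lim_seq_unique in Hl; apply is_lim_seq_unique in HL'.
  rewrite Hl in HL'; now injection HL'.
Qed.

Lemma Series_tail_le (a b : nat -> R) (N : nat) :
  (forall j, Rabs (a j) <= b j) -> ex_series b ->
  Rabs (Series a - sum_n a N) <= Series b - sum_n b N.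
Proof.
  intros Hab Hb.
  rewrite (Series_incr_n a (S N)); [|lia|now apply ex_series_dom with b].
  rewrite (Series_incr_n b (S N)); [|lia|exact Hb].
  rewrite !sum_n_Reals; simpl pred.
  replace (sum_f_R0 a N + _ - _) with (Series (fun k => a (S N + k)%nat)) by ring.
  replace (sum_f_R0 b N + _ - _) with (Series (fun k => b (S N + k)%nat)) by ring.
  apply Series_Rabs_le; [intros j; apply Hab|now apply ex_series_incr_n].
Qed.

(** Weierstrass' M-test at one point: a common bound on a ball gives a tail that is small
    there, and the finite part is continuous. *)
Lemma Series_continuous (a : nat -> R -> R) (b : nat -> R) (x : R) (d : R) :
  0 < d -> (forall j y, Rabs (y - x) < d -> Rabs (a j y) <= b j) -> ex_series b ->
  (forall j, continuous (a j) x) ->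
  continuous (fun y => Series (fun j => a j y)) x.
Proof.
  intros Hd Hab Hb Hc.
  apply filterlim_locally; intros eps.
  assert (He : 0 < eps / 4) by (generalize (cond_pos eps); lra).
  destruct (Series_tail_small b (eps / 4) Hb He) as [N HN].
  assert (Hb0 : forall j, 0 <= b j).
  { intros j; apply Rle_trans with (Rabs (a j x)); [apply Rabs_pos|].
    apply Hab; now rewrite Rminus_diag, Rabs_R0. }
  assert (Htail : forall y, Rabs (y - x) < d ->
    Rabs (Series (fun j => a j y) - sum_n (fun j => a j y) N) <= eps / 4).
  { intros y Hy; apply Rle_trans with (Series b - sum_n b N).
    - apply Series_tail_le; [intros j; now apply Hab|exact Hb].
    - specialize (HN N (le_n N)); apply Rabs_def2 in HN; lra. }
  assert (Hsum : continuous (fun y => sum_n (fun j => a j y) N) x).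
  { clear -Hc; induction N as [|N IH].
    - apply continuous_ext with (a 0%nat); [intros y; now rewrite sum_O|apply Hc].
    - apply continuous_ext with
        (fun y => plus (sum_n (fun j => a j y) N) (a (S N) y)).
      + intros y; now rewrite sum_Sn.
      + now apply (continuous_plus (V := R_NormedModule)). }
  apply filterlim_locally with (eps := mkposreal _ He) in Hsum.
  assert (Hx := Htail x); rewrite Rminus_diag, Rabs_R0 in Hx; specialize (Hx Hd).
  assert (Hball : locally x (fun y => Rabs (y - x) < d))
    by now exists (mkposreal d Hd).
  generalize (filter_and _ _ Hsum Hball); apply filter_imp.
  intros y [Hy1 Hy2]; specialize (Htail y Hy2).
  unfold ball in *; simpl in *; unfold AbsRing_ball, abs, minus, plus, opp in *.
  simpl in *.
  apply Rabs_def2 in Hy1; apply Rabs_le_between in Htail.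
  apply Rabs_le_between in Hx; apply Rabs_def1; lra.
Qed.

(** * Weighted square-summable sequences and Parseval's identity *)

Definition l2 (w f : nat -> R) : Prop := ex_series (fun j => w j * f j ^ 2).

Definition ip (w f g : nat -> R) : R := Series (fun j => w j * (f j * g j)).

Lemma ip_summable (w f g : nat -> R) :
  (forall j, 0 < w j) -> l2 w f -> l2 w g ->
  ex_series (fun j => Rabs (w j * (f j * g j))).
Proof.
  intros Hw Hf Hg.
  apply ex_series_dom with (fun j => w j * f j ^ 2 + w j * g j ^ 2).
  - intros j; rewrite Rabs_Rabsolu, Rabs_mult, (Rabs_pos_eq (w j))
      by (specialize (Hw j); lra).
    rewrite <- Rmult_plus_distr_l; apply Rmult_le_compat_l;
      [specialize (Hw j); lra|].
    rewrite Rabs_mult, <- (pow2_abs (f j)), <- (pow2_abs (g j)).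
    generalize (Rabs_pos (f j)) (Rabs_pos (g j)); nra.
  - now apply (ex_series_plus (V := R_NormedModule)).
Qed.

Lemma ip_ex (w f g : nat -> R) :
  (forall j, 0 < w j) -> l2 w f -> l2 w g ->
  ex_series (fun j => w j * (f j * g j)).
Proof. intros Hw Hf Hg; now apply ex_series_Rabs, ip_summable. Qed.

Lemma ip_sym (w f g : nat -> R) : ip w f g = ip w g f.
Proof. apply Series_ext; intros j; ring. Qed.

Lemma l2_lin (w f g : nat -> R) (a b : R) :
  (forall j, 0 < w j) -> l2 w f -> l2 w g ->
  l2 w (fun j => a * f j + b * g j).
Proof.
  intros Hw Hf Hg; unfold l2.
  apply ex_series_ext with (fun j =>
    plus (scal (a * a) (w j * f j ^ 2))
      (plus (scal (2 * a * b) (w j * (f j * g j))) (scal (b * b) (w j * g j ^ 2)))).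
  - intros j; unfold plus, scal; simpl; unfold mult; simpl; ring.
  - repeat apply (ex_series_plus (V := R_NormedModule));
      apply (ex_series_scal (V := R_NormedModule)); auto using ip_ex.
Qed.

Lemma ip_lin (w f g h : nat -> R) (a b : R) :
  (forall j, 0 < w j) -> l2 w f -> l2 w g -> l2 w h ->
  ip w (fun j => a * f j + b * g j) h = a * ip w f h + b * ip w g h.
Proof.
  intros Hw Hf Hg Hh; unfold ip.
  rewrite <- !Series_scal_l, <- Series_plus.
  - apply Series_ext; intros j; ring.
  - apply (ex_series_scal (V := R_NormedModule) a); auto using ip_ex.
  - apply (ex_series_scal (V := R_NormedModule) b); auto using ip_ex.
Qed.

Lemma ip_pos (w f : nat -> R) : (forall j, 0 < w j) -> l2 w f -> 0 <= ip w f f.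
Proof.
  intros Hw Hf; apply Series_nonneg.
  - intros j; specialize (Hw j); generalize (pow2_ge_0 (f j)); nra.
  - now apply ip_ex.
Qed.

Lemma ip_zero (w f : nat -> R) :
  (forall j, 0 < w j) -> l2 w f -> ip w f f = 0 -> forall j, f j = 0.
Proof.
  intros Hw Hf H0 j.
  assert (H : w j * (f j * f j) <= ip w f f).
  { apply (Series_term_le (fun j => w j * (f j * f j)) j).
    - intros i; specialize (Hw i); generalize (pow2_ge_0 (f i)); nra.
    - now apply ip_ex. }
  rewrite H0 in H; specialize (Hw j).
  assert (f j * f j <= 0) by (apply Rmult_le_reg_l with (w j); lra); nra.
Qed.

(** The quadratic form [|a f + b g| ^ 2] is nonnegative; its discriminant is the claim. *)
Lemma Cauchy_Schwarz (w f g : nat -> R) :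
  (forall j, 0 < w j) -> l2 w f -> l2 w g ->
  ip w f g ^ 2 <= ip w f f * ip w g g.
Proof.
  intros Hw Hf Hg.
  set (A := ip w f f); set (B := ip w f g); set (C := ip w g g).
  assert (Hq : forall a b, 0 <= a * a * A + 2 * (a * b) * B + b * b * C).
  { intros a b.
    assert (Hl := l2_lin w f g a b Hw Hf Hg).
    assert (H := ip_pos w _ Hw Hl).
    rewrite ip_lin in H by assumption.
    rewrite (ip_sym w f), (ip_sym w g), !ip_lin in H by assumption.
    rewrite (ip_sym w g f) in H; fold A B C in H; lra. }
  assert (HA : 0 <= A) by now apply ip_pos.
  assert (HC : 0 <= C) by now apply ip_pos.
  destruct (Req_dec C 0) as [HC0|HC0].
  - destruct (Req_dec B 0) as [HB0|HB0]; [rewrite HB0, HC0; lra|].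
    generalize (Hq 1 (- ((A + 1) / (2 * B)))); rewrite HC0.
    replace (1 * 1 * A + _ + _) with (-1) by (field; exact HB0); lra.
  - generalize (Hq C (- B)); intros H.
    assert (0 <= C * (A * C - B ^ 2)) by nra.
    assert (0 <= A * C - B ^ 2) by (apply Rmult_le_reg_l with C; lra); lra.
Qed.

(** Each finite partial sum passes to the limit, so the bound survives pointwise convergence.
    It puts the residual of an expansion back into the space. *)
Lemma l2_Fatou (w : nat -> R) (u : nat -> nat -> R) (v : nat -> R) (B : R) (K : nat) :
  (forall j, 0 < w j) -> (forall M, l2 w (u M)) ->
  (forall M, (K <= M)%nat -> ip w (u M) (u M) <= B) ->
  (forall j, is_lim_seq (fun M => u M j) (v j)) ->
  l2 w v /\ ip w v v <= B.
Proof.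
  intros Hw Hu HB Hlim.
  assert (H0 : forall f j, 0 <= w j * f j ^ 2).
  { intros f j; specialize (Hw j); generalize (pow2_ge_0 (f j)); nra. }
  assert (Hip : forall f, ip w f f = Series (fun j => w j * f j ^ 2)).
  { intros f; apply Series_ext; intros j; ring. }
  rewrite Hip; apply ex_series_bounded; [apply H0|]; intros n.
  assert (Hl : is_lim_seq (fun M => sum_n (fun j => w j * u M j ^ 2) n)
                 (sum_n (fun j => w j * v j ^ 2) n)).
  { induction n as [|n IH].
    - apply is_lim_seq_ext with (fun M => w 0%nat * u M 0%nat ^ 2).
      { intros M; now rewrite sum_O. }
      rewrite sum_O; simpl.
      apply is_lim_seq_mult'; [apply is_lim_seq_const|].
      repeat apply is_lim_seq_mult'; auto; apply is_lim_seq_const.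
    - apply is_lim_seq_ext with (fun M =>
        sum_n (fun j => w j * u M j ^ 2) n + w (S n) * u M (S n) ^ 2).
      { intros M; now rewrite sum_Sn. }
      rewrite sum_Sn; apply is_lim_seq_plus'; [exact IH|].
      apply is_lim_seq_mult'; [apply is_lim_seq_const|].
      repeat apply is_lim_seq_mult'; auto; apply is_lim_seq_const. }
  change (Rbar_le (sum_n (fun j => w j * v j ^ 2) n) B).
  apply is_lim_seq_le_loc with (2 := Hl) (3 := is_lim_seq_const B).
  exists K; intros M HM.
  apply Rle_trans with (2 := HB M HM); rewrite Hip.
  apply sum_n_le_Series; [apply H0|apply Hu].
Qed.

Definition orthonormal (w : nat -> R) (e : nat -> nat -> R) : Prop :=
  (forall k, l2 w (e k)) /\
  (forall k m, ip w (e k) (e m) = if Nat.eqb k m then 1 else 0).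

Definition lincomb (c : nat -> R) (e : nat -> nat -> R) (K j : nat) : R :=
  sum_n (fun k => c k * e k j) K.

Lemma lincomb_l2 (w c : nat -> R) (e : nat -> nat -> R) (K : nat) :
  (forall j, 0 < w j) -> (forall k, l2 w (e k)) -> l2 w (lincomb c e K).
Proof.
  intros Hw He; induction K as [|K IH]; unfold l2.
  - apply ex_series_ext with
      (fun j => w j * (c 0%nat * e 0%nat j + 0 * e 0%nat j) ^ 2).
    { intros j; unfold lincomb; rewrite sum_O; as_real; ring. }
    now apply l2_lin.
  - apply ex_series_ext with
      (fun j => w j * (1 * lincomb c e K j + c (S K) * e (S K) j) ^ 2).
    { intros j; unfold lincomb; rewrite sum_Sn; unfold plus; simpl; as_real; ring. }
    now apply l2_lin.
Qed.

Lemma lincomb_ip (w c g : nat -> R) (e : nat -> nat -> R) (K : nat) :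
  (forall j, 0 < w j) -> (forall k, l2 w (e k)) -> l2 w g ->
  ip w (lincomb c e K) g = sum_n (fun k => c k * ip w (e k) g) K.
Proof.
  intros Hw He Hg; induction K as [|K IH].
  - rewrite sum_O; unfold ip; rewrite <- Series_scal_l.
    apply Series_ext; intros j; unfold lincomb; rewrite sum_O; ring.
  - rewrite sum_Sn, <- IH; unfold plus; simpl.
    rewrite <- (Rmult_1_l (ip w (lincomb c e K) g)), <- ip_lin;
      auto using lincomb_l2.
    apply Series_ext; intros j; unfold lincomb; rewrite sum_Sn.
    unfold plus; simpl; ring.
Qed.

Lemma sum_n_delta (c : nat -> R) (m K : nat) :
  sum_n (fun k => c k * (if Nat.eqb k m then 1 else 0)) K =
  if Nat.leb m K then c m else 0.
Proof.
  induction K as [|K IH].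
  - rewrite sum_O; destruct m; simpl; ring.
  - rewrite sum_Sn, IH; unfold plus; simpl plus.
    destruct (Nat.eqb_spec (S K) m) as [<-|Hne].
    + rewrite (proj2 (Nat.leb_gt (S K) K)), Nat.leb_refl by lia; simpl; ring.
    + destruct (Nat.leb_spec m K); destruct (Nat.leb_spec m (S K));
        try lia; simpl; ring.
Qed.

Lemma lincomb_coef (w c : nat -> R) (e : nat -> nat -> R) (K m : nat) :
  (forall j, 0 < w j) -> orthonormal w e -> (m <= K)%nat ->
  ip w (lincomb c e K) (e m) = c m.
Proof.
  intros Hw [He Ho] HmK; rewrite lincomb_ip by auto.
  rewrite (sum_n_ext _ (fun k => c k * (if Nat.eqb k m then 1 else 0)))
    by (intros k; now rewrite Ho).
  now rewrite sum_n_delta, (proj2 (Nat.leb_le m K)).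
Qed.

Lemma lincomb_ip_lincomb (w c : nat -> R) (e : nat -> nat -> R) (K M : nat) :
  (forall j, 0 < w j) -> orthonormal w e -> (K <= M)%nat ->
  ip w (lincomb c e K) (lincomb c e M) = sum_n (fun k => c k ^ 2) K.
Proof.
  intros Hw Ho HKM; rewrite lincomb_ip; [|exact Hw|apply Ho|].
  2: { apply lincomb_l2; [exact Hw|apply Ho]. }
  apply sum_n_ext_loc; intros k Hk.
  rewrite ip_sym, lincomb_coef by (assumption || lia); as_real; ring.
Qed.

Lemma ip_diff (w f g : nat -> R) :
  (forall j, 0 < w j) -> l2 w f -> l2 w g ->
  l2 w (fun j => f j - g j) /\
  ip w (fun j => f j - g j) (fun j => f j - g j) =
    ip w f f - 2 * ip w f g + ip w g g.
Proof.
  intros Hw Hf Hg.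
  assert (Hl := l2_lin w f g 1 (-1) Hw Hf Hg).
  assert (E : forall h, ip w (fun j => f j - g j) h =
    ip w (fun j => 1 * f j + -1 * g j) h)
    by (intros h; apply Series_ext; intros j; ring).
  split.
  { apply ex_series_ext with (2 := Hl); intros j; as_real; ring. }
  rewrite E, (ip_sym w _ (fun j => f j - g j)), E.
  rewrite ip_lin by assumption.
  rewrite (ip_sym w f), (ip_sym w g), !ip_lin by assumption.
  rewrite (ip_sym w g f); ring.
Qed.

(** The squared distance from [f] to its partial expansion is nonnegative. *)
Lemma Bessel (w f : nat -> R) (e : nat -> nat -> R) :
  (forall j, 0 < w j) -> orthonormal w e -> l2 w f ->
  ex_series (fun k => ip w f (e k) ^ 2) /\
  Series (fun k => ip w f (e k) ^ 2) <= ip w f f.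
Proof.
  intros Hw Ho Hf; apply ex_series_bounded; [intros; apply pow2_ge_0|].
  intros K; set (c := fun k => ip w f (e k)).
  assert (Hl := lincomb_l2 w c e K Hw (proj1 Ho)).
  destruct (ip_diff w f (lincomb c e K) Hw Hf Hl) as [Hd E].
  assert (H := ip_pos w _ Hw Hd); rewrite E in H.
  rewrite lincomb_ip_lincomb, (ip_sym w f (lincomb c e K)), lincomb_ip in H
    by (assumption || apply Ho || lia).
  rewrite (sum_n_ext _ (fun k => c k ^ 2)) in H.
  2: { intros k; rewrite (ip_sym w (e k) f); fold (c k); as_real; ring. }
  change (sum_n (fun k => c k ^ 2) K <= ip w f f); lra.
Qed.

(** Riesz-Fischer: the orthogonal residual of [f] is again square summable, so a
    family with no orthogonal complement expands every [f]. The residual agrees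
    with [f] at each index where all members of the family vanish. *)
Lemma Parseval_of_complete (w f g : nat -> R) (e : nat -> nat -> R) :
  (forall j, 0 < w j) -> orthonormal w e -> l2 w f -> l2 w g ->
  (forall v, l2 w v -> (forall k, ip w v (e k) = 0) ->
     (forall j, (forall k, e k j = 0) -> v j = f j) -> forall j, v j = 0) ->
  ex_series (fun k => Rabs (ip w f (e k) * ip w g (e k))) /\
  Series (fun k => ip w f (e k) * ip w g (e k)) = ip w f g.
Proof.
  intros Hw Ho Hf Hg Hcomp.
  set (c := fun k => ip w f (e k)).
  assert (Hc : ex_series (fun k => c k ^ 2)) by now apply Bessel.
  assert (Habs : forall a : nat -> R, ex_series (fun k => a k ^ 2) ->
    ex_series (fun k => Rabs (c k * a k))).
  { intros a Ha; apply ex_series_dom with (fun k => c k ^ 2 + a k ^ 2).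
    - intros k; rewrite Rabs_Rabsolu, Rabs_mult.
      rewrite <- (pow2_abs (c k)), <- (pow2_abs (a k)).
      generalize (Rabs_pos (c k)) (Rabs_pos (a k)); nra.
    - now apply (ex_series_plus (V := R_NormedModule)). }
  (* Bessel for a multiple of the indicator of [j] gives square summability of [e k j] in [k]. *)
  assert (Hpt : forall j, ex_series (fun k => c k * e k j)).
  { intros j; apply ex_series_Rabs, Habs.
    set (dl := fun i => if Nat.eqb i j then / w j else 0).
    assert (Hs : forall h : nat -> R,
      is_series (fun i => h i * dl i) (h j * / w j)).
    { intros h; change (is_lim_seq (sum_n (fun i => h i * dl i)) (h j * / w j)).
      apply is_lim_seq_ext_loc with (fun _ => h j * / w j);
        [|apply is_lim_seq_const].
      exists j; intros n Hn.
      rewrite (sum_n_ext _ (fun i =>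
        (h i * / w j) * (if Nat.eqb i j then 1 else 0))).
      - now rewrite sum_n_delta, (proj2 (Nat.leb_le j n)).
      - intros i; unfold dl; destruct (Nat.eqb i j); as_real; ring. }
    assert (Hdl : l2 w dl).
    { exists (w j * dl j * / w j).
      apply is_series_ext with (fun i => (w i * dl i) * dl i); [intros; as_real; ring|].
      apply (Hs (fun i => w i * dl i)). }
    assert (Hdle : forall k, ip w dl (e k) = e k j).
    { intros k; unfold ip; apply is_series_unique.
      apply is_series_ext with (fun i => (w i * e k i) * dl i); [intros; as_real; ring|].
      replace (e k j) with ((w j * e k j) * / w j)
        by (field; specialize (Hw j); lra).
      apply (Hs (fun i => w i * e k i)). }
    apply ex_series_ext with (fun k => ip w dl (e k) ^ 2);
      [intros k; now rewrite Hdle|].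
    now apply Bessel. }
  set (v := fun j => f j - Series (fun k => c k * e k j)).
  set (u := fun K j => f j - lincomb c e K j).
  assert (Hlc : forall K, l2 w (lincomb c e K))
    by (intros K; apply lincomb_l2; [exact Hw|apply Ho]).
  assert (Hu : forall K, l2 w (u K)) by (intros K; now apply ip_diff).
  assert (Huv : forall j, is_lim_seq (fun K => u K j) (v j)).
  { intros j; apply is_lim_seq_minus'; [apply is_lim_seq_const|].
    apply (is_lim_seq_sum_n (fun k => c k * e k j)), Hpt. }
  set (tau := fun K => Series (fun k => c k ^ 2) - sum_n (fun k => c k ^ 2) K).
  assert (Htau : is_lim_seq tau 0).
  { replace 0 with (Series (fun k => c k ^ 2) - Series (fun k => c k ^ 2)) by ring.
    apply is_lim_seq_minus'; [apply is_lim_seq_const|].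
    now apply is_lim_seq_sum_n. }
  assert (Hdiff : forall K, l2 w (fun j => u K j - v j) /\
    ip w (fun j => u K j - v j) (fun j => u K j - v j) <= tau K).
  { intros K; apply l2_Fatou with (u := fun M j => u K j - u M j) (K := K).
    - exact Hw.
    - intros M; now apply ip_diff.
    - intros M HM; destruct (ip_diff w (lincomb c e M) (lincomb c e K) Hw
        (Hlc M) (Hlc K)) as [_ E].
      replace (ip w _ _) with
        (ip w (fun j => lincomb c e M j - lincomb c e K j)
              (fun j => lincomb c e M j - lincomb c e K j))
        by (apply Series_ext; intros j; unfold u; ring).
      rewrite E, (ip_sym w (lincomb c e M) (lincomb c e K)).
      rewrite !lincomb_ip_lincomb by (assumption || lia).
      unfold tau; generalize (sum_n_le_Series (fun k => c k ^ 2) M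
        (fun k => pow2_ge_0 (c k)) Hc); lra.
    - intros j; apply is_lim_seq_minus'; [apply is_lim_seq_const|apply Huv]. }
  assert (Hv : l2 w v).
  { apply ex_series_ext with (fun j => w j * (1 * u 0%nat j + -1 * (u 0%nat j - v j)) ^ 2).
    - intros j; as_real; ring.
    - apply l2_lin; [exact Hw|apply Hu|apply Hdiff]. }
  assert (Hlim : forall h, l2 w h -> is_lim_seq (fun K => ip w (u K) h) (ip w v h)).
  { intros h Hh; apply is_lim_seq_spec; intros eps; simpl.
    set (H2 := ip w h h).
    assert (HH : 0 <= H2) by now apply ip_pos.
    assert (Hd : 0 < eps ^ 2 / (H2 + 1)).
    { apply Rdiv_lt_0_compat; [apply pow_lt, cond_pos|lra]. }
    apply is_lim_seq_spec in Htau; destruct (Htau (mkposreal _ Hd)) as [N HN].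
    exists N; intros K HK; specialize (HN K HK); simpl in HN.
    rewrite Rminus_0_r in HN; apply Rabs_def2 in HN.
    destruct (Hdiff K) as [HdK HtK].
    assert (E : ip w (fun j => u K j - v j) h = ip w (u K) h - ip w v h).
    { transitivity (ip w (fun j => 1 * u K j + -1 * v j) h);
        [apply Series_ext; intros j; ring|].
      rewrite ip_lin by auto; ring. }
    rewrite <- E.
    assert (HCS := Cauchy_Schwarz w _ h Hw HdK Hh); fold H2 in HCS.
    set (X := ip w (fun j => u K j - v j) h) in *.
    assert (HX : X ^ 2 < eps ^ 2).
    { apply Rle_lt_trans with (1 := HCS).
      apply Rle_lt_trans with (tau K * (H2 + 1)).
      - assert (HP := ip_pos w _ Hw HdK).
        set (Y := ip w (fun j => u K j - v j) (fun j => u K j - v j)) in *.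
        apply Rle_trans with (Y * (H2 + 1)); nra.
      - replace (eps ^ 2) with (eps ^ 2 / (H2 + 1) * (H2 + 1)) by (field; lra).
        apply Rmult_lt_compat_r; lra. }
    assert (He := cond_pos eps); apply Rabs_def1; nra. }
  assert (Hv0 : forall j, v j = 0).
  { apply Hcomp; [exact Hv| |].
    - intros m.
      assert (HL := Hlim (e m) (proj1 Ho m)).
      assert (HL' : is_lim_seq (fun K => ip w (u K) (e m)) 0).
      { apply is_lim_seq_ext_loc with (fun _ => 0); [|apply is_lim_seq_const].
        exists m; intros K HK.
        transitivity (ip w (fun j => 1 * f j + -1 * lincomb c e K j) (e m)).
        - rewrite ip_lin, lincomb_coef by (auto || apply Ho).
          fold (c m); ring.
        - apply Series_ext; intros j; unfold u; ring. }
      apply is_lim_seq_unique in HL; apply is_lim_seq_unique in HL'.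
      rewrite HL in HL'; now injection HL'.
    - intros j Hj; unfold v; rewrite (Series_ext _ (fun _ => 0 * 0)).
      + rewrite Series_scal_l; ring.
      + intros k; rewrite Hj; ring. }
  split; [apply (Habs (fun k => ip w g (e k))); now apply Bessel|].
  apply is_series_unique.
  change (is_lim_seq (sum_n (fun k => c k * ip w g (e k))) (ip w f g)).
  assert (HL := Hlim g Hg).
  replace (ip w v g) with 0 in HL.
  2: { unfold ip; rewrite (Series_ext _ (fun j => 0 * 0)).
       - rewrite Series_scal_l; ring.
       - intros j; rewrite Hv0; ring. }
  apply is_lim_seq_ext with (fun K => ip w f g - ip w (u K) g).
  - intros K; rewrite (sum_n_ext _ (fun k => c k * ip w (e k) g))
      by (intros k; now rewrite (ip_sym w g)).
    rewrite <- (lincomb_ip w c g e K) by (auto || apply Ho).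
    transitivity (ip w f g - ip w (fun j => 1 * f j + -1 * lincomb c e K j) g).
    + f_equal; apply Series_ext; intros j; unfold u; ring.
    + rewrite ip_lin by auto; ring.
  - replace (Finite (ip w f g)) with (Finite (ip w f g - 0)) by (f_equal; ring).
    now apply is_lim_seq_minus'; [apply is_lim_seq_const|].
Qed.

(** * Complex derivatives by difference quotients *)

Lemma C_derive_eps (G : C -> C) (x l : C) :
  (forall eps, 0 < eps -> exists d, 0 < d /\ forall y, Cmod (y - x) < d ->
     Cmod (G y - G x - (y - x) * l) <= eps * Cmod (y - x)) <->
  is_derive (K := C_AbsRing) (V := C_NormedModule) G x l.
Proof.
  split.
  - intros H; split; [apply (is_linear_scal_l (K := C_AbsRing) l)|].
    intros x' Hx' eps.
    assert (E : x' = x) by (symmetry; now apply is_filter_lim_locally_unique).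
    subst x'.
    destruct (H eps (cond_pos eps)) as [d [Hd Hy]].
    exists (mkposreal d Hd); intros y Hb; exact (Hy y Hb).
  - intros [_ H] eps He.
    destruct (H x (fun P HP => HP) (mkposreal eps He)) as [d Hd].
    exists d; split; [apply cond_pos|]; intros y Hy; exact (Hd y Hy).
Qed.

Lemma C_ball_le (x y : C) (eps : R) : Cmod (y - x) < eps -> ball x eps y.
Proof. exact (C_NormedModule_mixin_compat1 x y eps). Qed.

Lemma C_filterlim_seq (u : nat -> C) (l : C) :
  filterlim u eventually (locally l) <->
  is_lim_seq (fun n => Cmod (u n - l)) 0.
Proof.
  split.
  - intros H; apply is_lim_seq_spec; intros eps.
    assert (He : 0 < eps / 2) by (generalize (cond_pos eps); lra).
    assert (H' := proj1 (filterlim_locally u l) H (mkposreal _ He)).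
    revert H'; apply filter_imp; intros n Hn.
    rewrite Rminus_0_r, Rabs_pos_eq by apply Cmod_ge_0.
    assert (Hs : Cmod (u n - l) < sqrt 2 * (eps / 2))
      by exact (C_NormedModule_mixin_compat2 l (u n) (mkposreal _ He) Hn).
    assert (sqrt 2 < 2) by (apply sqrt_less; lra).
    nra.
  - intros H; apply filterlim_locally; intros eps.
    apply is_lim_seq_spec in H; generalize (H eps); apply filter_imp.
    intros n Hn; rewrite Rminus_0_r, Rabs_pos_eq in Hn by apply Cmod_ge_0.
    now apply C_ball_le.
Qed.

(** A difference quotient that is Lipschitz off the base point has a limit there,
    because the complex plane is complete. *)
Lemma ex_derive_of_Lipschitz_quotient (G : C -> C) (x : C) (K : R) :
  (forall y z, y <> x -> z <> x -> Cmod (y - x) < 1 -> Cmod (z - x) < 1 ->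
    Cmod ((G y - G x) / (y - x) - (G z - G x) / (z - x)) <= K * Cmod (y - z)) ->
  ex_derive (K := C_AbsRing) (V := C_NormedModule) G x.
Proof.
  intros HL.
  set (Q := fun y : C => ((G y - G x) / (y - x))%C).
  (* A sequence in the punctured unit ball that tends to the base point. *)
  set (s := fun n : nat => (x + RtoC (/ (INR n + 2)))%C).
  assert (Hpos : forall n, 0 < / (INR n + 2))
    by (intros n; apply Rinv_0_lt_compat; generalize (pos_INR n); lra).
  assert (Hsx : forall n, Cmod (s n - x) = / (INR n + 2)).
  { intros n; unfold s; replace (x + _ - x)%C with (RtoC (/ (INR n + 2))) by ring.
    rewrite Cmod_R; apply Rabs_pos_eq, Rlt_le, Hpos. }
  assert (Hs1 : forall n, Cmod (s n - x) < 1).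
  { intros n; rewrite Hsx, <- Rinv_1 at 1; apply Rinv_lt_contravar;
      generalize (pos_INR n); lra. }
  assert (Hsne : forall n, s n <> x).
  { intros n E; assert (H := Hsx n); rewrite E in H.
    replace (x - x)%C with (RtoC 0) in H by ring.
    rewrite Cmod_0 in H; generalize (Hpos n); lra. }
  assert (HK : 0 <= K).
  { assert (H := HL (s 0%nat) (s 1%nat) (Hsne _) (Hsne _) (Hs1 _) (Hs1 _)).
    assert (0 < Cmod (s 0%nat - s 1%nat)).
    { unfold s; replace (x + _ - _)%C with (RtoC (/ (INR 0 + 2) - / (INR 1 + 2)))
        by (rewrite RtoC_minus; ring).
      rewrite Cmod_R; apply Rabs_pos_lt; simpl; lra. }
    generalize (Cmod_ge_0 ((G (s 0%nat) - G x) / (s 0%nat - x)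
      - (G (s 1%nat) - G x) / (s 1%nat - x))); nra. }
  assert (Hlim : is_lim_seq (fun n => / (INR n + 2)) 0).
  { replace (Finite 0) with (Rbar_inv p_infty) by reflexivity.
    apply is_lim_seq_inv; [|easy].
    apply is_lim_seq_plus with p_infty 2; [apply is_lim_seq_INR
      |apply is_lim_seq_const|easy]. }
  assert (Hcauchy : exists l : C, filterlim (fun n => Q (s n)) eventually (locally l)).
  { apply (filterlim_locally_cauchy (U := C_CompleteNormedModule)); intros eps.
    assert (He : 0 < eps / (2 * (K + 1)))
      by (apply Rdiv_lt_0_compat; [apply cond_pos|lra]).
    apply is_lim_seq_spec in Hlim.
    exists (fun n => Rabs (/ (INR n + 2) - 0) < eps / (2 * (K + 1))); split.
    { exact (Hlim (mkposreal _ He)). }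
    intros n m Hn Hm; rewrite Rminus_0_r, Rabs_pos_eq in Hn, Hm
      by (apply Rlt_le, Hpos).
    apply C_ball_le.
    apply Rle_lt_trans with (1 := HL _ _ (Hsne m) (Hsne n) (Hs1 m) (Hs1 n)).
    apply Rle_lt_trans with (K * (Cmod (s m - x) + Cmod (s n - x))).
    - apply Rmult_le_compat_l; [exact HK|].
      replace (s m - s n)%C with ((s m - x) + - (s n - x))%C by ring.
      rewrite <- (Cmod_opp (s n - x)); apply Cmod_triangle.
    - rewrite !Hsx; apply Rle_lt_trans with (K * (eps / (K + 1))).
      + apply Rmult_le_compat_l; [exact HK|].
        replace (eps / (K + 1)) with (eps / (2 * (K + 1)) + eps / (2 * (K + 1)))
          by (field; lra); lra.
      + replace (pos eps) with ((K + 1) * (eps / (K + 1))) at 2 by (field; lra).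
        apply Rmult_lt_compat_r; [|lra].
        apply Rdiv_lt_0_compat; [apply cond_pos|lra]. }
  destruct Hcauchy as [l Hl]; exists l; apply C_derive_eps; intros eps He.
  apply C_filterlim_seq in Hl.
  assert (HQ : forall y, y <> x -> Cmod (y - x) < 1 ->
    Cmod (Q y - l) <= K * Cmod (y - x)).
  { intros y Hy Hy1.
    assert (HLe : Rbar_le (Cmod (Q y - l)) (K * Cmod (y - x))).
    { apply is_lim_seq_le with (fun _ => Cmod (Q y - l))
        (fun n => K * (Cmod (y - x) + / (INR n + 2)) + Cmod (Q (s n) - l)).
      - intros n.
        apply Rle_trans with (Cmod (Q y - Q (s n)) + Cmod (Q (s n) - l)).
        { replace (Q y - l)%C with ((Q y - Q (s n)) + (Q (s n) - l))%C by ring.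
          apply Cmod_triangle. }
        apply Rplus_le_compat_r.
        apply Rle_trans with (1 := HL _ _ Hy (Hsne n) Hy1 (Hs1 n)).
        apply Rmult_le_compat_l; [exact HK|].
        rewrite <- Hsx, <- (Cmod_opp (s n - x)).
        replace (y - s n)%C with ((y - x) + - (s n - x))%C by ring.
        apply Cmod_triangle.
      - apply is_lim_seq_const.
      - replace (Finite (K * Cmod (y - x)))
          with (Finite (K * (Cmod (y - x) + 0) + 0)) by (f_equal; ring).
        apply is_lim_seq_plus'; [|exact Hl].
        apply is_lim_seq_mult'; [apply is_lim_seq_const|].
        apply is_lim_seq_plus'; [apply is_lim_seq_const|exact Hlim]. }
    exact HLe. }
  exists (Rmin 1 (eps / (K + 1))); split.
  { apply Rmin_pos; [lra|apply Rdiv_lt_0_compat; lra]. }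
  intros y Hy.
  assert (Hy1 := Rlt_le_trans _ _ _ Hy (Rmin_l _ _)).
  assert (Hy2 := Rlt_le_trans _ _ _ Hy (Rmin_r _ _)).
  destruct (Ceq_dec y x) as [->|Hne].
  { replace (G x - G x - (x - x) * l)%C with (RtoC 0) by ring.
    rewrite Cmod_0; apply Rmult_le_pos; [lra|apply Cmod_ge_0]. }
  assert (Hd : (y - x)%C <> 0%C).
  { intros E; apply Hne; replace y with ((y - x) + x)%C by ring; rewrite E; ring. }
  replace (G y - G x - (y - x) * l)%C with ((Q y - l) * (y - x))%C
    by (unfold Q; field; exact Hd).
  rewrite Cmod_mult; apply Rmult_le_compat_r; [apply Cmod_ge_0|].
  apply Rle_trans with (1 := HQ y Hne Hy1).
  replace eps with ((K + 1) * (eps / (K + 1))) by (field; lra).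
  generalize (Cmod_ge_0 (y - x)); nra.
Qed.

(** Transfers holomorphy to the real line, where the Riccati argument takes place. *)
Lemma is_derive_Re (G : C -> C) (x : R) (l : C) :
  is_derive (K := C_AbsRing) (V := C_NormedModule) G (RtoC x) l ->
  is_derive (fun t : R => Re (G (RtoC t))) x (Re l).
Proof.
  intros H; generalize (proj2 (C_derive_eps _ _ _) H); clear H; intros H.
  split; [apply (is_linear_scal_l (K := R_AbsRing) (Re l))|].
  intros x' Hx' eps.
  assert (E : x' = x) by (symmetry; now apply is_filter_lim_locally_unique).
  subst x'; destruct (H eps (cond_pos eps)) as [d [Hd Hy]].
  exists (mkposreal d Hd); intros y Hb.
  assert (Hc : forall t : R, Cmod (RtoC t - RtoC x) = Rabs (t - x))
    by (intros t; now rewrite <- RtoC_minus, Cmod_R).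
  specialize (Hy (RtoC y)); rewrite Hc in Hy; specialize (Hy Hb).
  apply Rle_trans with (2 := Hy).
  apply Rle_trans with (2 := re_le_Cmod _); apply Req_le.
  unfold norm; simpl; unfold abs, minus, plus, opp, scal; simpl.
  unfold mult; simpl; f_equal; destruct l as [l1 l2].
  destruct (G (RtoC y)), (G (RtoC x)); simpl; ring.
Qed.

(** * The three-term recurrence and its growth *)

(** Sums over indices strictly below [n], so that [psum a 0 = 0]; the Gronwall inductions
    start from the empty sum. *)
Fixpoint psum (a : nat -> R) (n : nat) : R :=
  match n with O => 0 | S k => psum a k + a k end.

Lemma psum_bounds (a : nat -> R) (n : nat) :
  (forall j, 0 <= a j) -> ex_series a -> 0 <= psum a n <= Series a.
Proof.
  intros Ha Hs.
  assert (E : forall k, psum a (S k) = sum_n a k).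
  { induction k as [|k IH]; [rewrite sum_O; simpl; ring|].
    rewrite sum_Sn, <- IH; reflexivity. }
  split.
  - induction n as [|n IH]; simpl; [lra|specialize (Ha n); lra].
  - destruct n as [|n]; [now apply Series_nonneg|].
    rewrite E; now apply sum_n_le_Series.
Qed.

(** Gronwall for a second-order inequality, run from infinity towards [0]: the
    pair [max (m n) (m (S n))] shrinks by at most the factor [1 + b n]. *)
Lemma Gronwall_backward (m b c : nat -> R) (L : R) :
  (forall j, 0 <= m j) -> (forall j, 0 <= b j) -> (forall j, 0 <= c j) ->
  ex_series b -> ex_series c ->
  (forall j, m j <= m (S (S j)) + b j * m (S j) + c j) ->
  (forall eps, 0 < eps -> exists N, forall n, (N <= n)%nat -> m n <= L + eps) ->
  forall j, m j <= exp (Series b) * (L + Series c).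
Proof.
  intros Hm Hb Hc Sb Sc Hrec HL j.
  set (M := fun n => Rmax (m n) (m (S n))).
  assert (HM : forall n, M n <= (1 + b n) * M (S n) + c n).
  { intros n; unfold M.
    generalize (Rmax_l (m (S n)) (m (S (S n)))) (Rmax_r (m (S n)) (m (S (S n)))).
    set (X := Rmax (m (S n)) (m (S (S n)))); intros H1 H2.
    specialize (Hrec n); specialize (Hb n); specialize (Hc n).
    generalize (Hm (S n)); intros H3.
    apply Rmax_lub; nra. }
  assert (HM0 : forall n, 0 <= M n)
    by (intros n; apply Rle_trans with (m n); [apply Hm|apply Rmax_l]).
  assert (Hk : forall k, M j <= exp (psum b (j + k) - psum b j) *
    (M (j + k)%nat + (psum c (j + k) - psum c j))).
  { induction k as [|k IH].
    - rewrite Nat.add_0_r, !Rminus_diag, exp_0; lra.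
    - apply Rle_trans with (1 := IH).
      rewrite Nat.add_succ_r; simpl psum.
      replace (psum b (j + k) + b (j + k)%nat - psum b j)
        with (psum b (j + k) - psum b j + b (j + k)%nat) by ring.
      rewrite exp_plus, Rmult_assoc; apply Rmult_le_compat_l;
        [apply Rlt_le, exp_pos|].
      specialize (HM (j + k)%nat); specialize (HM0 (S (j + k))).
      assert (He : 1 + b (j + k)%nat <= exp (b (j + k)%nat)) by apply exp_ineq1_le.
      assert (Hb' := Hb (j + k)%nat); assert (Hc' := Hc (j + k)%nat).
      assert (Hd : 0 <= psum c (j + k) - psum c j).
      { clear -Hc; induction k as [|k IH]; [rewrite Nat.add_0_r; lra|].
        rewrite Nat.add_succ_r; simpl; specialize (Hc (j + k)%nat); lra. }
      assert ((1 + b (j + k)%nat) * M (S (j + k)) <=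
        exp (b (j + k)%nat) * M (S (j + k))) by now apply Rmult_le_compat_r.
      nra. }
  assert (HL0 : 0 <= L).
  { apply Rnot_lt_le; intros Hlt; destruct (HL (- L / 2)) as [N HN]; [lra|].
    specialize (HN N (le_n N)); specialize (Hm N); lra. }
  apply le_epsilon; intros eps He.
  assert (Hexp := exp_pos (Series b)).
  destruct (HL (eps / exp (Series b))) as [N HN];
    [now apply Rdiv_lt_0_compat|].
  apply Rle_trans with (M j); [apply Rmax_l|].
  apply Rle_trans with (1 := Hk N).
  assert (B1 := psum_bounds b (j + N) Hb Sb); assert (B2 := psum_bounds b j Hb Sb).
  assert (C1 := psum_bounds c (j + N) Hc Sc); assert (C2 := psum_bounds c j Hc Sc).
  assert (HMN : M (j + N)%nat <= L + eps / exp (Series b))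
    by (apply Rmax_lub; apply HN; lia).
  apply Rle_trans with
    (exp (Series b) * ((L + eps / exp (Series b)) + Series c)).
  - apply Rmult_le_compat.
    + apply Rlt_le, exp_pos.
    + assert (Hd : 0 <= psum c (j + N) - psum c j).
      { clear -Hc; induction N as [|k IH]; [rewrite Nat.add_0_r; lra|].
        rewrite Nat.add_succ_r; simpl; specialize (Hc (j + k)%nat); lra. }
      specialize (HM0 (j + N)%nat); lra.
    + destruct (Req_dec (psum b (j + N) - psum b j) (Series b)) as [->|Hne]; [lra|].
      apply Rlt_le, exp_increasing; lra.
    + lra.
  - apply Req_le; field; lra.
Qed.

Lemma Gronwall_forward (m b c : nat -> R) :
  (forall j, 0 <= m j) -> (forall j, 0 <= b j) -> (forall j, 0 <= c j) ->
  ex_series b -> ex_series c ->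
  (forall j, m (S (S j)) <= m j + b j * m (S j) + c j) ->
  forall j, m j <= exp (Series b) * (m 0%nat + m 1%nat + Series c).
Proof.
  intros Hm Hb Hc Sb Sc Hrec j.
  set (M := fun n => Rmax (m n) (m (S n))).
  assert (HM : forall n, M (S n) <= (1 + b n) * M n + c n).
  { intros n; unfold M.
    generalize (Rmax_l (m n) (m (S n))) (Rmax_r (m n) (m (S n))).
    set (X := Rmax (m n) (m (S n))); intros H1 H2.
    specialize (Hrec n); specialize (Hb n); specialize (Hc n).
    generalize (Hm n) (Hm (S n)); intros H3 H4.
    apply Rmax_lub; nra. }
  assert (Hk : forall n, M n <= exp (psum b n) * (m 0%nat + m 1%nat + psum c n)).
  { induction n as [|n IH].
    - simpl; rewrite exp_0; unfold M.
      generalize (Hm 0%nat) (Hm 1%nat); intros; apply Rmax_case; lra.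
    - apply Rle_trans with (1 := HM n); simpl psum; rewrite exp_plus.
      assert (He : 1 + b n <= exp (b n)) by apply exp_ineq1_le.
      assert (B1 := psum_bounds b n Hb Sb); assert (C1 := psum_bounds c n Hc Sc).
      assert (HE : 1 <= exp (psum b n))
        by (generalize (exp_ineq1_le (psum b n)); lra).
      specialize (Hb n); specialize (Hc n).
      set (Y := exp (psum b n)) in *; set (Z := exp (b n)) in *.
      set (U := m 0%nat + m 1%nat + psum c n) in *.
      replace (m 0%nat + m 1%nat + (psum c n + c n)) with (U + c n)
        by (unfold U; ring).
      assert (HU : 0 <= U)
        by (unfold U; generalize (Hm 0%nat) (Hm 1%nat); lra).
      assert ((1 + b n) * M n <= Z * (Y * U)).
      { apply Rmult_le_compat; try lra.
        apply Rle_trans with (m n); [apply Hm|apply Rmax_l]. }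
      assert (c n <= Y * Z * c n).
      { rewrite <- (Rmult_1_l (c n)) at 1; apply Rmult_le_compat_r; nra. }
      nra. }
  apply Rle_trans with (M j); [apply Rmax_l|].
  apply Rle_trans with (1 := Hk j).
  assert (B1 := psum_bounds b j Hb Sb); assert (C1 := psum_bounds c j Hc Sc).
  apply Rmult_le_compat.
  - apply Rlt_le, exp_pos.
  - generalize (Hm 0%nat) (Hm 1%nat); lra.
  - destruct (Req_dec (psum b j) (Series b)) as [->|Hne]; [lra|].
    apply Rlt_le, exp_increasing; lra.
  - lra.
Qed.

(** The equations for even and odd indices carry opposite signs; this sign also makes the
    Casoratian telescope. *)
Definition sgn (j : nat) : R := (-1) ^ j.

Lemma sgn_S (j : nat) : sgn (S j) = - sgn j.
Proof. unfold sgn; simpl; ring. Qed.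

Lemma sgn_sqr (j : nat) : sgn j * sgn j = 1.
Proof. induction j as [|j IH]; [unfold sgn; simpl; ring|]. rewrite sgn_S; lra. Qed.

Lemma Rabs_sgn (j : nat) : Rabs (sgn j) = 1.
Proof. apply pow_1_abs. Qed.

Lemma sgn_even (n : nat) : sgn (2 * n) = 1.
Proof. apply pow_1_even. Qed.

Lemma sgn_odd (n : nat) : sgn (2 * n + 1) = -1.
Proof. now rewrite Nat.add_1_r, sgn_S, sgn_even. Qed.

(** The summability under which the transfer matrices of the recurrence have a convergent
    product, and so solutions have limits along each parity. *)
Record admissible (w p : nat -> R) : Prop := {
  adm_pos : forall j, 0 < w j;
  adm_w : ex_series w;
  adm_p : ex_series (fun j => w j * Rabs (p j)) }.

Arguments adm_pos {w p} _.
Arguments adm_w {w p} _.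

(** The recurrence for [(lam - L) z + v = 0], where [v j] is attached to the middle index
    [S j] of the step. *)
Definition recC (w p : nat -> R) (lam : C) (v z : nat -> C) : Prop :=
  forall j, z (S (S j)) =
    (z j + RtoC (sgn j * w j) * ((lam - RtoC (p j)) * z (S j) + v j))%C.

Definition recR (w p : nat -> R) (lam : R) (v z : nat -> R) : Prop :=
  forall j, z (S (S j)) = z j + sgn j * w j * ((lam - p j) * z (S j) + v j).

(** The Gronwall constant for all parameters of modulus at most [r]. *)
Definition growth (w p : nat -> R) (r : R) : R :=
  exp (Series (fun j => w j * (r + Rabs (p j)))).

Lemma growth_pos (w p : nat -> R) (r : R) : 0 < growth w p r.
Proof. apply exp_pos. Qed.

Lemma adm_growth (w p : nat -> R) (r : R) :
  admissible w p -> ex_series (fun j => w j * (r + Rabs (p j))).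
Proof.
  intros [_ Hw Hp].
  apply ex_series_ext with (fun j => plus (scal r (w j)) (w j * Rabs (p j))).
  - intros j; unfold plus, scal; simpl; unfold mult; simpl; ring.
  - apply (ex_series_plus (V := R_NormedModule)); [|exact Hp].
    now apply (ex_series_scal (V := R_NormedModule)).
Qed.

Definition ends_le (z : nat -> C) (L : R) : Prop :=
  forall eps, 0 < eps -> exists N, forall n, (N <= n)%nat -> Cmod (z n) <= L + eps.

Lemma recC_increment (w p : nat -> R) (lam : C) (r : R) (v z : nat -> C) (j : nat) :
  admissible w p -> recC w p lam v z -> Cmod lam <= r ->
  Cmod (z (S (S j)) - z j) <=
    w j * (r + Rabs (p j)) * Cmod (z (S j)) + w j * Cmod (v j).
Proof.
  intros Hadm Hz Hr; rewrite (Hz j); set (s := (lam - RtoC (p j))%C).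
  replace (z j + _ - z j)%C with (RtoC (sgn j * w j) * (s * z (S j) + v j))%C by ring.
  assert (Hw := adm_pos Hadm j).
  rewrite Cmod_mult, Cmod_R, Rabs_mult, Rabs_sgn, (Rabs_pos_eq (w j)) by lra.
  rewrite Rmult_1_l, Rmult_assoc, <- Rmult_plus_distr_l.
  apply Rmult_le_compat_l; [lra|].
  apply Rle_trans with (1 := Cmod_triangle _ _); apply Rplus_le_compat_r.
  rewrite Cmod_mult; apply Rmult_le_compat_r; [apply Cmod_ge_0|].
  unfold s, Cminus; apply Rle_trans with (1 := Cmod_triangle _ _).
  rewrite Cmod_opp, Cmod_R; lra.
Qed.

Lemma recC_bound (w p : nat -> R) (lam : C) (r L : R) (v z : nat -> C) :
  admissible w p -> recC w p lam v z -> Cmod lam <= r ->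
  ex_series (fun j => w j * Cmod (v j)) -> ends_le z L ->
  forall j, Cmod (z j) <= growth w p r * (L + Series (fun j => w j * Cmod (v j))).
Proof.
  intros Hadm Hz Hr Hv HL.
  assert (Hr0 : 0 <= r) by (generalize (Cmod_ge_0 lam); lra).
  apply Gronwall_backward; auto.
  - intros j; apply Cmod_ge_0.
  - intros j; apply Rmult_le_pos; [apply Rlt_le, (adm_pos Hadm)|].
    generalize (Rabs_pos (p j)); lra.
  - intros j; apply Rmult_le_pos; [apply Rlt_le, (adm_pos Hadm)|apply Cmod_ge_0].
  - now apply adm_growth.
  - intros j.
    replace (z j) with (z (S (S j)) + - (z (S (S j)) - z j))%C at 1 by ring.
    apply Rle_trans with (1 := Cmod_triangle _ _); rewrite Cmod_opp.
    generalize (recC_increment w p lam r v z j Hadm Hz Hr); lra.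
Qed.

Lemma recR_bound (w p : nat -> R) (lam r : R) (v z : nat -> R) :
  admissible w p -> recR w p lam v z -> Rabs lam <= r ->
  ex_series (fun j => w j * Rabs (v j)) ->
  forall j, Rabs (z j) <= growth w p r *
    (Rabs (z 0%nat) + Rabs (z 1%nat) + Series (fun j => w j * Rabs (v j))).
Proof.
  intros Hadm Hz Hr Hv.
  assert (Hr0 : 0 <= r) by (generalize (Rabs_pos lam); lra).
  apply (Gronwall_forward (fun j => Rabs (z j))); auto.
  - intros j; apply Rabs_pos.
  - intros j; apply Rmult_le_pos; [apply Rlt_le, (adm_pos Hadm)|].
    generalize (Rabs_pos (p j)); lra.
  - intros j; apply Rmult_le_pos; [apply Rlt_le, (adm_pos Hadm)|apply Rabs_pos].
  - now apply adm_growth.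
  - intros j; rewrite (Hz j), Rplus_assoc.
    apply Rle_trans with (1 := Rabs_triang _ _); apply Rplus_le_compat_l.
    assert (Hw := adm_pos Hadm j).
    rewrite !Rabs_mult, Rabs_sgn, (Rabs_pos_eq (w j)) by lra.
    rewrite Rmult_1_l, Rmult_assoc, <- Rmult_plus_distr_l.
    apply Rmult_le_compat_l; [lra|].
    apply Rle_trans with (1 := Rabs_triang _ _); apply Rplus_le_compat_r.
    rewrite Rabs_mult; apply Rmult_le_compat_r; [apply Rabs_pos|].
    unfold Rminus; apply Rle_trans with (1 := Rabs_triang _ _).
    rewrite Rabs_Ropp; lra.
Qed.

(** The values at [x = 0] of the two components of the Dirac system: even indices carry the
    second component and odd indices the first. *)
Definition end_values (z : nat -> C) (al be : C) : Prop :=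
  is_lim_seq (fun n => Cmod (z (2 * n)%nat - be)) 0 /\
  is_lim_seq (fun n => Cmod (z (2 * n + 1)%nat - al)) 0.

Lemma is_lim_seq_0_eps (u : nat -> R) (eps : R) :
  (forall n, 0 <= u n) -> is_lim_seq u 0 -> 0 < eps ->
  exists N, forall n, (N <= n)%nat -> u n < eps.
Proof.
  intros Hu H He; apply is_lim_seq_spec in H.
  destruct (H (mkposreal eps He)) as [N HN]; exists N; intros n Hn.
  specialize (HN n Hn); simpl in HN.
  now rewrite Rminus_0_r, Rabs_pos_eq in HN by apply Hu.
Qed.

Lemma end_values_ends_le (z : nat -> C) (al be : C) :
  end_values z al be -> ends_le z (Cmod al + Cmod be).
Proof.
  intros [H0 H1] eps He.
  destruct (is_lim_seq_0_eps _ eps (fun n => Cmod_ge_0 _) H0 He) as [N0 HN0].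
  destruct (is_lim_seq_0_eps _ eps (fun n => Cmod_ge_0 _) H1 He) as [N1 HN1].
  exists (2 * (N0 + N1) + 2)%nat; apply (parity_case (fun n => _ -> _)); intros n Hn.
  - specialize (HN0 n ltac:(lia)).
    replace (z (2 * n)%nat) with ((z (2 * n)%nat - be) + be)%C by ring.
    apply Rle_trans with (1 := Cmod_triangle _ _).
    generalize (Cmod_ge_0 al); lra.
  - specialize (HN1 n ltac:(lia)).
    replace (z (2 * n + 1)%nat) with ((z (2 * n + 1)%nat - al) + al)%C by ring.
    apply Rle_trans with (1 := Cmod_triangle _ _).
    generalize (Cmod_ge_0 be); lra.
Qed.

Lemma end_values_lin (z z' : nat -> C) (al be al' be' a b : C) :
  end_values z al be -> end_values z' al' be' ->
  end_values (fun j => a * z j + b * z' j)%C (a * al + b * al')%C (a * be + b * be')%C.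
Proof.
  assert (H : forall (u u' : nat -> C) l l',
    is_lim_seq (fun n => Cmod (u n - l)) 0 -> is_lim_seq (fun n => Cmod (u' n - l')) 0 ->
    is_lim_seq (fun n => Cmod (a * u n + b * u' n - (a * l + b * l'))) 0).
  { intros u u' l l' Hu Hu'.
    apply is_lim_seq_le_le with (fun _ => 0)
      (fun n => Cmod a * Cmod (u n - l) + Cmod b * Cmod (u' n - l')).
    - intros n; split; [apply Cmod_ge_0|].
      rewrite <- !Cmod_mult.
      replace (a * u n + b * u' n - (a * l + b * l'))%C
        with (a * (u n - l) + b * (u' n - l'))%C by ring.
      apply Cmod_triangle.
    - apply is_lim_seq_const.
    - replace (Finite 0) with (Finite (Cmod a * 0 + Cmod b * 0)) by (f_equal; ring).
      apply is_lim_seq_plus'; apply is_lim_seq_mult'; auto; apply is_lim_seq_const. }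
  intros [H0 H1] [H0' H1']; split.
  - now apply (H (fun n => z (2 * n)%nat) (fun n => z' (2 * n)%nat)).
  - now apply (H (fun n => z (2 * n + 1)%nat) (fun n => z' (2 * n + 1)%nat)).
Qed.

(** Gronwall from infinity, applied to the difference of the two solutions. *)
Lemma recC_unique (w p : nat -> R) (lam : C) (z z' : nat -> C) (al be : C) :
  admissible w p ->
  recC w p lam (fun _ => RtoC 0) z -> recC w p lam (fun _ => RtoC 0) z' ->
  end_values z al be -> end_values z' al be -> forall j, z j = z' j.
Proof.
  intros Hadm Hz Hz' He He' j.
  assert (Hd : recC w p lam (fun _ => RtoC 0) (fun j => (1 * z j + -1 * z' j)%C)).
  { intros i; rewrite (Hz i), (Hz' i); ring. }
  assert (Hde := end_values_lin z z' al be al be 1%C (-1)%C He He').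
  assert (H0 : forall j, w j * Cmod (RtoC 0) = 0)
    by (intros i; rewrite Cmod_0; ring).
  assert (Hs : is_series (fun j => w j * Cmod (RtoC 0)) 0).
  { now apply is_series_zero. }
  apply end_values_ends_le in Hde.
  assert (Hb := recC_bound w p lam (Cmod lam) _ _ _ Hadm Hd (Rle_refl _)
    (ex_intro _ 0 Hs) Hde j).
  cbv beta in Hb; rewrite (is_series_unique _ _ Hs) in Hb.
  replace (1 * al + -1 * al)%C with (RtoC 0) in Hb by ring.
  replace (1 * be + -1 * be)%C with (RtoC 0) in Hb by ring.
  rewrite Cmod_0, !Rplus_0_r, Rmult_0_r in Hb.
  assert (E : (1 * z j + -1 * z' j = 0)%C)
    by (apply Cmod_eq_0, Rle_antisym; [exact Hb|apply Cmod_ge_0]).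
  replace (z j) with ((1 * z j + -1 * z' j) + z' j)%C by ring.
  rewrite E; ring.
Qed.

(** * Dependence on the spectral parameter and Green's identity *)

Lemma Im_le_Cmod (c : C) : Rabs (Im c) <= Cmod c.
Proof.
  apply Rle_trans with (2 := Rmax_Cmod c); apply Rmax_r.
Qed.

Lemma Cmod_le_Re_Im (c : C) : Cmod c <= Rabs (Re c) + Rabs (Im c).
Proof.
  destruct c as [x y]; unfold Cmod; simpl.
  apply Rsqr_incr_0_var; [|generalize (Rabs_pos x) (Rabs_pos y); lra].
  rewrite Rsqr_sqrt by nra.
  unfold Rsqr; generalize (Rabs_pos x) (Rabs_pos y) (pow2_abs x) (pow2_abs y); nra.
Qed.

Lemma CSeries_dom (u : nat -> C) (b : nat -> R) :
  (forall n, Cmod (u n) <= b n) -> ex_series b ->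
  ex_series (fun n => Re (u n)) /\ ex_series (fun n => Im (u n)) /\
  Cmod (CSeries u) <= 2 * Series b.
Proof.
  intros Hu Hb.
  assert (H1 : forall n, Rabs (Re (u n)) <= b n)
    by (intros n; apply Rle_trans with (1 := re_le_Cmod _), Hu).
  assert (H2 : forall n, Rabs (Im (u n)) <= b n)
    by (intros n; apply Rle_trans with (1 := Im_le_Cmod _), Hu).
  split; [now apply ex_series_dom with b|].
  split; [now apply ex_series_dom with b|].
  apply Rle_trans with (1 := Cmod_le_Re_Im _); simpl.
  generalize (Series_Rabs_le _ _ H1 Hb) (Series_Rabs_le _ _ H2 Hb); lra.
Qed.

Lemma CSeries_lin (u v : nat -> C) (a b : C) :
  ex_series (fun n => Cmod (u n)) -> ex_series (fun n => Cmod (v n)) ->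
  CSeries (fun n => a * u n + b * v n)%C = (a * CSeries u + b * CSeries v)%C.
Proof.
  intros Hu Hv.
  destruct (CSeries_dom u _ (fun n => Rle_refl _) Hu) as [u1 [u2 _]].
  destruct (CSeries_dom v _ (fun n => Rle_refl _) Hv) as [v1 [v2 _]].
  assert (H : forall (f g : nat -> R) x y, ex_series f -> ex_series g ->
    ex_series (fun n => x * f n + y * g n) /\
    Series (fun n => x * f n + y * g n) = x * Series f + y * Series g).
  { intros f g x y Hf Hg.
    assert (E1 : ex_series (fun n => x * f n))
      by exact (ex_series_scal (V := R_NormedModule) x f Hf).
    assert (E2 : ex_series (fun n => y * g n))
      by exact (ex_series_scal (V := R_NormedModule) y g Hg).
    split; [exact (ex_series_plus (V := R_NormedModule) _ _ E1 E2)|].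
    rewrite Series_plus by assumption; now rewrite !Series_scal_l. }
  assert (H4 : forall (f g h k : nat -> R) x y s t,
    ex_series f -> ex_series g -> ex_series h -> ex_series k ->
    Series (fun n => (x * f n + y * g n) + (s * h n + t * k n)) =
      (x * Series f + y * Series g) + (s * Series h + t * Series k)).
  { intros f g h k x y s t Hf Hg Hh Hk.
    destruct (H f g x y Hf Hg) as [E1 <-]; destruct (H h k s t Hh Hk) as [E2 <-].
    now apply Series_plus. }
  destruct a as [a1 a2], b as [b1 b2].
  unfold CSeries, Cplus, Cmult; simpl; f_equal.
  - replace (a1 * Series (fun n => Re (u n)) - a2 * Series (fun n => Im (u n)) +
      (b1 * Series (fun n => Re (v n)) - b2 * Series (fun n => Im (v n))))
      with ((a1 * Series (fun n => Re (u n)) + - a2 * Series (fun n => Im (u n))) +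
      (b1 * Series (fun n => Re (v n)) + - b2 * Series (fun n => Im (v n)))) by ring.
    rewrite <- H4 by assumption; apply Series_ext; intros n; unfold Re, Im; ring.
  - rewrite <- H4 by assumption; apply Series_ext; intros n; unfold Re, Im; ring.
Qed.

Lemma CSeries_ext (u v : nat -> C) : (forall n, u n = v n) -> CSeries u = CSeries v.
Proof.
  intros H; unfold CSeries; f_equal; apply Series_ext; intros n; now rewrite H.
Qed.

Lemma CSeries_zero (u : nat -> C) : (forall n, u n = 0%C) -> CSeries u = 0%C.
Proof.
  intros Hu; unfold CSeries, RtoC; f_equal; apply is_series_unique, is_series_zero;
    intros n; now rewrite Hu.
Qed.

(** The transform of [g]: the entry [g j] is paired with the middle index [S j] of step [j]. *)
Definition csum (w : nat -> R) (g z : nat -> C) : C :=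
  CSeries (fun j => RtoC (w j) * (g j * z (S j)))%C.

Definition cl1 (w : nat -> R) (g : nat -> C) : Prop :=
  ex_series (fun j => w j * Cmod (g j)).

Lemma cl1_bounded (w p : nat -> R) (g : nat -> C) (M : R) :
  admissible w p -> (forall j, Cmod (g j) <= M) -> cl1 w g.
Proof.
  intros Hadm Hg; apply ex_series_dom with (fun j => M * w j).
  - intros j; assert (Hw := adm_pos Hadm j).
    rewrite Rabs_pos_eq by (generalize (Cmod_ge_0 (g j)); nra).
    rewrite Rmult_comm; apply Rmult_le_compat_r; [lra|apply Hg].
  - apply (ex_series_scal (V := R_NormedModule) M), (adm_w Hadm).
Qed.

Lemma csum_term (w p : nat -> R) (g z : nat -> C) (M : R) (j : nat) :
  admissible w p -> (forall j, Cmod (z j) <= M) ->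
  Cmod (RtoC (w j) * (g j * z (S j))) <= M * (w j * Cmod (g j)).
Proof.
  intros Hadm Hz; assert (Hw := adm_pos Hadm j).
  rewrite !Cmod_mult, Cmod_R, Rabs_pos_eq by lra.
  rewrite <- Rmult_assoc, Rmult_comm; apply Rmult_le_compat_r; [|apply Hz].
  generalize (Cmod_ge_0 (g j)); nra.
Qed.

Lemma csum_bound (w p : nat -> R) (g z : nat -> C) (M : R) :
  admissible w p -> cl1 w g -> (forall j, Cmod (z j) <= M) ->
  ex_series (fun j => Cmod (RtoC (w j) * (g j * z (S j)))) /\
  Cmod (csum w g z) <= 2 * (M * Series (fun j => w j * Cmod (g j))).
Proof.
  intros Hadm Hg Hz.
  assert (Hb : ex_series (fun j => M * (w j * Cmod (g j))))
    by exact (ex_series_scal (V := R_NormedModule) M _ Hg).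
  assert (Ht := fun j => csum_term w p g z M j Hadm Hz).
  split.
  - apply ex_series_dom with (2 := Hb); intros j.
    rewrite Rabs_pos_eq by apply Cmod_ge_0; apply Ht.
  - rewrite <- Series_scal_l; now apply CSeries_dom.
Qed.

Lemma csum_lin (w p : nat -> R) (g z z' : nat -> C) (M M' : R) (a b : C) :
  admissible w p -> cl1 w g ->
  (forall j, Cmod (z j) <= M) -> (forall j, Cmod (z' j) <= M') ->
  csum w g (fun j => a * z j + b * z' j)%C = (a * csum w g z + b * csum w g z')%C.
Proof.
  intros Hadm Hg Hz Hz'; unfold csum.
  rewrite <- CSeries_lin.
  - apply CSeries_ext; intros n; ring.
  - exact (proj1 (csum_bound w p g z M Hadm Hg Hz)).
  - exact (proj1 (csum_bound w p g z' M' Hadm Hg Hz')).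
Qed.

(** The fundamental solution as a function of the spectral parameter, with data at infinity
    that do not depend on it. *)
Record sol_family (w p : nat -> R) (al be : C) (phi : C -> nat -> C) : Prop := {
  fam_rec : forall lam, recC w p lam (fun _ => RtoC 0) (phi lam);
  fam_end : forall lam, end_values (phi lam) al be }.

Arguments fam_rec {w p al be phi} _.
Arguments fam_end {w p al be phi} _.

Lemma family_bound (w p : nat -> R) (al be : C) (phi : C -> nat -> C) (r : R) (lam : C) :
  admissible w p -> sol_family w p al be phi -> Cmod lam <= r ->
  forall j, Cmod (phi lam j) <= growth w p r * (Cmod al + Cmod be).
Proof.
  intros Hadm Hphi Hr j.
  assert (Hs : is_series (fun j : nat => w j * Cmod (RtoC 0)) 0)
    by (apply is_series_zero; intros n; rewrite Cmod_0; ring).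
  assert (H := recC_bound w p lam r _ _ _ Hadm (fam_rec Hphi lam) Hr
    (ex_intro _ 0 Hs) (end_values_ends_le _ _ _ (fam_end Hphi lam)) j).
  cbv beta in H; now rewrite (is_series_unique _ _ Hs), Rplus_0_r in H.
Qed.

Lemma recC_end0_bound (w p : nat -> R) (lam : C) (r : R) (v z : nat -> C) :
  admissible w p -> recC w p lam v z -> Cmod lam <= r -> cl1 w v ->
  end_values z 0%C 0%C ->
  forall j, Cmod (z j) <= growth w p r * Series (fun j => w j * Cmod (v j)).
Proof.
  intros Hadm Hz Hr Hv He j.
  assert (H := recC_bound w p lam r _ v z Hadm Hz Hr Hv (end_values_ends_le _ _ _ He) j).
  now rewrite Cmod_0, Rplus_0_l, Rplus_0_l in H.
Qed.

(** The difference quotient of a family in the spectral parameter solves the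
    inhomogeneous recurrence and vanishes at infinity, and so does the difference
    of two such quotients; both are therefore controlled uniformly in [j]. *)
Lemma family_quotient (w p : nat -> R) (al be : C) (phi : C -> nat -> C) (mu : C) :
  admissible w p -> sol_family w p al be phi ->
  exists K, 0 <= K /\
  (forall lam j, lam <> mu -> Cmod (lam - mu) < 1 ->
    Cmod ((phi lam j - phi mu j) / (lam - mu)) <= K) /\
  (forall lam lam' j, lam <> mu -> lam' <> mu ->
    Cmod (lam - mu) < 1 -> Cmod (lam' - mu) < 1 ->
    Cmod ((phi lam j - phi mu j) / (lam - mu) - (phi lam' j - phi mu j) / (lam' - mu))
      <= K * Cmod (lam - lam')).
Proof.
  intros Hadm Hphi.
  set (r := Cmod mu + 1).
  assert (Hr : forall lam, Cmod (lam - mu) < 1 -> Cmod lam <= r).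
  { intros lam Hl; unfold r.
    replace lam with ((lam - mu) + mu)%C at 1 by ring.
    apply Rle_trans with (1 := Cmod_triangle _ _); lra. }
  assert (Hv : cl1 w (fun j => phi mu (S j))).
  { eapply cl1_bounded; [exact Hadm|]; intros j.
    now apply (family_bound w p al be phi (Cmod mu)); [| |lra]. }
  set (K1 := growth w p r * Series (fun j => w j * Cmod (phi mu (S j)))).
  set (D := fun lam j => (/ (lam - mu) * phi lam j + - / (lam - mu) * phi mu j)%C).
  assert (HDe : forall lam, end_values (D lam) 0%C 0%C).
  { intros lam.
    assert (H := end_values_lin _ _ _ _ _ _ (/ (lam - mu))%C (- / (lam - mu))%C
      (fam_end Hphi lam) (fam_end Hphi mu)).
    replace (_ * al + _ * al)%C with (RtoC 0) in H by ring.
    now replace (_ * be + _ * be)%C with (RtoC 0) in H by ring. }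
  assert (Hne : forall lam, lam <> mu -> (lam - mu)%C <> 0%C).
  { intros lam Hl E; apply Hl; replace lam with ((lam - mu) + mu)%C by ring.
    rewrite E; ring. }
  assert (HD : forall lam, lam <> mu -> recC w p lam (fun j => phi mu (S j)) (D lam)).
  { intros lam Hl j; unfold D.
    rewrite (fam_rec Hphi lam j), (fam_rec Hphi mu j).
    field; now apply Hne. }
  assert (HDb : forall lam, lam <> mu -> Cmod (lam - mu) < 1 ->
    forall j, Cmod (D lam j) <= K1).
  { intros lam Hl H1; apply (recC_end0_bound w p lam); auto. }
  assert (HK1 : 0 <= K1).
  { unfold K1; apply Rmult_le_pos; [apply Rlt_le, growth_pos|].
    apply Series_nonneg; [|exact Hv]; intros j.
    apply Rmult_le_pos; [apply Rlt_le, (adm_pos Hadm)|apply Cmod_ge_0]. }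
  assert (HW : 0 <= Series w).
  { apply Series_nonneg; [intros j; apply Rlt_le, (adm_pos Hadm)|apply Hadm]. }
  assert (HG := growth_pos w p r).
  set (K2 := growth w p r * (K1 * Series w)).
  assert (HK2 : 0 <= K2) by (unfold K2; apply Rmult_le_pos; [lra|nra]).
  assert (HDE : forall lam j, lam <> mu ->
    ((phi lam j - phi mu j) / (lam - mu))%C = D lam j).
  { intros lam j Hl; unfold D; field; now apply Hne. }
  exists (K1 + K2); split; [lra|split].
  - intros lam j Hl H1; rewrite HDE by exact Hl.
    apply Rle_trans with (1 := HDb lam Hl H1 j); lra.
  - intros lam lam' j Hl Hl' H1 H1'; rewrite !HDE by assumption.
    set (E := fun j => (1 * D lam j + -1 * D lam' j)%C).
    replace (D lam j - D lam' j)%C with (E j) by (unfold E; ring).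
    assert (HE : recC w p lam (fun j => (lam - lam') * D lam' (S j))%C E).
    { intros i; unfold E; rewrite (HD lam Hl i), (HD lam' Hl' i); ring. }
    assert (HEe : end_values E 0%C 0%C).
    { assert (H := end_values_lin _ _ _ _ _ _ 1%C (-1)%C (HDe lam) (HDe lam')).
      now replace (1 * 0 + -1 * 0)%C with (RtoC 0) in H by ring. }
    assert (Hvb : forall i, Cmod ((lam - lam') * D lam' (S i)) <= Cmod (lam - lam') * K1).
    { intros i; rewrite Cmod_mult; apply Rmult_le_compat_l; [apply Cmod_ge_0|auto]. }
    assert (HEv := cl1_bounded w p _ _ Hadm Hvb).
    apply Rle_trans with (1 := recC_end0_bound w p lam r _ E Hadm HE (Hr lam H1) HEv HEe j).
    apply Rle_trans with (K2 * Cmod (lam - lam')).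
    + unfold K2; rewrite Rmult_assoc; apply Rmult_le_compat_l; [lra|].
      replace (K1 * Series w * Cmod (lam - lam'))
        with (Cmod (lam - lam') * K1 * Series w) by ring.
      rewrite <- Series_scal_l; apply Series_le.
      * intros i; assert (Hw := adm_pos Hadm i); split.
        { apply Rmult_le_pos; [lra|apply Cmod_ge_0]. }
        rewrite Rmult_comm; apply Rmult_le_compat_r; [lra|apply Hvb].
      * apply (ex_series_scal (V := R_NormedModule) (Cmod (lam - lam') * K1)), Hadm.
    + apply Rmult_le_compat_r; [apply Cmod_ge_0|lra].
Qed.

Lemma family_derivable (w p : nat -> R) (al be : C) (phi : C -> nat -> C) (j : nat) (mu : C) :
  admissible w p -> sol_family w p al be phi ->
  ex_derive (K := C_AbsRing) (V := C_NormedModule) (fun lam => phi lam j) mu.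
Proof.
  intros Hadm Hphi.
  destruct (family_quotient w p al be phi mu Hadm Hphi) as [K [_ [_ HK]]].
  apply ex_derive_of_Lipschitz_quotient with K; intros y z Hy Hz Hy1 Hz1.
  now apply HK.
Qed.

(** The uniform estimate on difference quotients of [phi] passes to its transform, which
    is linear in [phi] and bounded on bounded sequences. *)
Lemma csum_derivable (w p : nat -> R) (al be : C) (phi : C -> nat -> C)
    (g : nat -> C) (mu : C) :
  admissible w p -> sol_family w p al be phi -> cl1 w g ->
  ex_derive (K := C_AbsRing) (V := C_NormedModule) (fun lam => csum w g (phi lam)) mu.
Proof.
  intros Hadm Hphi Hg.
  destruct (family_quotient w p al be phi mu Hadm Hphi) as [K [HK0 [HKb HK]]].
  set (G := Series (fun j => w j * Cmod (g j))).
  apply ex_derive_of_Lipschitz_quotient with (2 * (K * G)).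
  intros y z Hy Hz Hy1 Hz1.
  assert (Hb := fun lam => family_bound w p al be phi (Cmod lam) lam Hadm Hphi (Rle_refl _)).
  set (D := fun lam j => ((phi lam j - phi mu j) / (lam - mu))%C).
  assert (HD : forall lam, lam <> mu ->
    ((csum w g (phi lam) - csum w g (phi mu)) / (lam - mu))%C = csum w g (D lam)).
  { intros lam Hl.
    assert (Hne : (lam - mu)%C <> 0%C).
    { intros E; apply Hl; replace lam with ((lam - mu) + mu)%C by ring.
      rewrite E; ring. }
    transitivity (csum w g (fun j => / (lam - mu) * phi lam j + - / (lam - mu) * phi mu j)%C).
    - rewrite (csum_lin w p g _ _ _ _ _ _ Hadm Hg (Hb lam) (Hb mu)); field; exact Hne.
    - apply CSeries_ext; intros j; unfold D; field; exact Hne. }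
  rewrite !HD by assumption.
  replace (csum w g (D y) - csum w g (D z))%C
    with (csum w g (fun j => 1 * D y j + -1 * D z j)%C).
  2: { rewrite (csum_lin w p g _ _ K K _ _ Hadm Hg); [ring| |];
       intros j; now apply HKb. }
  replace (2 * (K * G) * Cmod (y - z)) with (2 * (K * Cmod (y - z) * G)) by ring.
  apply (csum_bound w p); [exact Hadm|exact Hg|]; intros j.
  replace (1 * D y j + -1 * D z j)%C with (D y j - D z j)%C by ring; now apply HK.
Qed.

(** In the limit the products cancel, since both sequences tend to the same pair. *)
Lemma cross_limit (z z' : nat -> C) (al be : C) (M : R) :
  end_values z al be -> end_values z' al be -> (forall j, Cmod (z' j) <= M) ->
  is_lim_seq (fun n => Cmod (z (2 * n + 1)%nat * z' (2 * n)%nat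
    - z (2 * n)%nat * z' (2 * n + 1)%nat)) 0.
Proof.
  intros [H0 H1] [H0' H1'] HM.
  apply is_lim_seq_le_le with (fun _ => 0) (fun n =>
    (M * Cmod (z (2 * n + 1)%nat - al) + Cmod al * Cmod (z' (2 * n)%nat - be)) +
    (M * Cmod (z (2 * n)%nat - be) + Cmod be * Cmod (z' (2 * n + 1)%nat - al))).
  - intros n; split; [apply Cmod_ge_0|].
    set (a := z (2 * n + 1)%nat); set (b := z (2 * n)%nat).
    set (a' := z' (2 * n + 1)%nat); set (b' := z' (2 * n)%nat).
    replace (a * b' - b * a')%C with (((a - al) * b' + al * (b' - be)) +
      - ((b - be) * a' + be * (a' - al)))%C by ring.
    apply Rle_trans with (1 := Cmod_triangle _ _); rewrite Cmod_opp.
    apply Rplus_le_compat; apply Rle_trans with (1 := Cmod_triangle _ _);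
      rewrite !Cmod_mult; apply Rplus_le_compat; try lra;
      rewrite Rmult_comm; apply Rmult_le_compat_r; try apply Cmod_ge_0; apply HM.
  - apply is_lim_seq_const.
  - replace (Finite 0) with (Finite ((M * 0 + Cmod al * 0) + (M * 0 + Cmod be * 0)))
      by (f_equal; ring).
    apply is_lim_seq_plus'; apply is_lim_seq_plus'; apply is_lim_seq_mult'; auto;
      apply is_lim_seq_const.
Qed.

(** Green's identity (summation by parts): the Casoratian of two solutions with the
    same end values vanishes at infinity, so only its value at the left end remains. *)
Lemma Green_family (w p : nat -> R) (al be : C) (phi : C -> nat -> C) (lam mu : C) :
  admissible w p -> sol_family w p al be phi ->
  (phi lam 1%nat * phi mu 0%nat - phi lam 0%nat * phi mu 1%nat =
   (lam - mu) * csum w (fun j => phi mu (S j)) (phi lam))%C.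
Proof.
  intros Hadm Hphi.
  assert (Hb := fun nu => family_bound w p al be phi (Cmod nu) nu Hadm Hphi (Rle_refl _)).
  assert (Hg : cl1 w (fun j => phi mu (S j)))
    by (eapply cl1_bounded; [exact Hadm|]; intros j; apply Hb).
  destruct (csum_bound w p _ _ _ Hadm Hg (Hb lam)) as [Hs _].
  set (W := fun j => (RtoC (sgn j) * (phi lam (S j) * phi mu j - phi lam j * phi mu (S j)))%C).
  assert (HW : forall j,
    ((lam - mu) * (RtoC (w j) * (phi mu (S j) * phi lam (S j))) + 0 * 0
      = W j - W (S j))%C).
  { intros j; unfold W.
    rewrite (fam_rec Hphi lam j), (fam_rec Hphi mu j).
    rewrite sgn_S, RtoC_opp, RtoC_mult.
    assert (E : (RtoC (sgn j) * RtoC (sgn j))%C = RtoC 1)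
      by now rewrite <- RtoC_mult, sgn_sqr.
    set (s := RtoC (sgn j)) in *; set (a := phi lam j); set (a1 := phi lam (S j)).
    set (b := phi mu j); set (b1 := phi mu (S j)).
    transitivity ((s * s) * ((lam - mu) * (RtoC (w j) * (b1 * a1))))%C;
      [rewrite E|]; ring. }
  assert (Hl := cross_limit _ _ _ _ _ (fam_end Hphi lam)
    (fam_end Hphi mu) (Hb mu)).
  assert (Hlim : forall P : C -> R, (forall c, Rabs (P c) <= Cmod c) ->
    is_lim_seq (fun n => P (W (2 * n)%nat)) 0).
  { intros P HP; apply is_lim_seq_abs_0.
    apply is_lim_seq_le_le with (3 := Hl) (u := fun _ => 0).
    - intros n; split; [apply Rabs_pos|].
      apply Rle_trans with (1 := HP _); apply Req_le; unfold W.
      rewrite sgn_even, Nat.add_1_r; f_equal; ring.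
    - apply is_lim_seq_const. }
  assert (HsW : ex_series (fun j => Cmod ((lam - mu) *
    (RtoC (w j) * (phi mu (S j) * phi lam (S j))) + 0 * 0))).
  { apply ex_series_ext with (fun j => Cmod (lam - mu) *
      Cmod (RtoC (w j) * (phi mu (S j) * phi lam (S j)))).
    - intros j; rewrite <- Cmod_mult; f_equal; ring.
    - exact (ex_series_scal (V := R_NormedModule) (Cmod (lam - mu)) _ Hs). }
  destruct (CSeries_dom _ _ (fun n => Rle_refl _) HsW) as [HRe [HIm _]].
  assert (E : CSeries (fun j => (lam - mu) *
    (RtoC (w j) * (phi mu (S j) * phi lam (S j))) + 0 * 0)%C = W 0%nat).
  { unfold CSeries.
    rewrite (Series_telescope _ (fun j => Re (W j)) 0),
      (Series_telescope _ (fun j => Im (W j)) 0).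
    - rewrite !Rminus_0_r; now destruct (W 0%nat).
    - intros j; rewrite HW; reflexivity.
    - exact HIm.
    - apply Hlim, Im_le_Cmod.
    - intros j; rewrite HW; reflexivity.
    - exact HRe.
    - apply Hlim, re_le_Cmod. }
  rewrite CSeries_lin with (v := fun _ => 0%C) in E; [|exact Hs|].
  2: { exists 0; apply is_series_zero; intros n; apply Cmod_0. }
  unfold csum; transitivity (W 0%nat).
  - unfold W, sgn; simpl; ring.
  - rewrite <- E; ring.
Qed.

(** * Riccati inequalities and real solutions *)

Lemma Riccati_not_positive (N E : R -> R) (V x0 : R) :
  0 < V -> (forall x, is_derive N x (E x)) -> (forall x, N x ^ 2 <= V * E x) ->
  ~ 0 < N x0.
Proof.
  intros HV HN HE H0.
  assert (HE0 : forall x, 0 <= E x).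
  { intros x; apply Rmult_le_reg_l with V; [exact HV|].
    generalize (HE x) (pow2_ge_0 (N x)); lra. }
  assert (Hc : forall x, continuity_pt N x).
  { intros x; apply continuity_pt_filterlim, (ex_derive_continuous N x).
    now exists (E x). }
  (* The solution of [N' = N ^ 2 / V] through [N x0] blows up at [x1]. *)
  set (x1 := x0 + V / N x0).
  assert (Hx : x0 < x1) by (unfold x1; generalize (Rdiv_lt_0_compat V (N x0) HV H0); lra).
  assert (Hinc : forall x, x0 <= x -> 0 < N x).
  { intros x Hxx.
    destruct (MVT_gen N x0 x E) as [c [_ Hc']].
    - intros; apply HN.
    - intros; apply Hc.
    - specialize (HE0 c); nra. }
  destruct (MVT_gen (fun x => / N x + x * / V) x0 x1
    (fun x => - E x / N x ^ 2 + / V)) as [c [Hc1 Hc2]].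
  - rewrite Rmin_left, Rmax_right by lra; intros x Hxx.
    assert (Hpos : 0 < N x) by (apply Hinc; lra).
    apply (is_derive_plus (V := R_NormedModule)).
    + apply is_derive_inv; [apply HN|lra].
    + auto_derive; [exact I|ring].
  - rewrite Rmin_left, Rmax_right by lra; intros x Hxx.
    assert (Hpos : 0 < N x) by (apply Hinc; lra).
    apply continuity_pt_plus.
    + apply continuity_pt_inv; [apply Hc|lra].
    + apply continuity_pt_mult; [apply continuity_pt_id|apply continuity_pt_const; easy].
  - rewrite Rmin_left, Rmax_right in Hc1 by lra.
    assert (Hp : 0 < N c) by (apply Hinc; lra).
    assert (Hn : - E c / N c ^ 2 + / V <= 0).
    { specialize (HE c).
      apply Rmult_le_reg_l with (V * N c ^ 2); [generalize (pow_lt (N c) 2 Hp); nra|].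
      replace (V * N c ^ 2 * _) with (- (V * E c) + N c ^ 2) by (field; lra); lra. }
    assert (H1 : 0 < / N x1) by (apply Rinv_0_lt_compat, Hinc; lra).
    assert (E1 : (x1 - x0) * / V = / N x0) by (unfold x1; field; lra).
    assert (x1 * / V = x0 * / V + / N x0) by lra.
    nra.
Qed.

(** A solution of [N' >= N ^ 2 / V] blows up in finite time unless it vanishes. *)
Lemma Riccati_zero (N E : R -> R) (V : R) :
  0 < V -> (forall x, is_derive N x (E x)) -> (forall x, N x ^ 2 <= V * E x) ->
  forall x, N x = 0.
Proof.
  intros HV HN HE x.
  assert (H1 := Riccati_not_positive N E V x HV HN HE).
  assert (H2 : ~ 0 < (fun t => - N (- t)) (- x)).
  { apply (Riccati_not_positive (fun t => - N (- t)) (fun t => E (- t)) V).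
    - exact HV.
    - intros t.
      assert (Hr : is_derive (fun s : R => - s) t (-1))
        by (auto_derive; [exact I|ring]).
      assert (Hm := is_derive_comp (V := R_NormedModule) N (fun s : R => - s) t
        (E (- t)) (-1) (HN (- t)) Hr).
      apply (is_derive_opp (V := R_NormedModule)) in Hm.
      replace (E (- t)) with (opp (scal (-1) (E (- t)))); [exact Hm|].
      unfold opp, scal; simpl; unfold mult; simpl; ring.
    - intros t; replace ((- N (- t)) ^ 2) with (N (- t) ^ 2) by ring; apply HE. }
  simpl in H2; rewrite Ropp_involutive in H2; lra.
Qed.

(** The form in which the resolvent identity delivers a derivative. *)
Lemma is_derive_of_quotient (N q : R -> R) (x : R) :
  (forall y, N y - N x = (y - x) * q y) -> continuous q x -> is_derive N x (q x).
Proof.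
  intros HN Hq.
  split; [apply (is_linear_scal_l (K := R_AbsRing) (q x))|].
  intros x' Hx' eps.
  assert (E : x' = x) by (symmetry; now apply is_filter_lim_locally_unique).
  subst x'; assert (Hl := proj1 (filterlim_locally q (q x)) Hq eps).
  revert Hl; apply filter_imp; intros y Hy.
  unfold ball in Hy; simpl in Hy; unfold AbsRing_ball, abs, minus, plus, opp in Hy.
  simpl in Hy; unfold norm; simpl; unfold abs, minus, plus, opp, scal; simpl.
  unfold mult; simpl.
  change (N y + - N x) with (N y - N x); rewrite HN.
  replace ((y - x) * q y + - ((y + - x) * q x)) with ((q y + - q x) * (y + - x)) by ring.
  rewrite Rabs_mult; apply Rmult_le_compat_r; [apply Rabs_pos|lra].
Qed.

Lemma quotient_of_derive (f : R -> R) (x : R) :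
  ex_derive f x ->
  continuous (fun y => if Req_EM_T y x then Derive f x else (f y - f x) / (y - x)) x.
Proof.
  intros Hf; apply Derive_correct in Hf.
  apply filterlim_locally; intros eps.
  destruct Hf as [_ Hf].
  assert (He : 0 < eps / 2) by (generalize (cond_pos eps); lra).
  generalize (Hf x (fun P HP => HP) (mkposreal _ He)); apply filter_imp.
  intros y Hy; unfold norm in Hy; simpl in Hy.
  unfold abs, minus, plus, opp, scal in Hy; simpl in Hy; unfold mult in Hy; simpl in Hy.
  unfold ball; simpl; unfold AbsRing_ball, abs, minus, plus, opp; simpl.
  destruct (Req_EM_T x x) as [_|]; [|easy].
  destruct (Req_EM_T y x) as [->|Hne].
  { replace (Derive f x + - Derive f x) with 0 by ring.
    rewrite Rabs_R0; apply cond_pos. }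
  assert (Hp : 0 < Rabs (y + - x)) by (apply Rabs_pos_lt; lra).
  apply Rle_lt_trans with (eps / 2); [|lra].
  apply Rmult_le_reg_r with (1 := Hp); rewrite <- Rabs_mult.
  replace (((f y - f x) / (y - x) + - Derive f x) * (y + - x))
    with (f y + - f x + - ((y + - x) * Derive f x)) by (field; lra).
  exact Hy.
Qed.

(** The quotient [f / g] continued over the simple zeros of [g] by l'Hopital's rule. *)
Definition rquot (f g : R -> R) (x : R) : R :=
  if Req_EM_T (g x) 0 then Derive f x / Derive g x else f x / g x.

Lemma continuous_neq0 (g : R -> R) (x : R) :
  continuous g x -> g x <> 0 -> locally x (fun y => g y <> 0).
Proof.
  intros Hg H0.
  assert (He : 0 < Rabs (g x)) by now apply Rabs_pos_lt.
  generalize (proj1 (filterlim_locally g (g x)) Hg (mkposreal _ He)).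
  apply filter_imp; intros y Hy E.
  unfold ball in Hy; simpl in Hy; unfold AbsRing_ball, abs, minus, plus, opp in Hy.
  simpl in Hy; rewrite E, Rplus_0_l, Rabs_Ropp in Hy; lra.
Qed.

Lemma continuous_div (f g : R -> R) (x : R) :
  continuous f x -> continuous g x -> g x <> 0 -> continuous (fun y => f y / g y) x.
Proof.
  intros Hf Hg H0; apply continuity_pt_filterlim.
  apply continuity_pt_div; [now apply continuity_pt_filterlim..|exact H0].
Qed.

Lemma rquot_continuous (f g : R -> R) :
  (forall x, ex_derive f x) -> (forall x, ex_derive g x) ->
  (forall x, g x = 0 -> f x = 0 /\ Derive g x <> 0) ->
  forall x, continuous (rquot f g) x.
Proof.
  intros Hf Hg H0 x.
  assert (Hfc := ex_derive_continuous f x (Hf x)).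
  assert (Hgc := ex_derive_continuous g x (Hg x)).
  destruct (Req_EM_T (g x) 0) as [E|Hne].
  - destruct (H0 x E) as [Ef Hd].
    set (qf := fun y => if Req_EM_T y x then Derive f x else (f y - f x) / (y - x)).
    set (qg := fun y => if Req_EM_T y x then Derive g x else (g y - g x) / (y - x)).
    assert (Hqg : qg x <> 0) by (unfold qg; destruct (Req_EM_T x x); easy).
    assert (Hcf : continuous qf x) by now apply quotient_of_derive.
    assert (Hcg : continuous qg x) by now apply quotient_of_derive.
    apply continuous_ext_loc with (fun y => qf y / qg y);
      [|now apply continuous_div].
    generalize (continuous_neq0 qg x Hcg Hqg); apply filter_imp; intros y Hy.
    unfold rquot, qf, qg in *; destruct (Req_EM_T y x) as [->|Hyx].
    + destruct (Req_EM_T (g x) 0); [easy|easy].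
    + destruct (Req_EM_T (g y) 0) as [Eg|Eg].
      * exfalso; apply Hy; rewrite Eg, E; field; lra.
      * rewrite Ef, E; as_real; field; lra.
  - apply continuous_ext_loc with (fun y => f y / g y); [|now apply continuous_div].
    generalize (continuous_neq0 g x Hgc Hne); apply filter_imp; intros y Hy.
    unfold rquot; destruct (Req_EM_T (g y) 0); easy.
Qed.

Fixpoint solR_pair (w p v : nat -> R) (x a b : R) (j : nat) : R * R :=
  match j with
  | O => (a, b)
  | S k => let u := solR_pair w p v x a b k in
      (snd u, fst u + sgn k * w k * ((x - p k) * snd u + v k))
  end.

(** The solution with prescribed values at the left end, where no convergence question
    arises; its behaviour at infinity is found afterwards from Green's identity. *)
Definition solR (w p v : nat -> R) (x a b : R) (j : nat) : R :=
  fst (solR_pair w p v x a b j).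

Lemma solR_rec (w p v : nat -> R) (x a b : R) : recR w p x v (solR w p v x a b).
Proof. intros j; reflexivity. Qed.

Lemma solR_continuous (w p v : nat -> R) (a b : R -> R) (x : R) (j : nat) :
  continuous a x -> continuous b x ->
  continuous (fun t => solR w p v t (a t) (b t) j) x.
Proof.
  intros Ha Hb.
  assert (H : continuous (fun t => solR w p v t (a t) (b t) j) x /\
    continuous (fun t => solR w p v t (a t) (b t) (S j)) x).
  { induction j as [|j [IH1 IH2]]; [now split|split; [exact IH2|]].
    apply continuous_ext with (fun t => solR w p v t (a t) (b t) j +
      sgn j * w j * ((t - p j) * solR w p v t (a t) (b t) (S j) + v j)).
    { intros t; now rewrite (solR_rec w p v t (a t) (b t) j). }
    apply (continuous_plus (V := R_NormedModule)); [exact IH1|].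
    apply (continuous_mult (K := R_AbsRing)); [apply continuous_const|].
    apply (continuous_plus (V := R_NormedModule)); [|apply continuous_const].
    apply (continuous_mult (K := R_AbsRing)); [|exact IH2].
    apply (continuous_minus (V := R_NormedModule));
      [apply continuous_id|apply continuous_const]. }
  apply H.
Qed.

(** The Casoratian with alternating sign, which is constant for two homogeneous solutions
    with the same parameter. *)
Definition Wronsk (z z' : nat -> R) (j : nat) : R :=
  sgn j * (z (S j) * z' j - z j * z' (S j)).

Lemma Wronsk_step (w p : nat -> R) (lam lam' : R) (v v' z z' : nat -> R) (j : nat) :
  recR w p lam v z -> recR w p lam' v' z' ->
  w j * ((lam - lam') * (z (S j) * z' (S j)) + v j * z' (S j) - z (S j) * v' j) =
  Wronsk z z' j - Wronsk z z' (S j).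
Proof.
  intros Hz Hz'; unfold Wronsk; rewrite (Hz j), (Hz' j), sgn_S.
  assert (E := sgn_sqr j); set (s := sgn j) in *.
  transitivity ((s * s) * (w j * ((lam - lam') * (z (S j) * z' (S j)) +
    v j * z' (S j) - z (S j) * v' j))); [rewrite E|]; ring.
Qed.

Lemma l2_bounded (w p f : nat -> R) (M : R) :
  admissible w p -> (forall j, Rabs (f j) <= M) -> l2 w f.
Proof.
  intros Hadm Hf; apply ex_series_dom with (fun j => M ^ 2 * w j).
  - intros j; assert (Hw := adm_pos Hadm j).
    rewrite Rabs_pos_eq by (generalize (pow2_ge_0 (f j)); nra).
    rewrite Rmult_comm; apply Rmult_le_compat_r; [lra|].
    rewrite <- pow2_abs; apply pow_incr; split; [apply Rabs_pos|apply Hf].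
  - apply (ex_series_scal (V := R_NormedModule) (M ^ 2)), Hadm.
Qed.

Lemma l2_l1 (w p f : nat -> R) :
  admissible w p -> l2 w f -> ex_series (fun j => w j * Rabs (f j)).
Proof.
  intros Hadm Hf.
  assert (H1 : l2 w (fun _ => 1)).
  { apply l2_bounded with p 1; [exact Hadm|]; intros j; rewrite Rabs_R1; lra. }
  apply ex_series_ext with (2 := ip_summable w f _ (adm_pos Hadm) Hf H1).
  intros j; assert (Hw := adm_pos Hadm j).
  rewrite Rmult_1_r, Rabs_mult, (Rabs_pos_eq (w j)) by lra; reflexivity.
Qed.

(** * Completeness of the eigenfunctions *)

(** Summation by parts, stated as an equivalence because it is read both ways: the left end
    determines the boundary condition at infinity, and conversely. *)
Lemma Green_limit (w p : nat -> R) (lam lam' L : R) (v v' z z' : nat -> R) (M M' : R) :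
  admissible w p -> recR w p lam v z -> recR w p lam' v' z' ->
  l2 w v -> l2 w v' ->
  (forall j, Rabs (z j) <= M) -> (forall j, Rabs (z' j) <= M') ->
  (lam - lam') * ip w (fun j => z (S j)) (fun j => z' (S j))
    + ip w v (fun j => z' (S j)) - ip w v' (fun j => z (S j)) = Wronsk z z' 0 - L <->
  is_lim_seq (fun n => Wronsk z z' (2 * n)) L.
Proof.
  intros Hadm Hz Hz' Hv Hv' HM HM'.
  assert (Hw := adm_pos Hadm).
  assert (Lz : l2 w (fun j => z (S j))) by (apply l2_bounded with p M; auto).
  assert (Lz' : l2 w (fun j => z' (S j))) by (apply l2_bounded with p M'; auto).
  set (a := fun j => w j * ((lam - lam') * (z (S j) * z' (S j)) + v j * z' (S j) - z (S j) * v' j)).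
  assert (Ha : forall j, a j = Wronsk z z' j - Wronsk z z' (S j))
    by (intros j; now apply (Wronsk_step w p)).
  assert (Hs : is_series a ((lam - lam') * ip w (fun j => z (S j)) (fun j => z' (S j))
    + ip w v (fun j => z' (S j)) - ip w v' (fun j => z (S j)))).
  { assert (S1 := Series_correct _ (ip_ex w _ _ Hw Lz Lz')).
    assert (S2 := Series_correct _ (ip_ex w _ _ Hw Hv Lz')).
    assert (S3 := Series_correct _ (ip_ex w _ _ Hw Hv' Lz)).
    apply (is_series_scal (V := R_NormedModule) (lam - lam')) in S1.
    assert (S4 := is_series_minus (V := R_NormedModule) _ _ _ _
      (is_series_plus (V := R_NormedModule) _ _ _ _ S1 S2) S3).
    apply is_series_ext with (2 := S4); intros j.
    unfold a, minus, plus, opp, scal; simpl; unfold mult; simpl; ring. }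
  set (Sg := _ - ip w v' _) in *.
  assert (HW : is_lim_seq (fun n => Wronsk z z' (2 * n)) (Wronsk z z' 0 - Sg)).
  { assert (E : forall n, sum_n a n = Wronsk z z' 0 - Wronsk z z' (S n)).
    { induction n as [|n IH]; [now rewrite sum_O|].
      rewrite sum_Sn, IH, Ha; unfold plus; simpl; ring. }
    assert (HS : is_lim_seq (sum_n a) Sg) by exact Hs.
    assert (HW1 : is_lim_seq (fun n => Wronsk z z' n) (Wronsk z z' 0 - Sg)).
    { apply is_lim_seq_incr_1, is_lim_seq_ext with (fun n => Wronsk z z' 0 - sum_n a n).
      - intros n; rewrite E; ring.
      - now apply is_lim_seq_minus'; [apply is_lim_seq_const|]. }
    apply is_lim_seq_subseq with (phi := fun n => (2 * n)%nat) in HW1; [exact HW1|].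
    apply eventually_subseq; intros n; lia. }
  split.
  - intros E; replace L with (Wronsk z z' 0 - Sg) by lra; exact HW.
  - intros HL; apply is_lim_seq_unique in HL; apply is_lim_seq_unique in HW.
    rewrite HL in HW; injection HW; intros ->; lra.
Qed.

Lemma lim0_mult_bounded (u s : nat -> R) (M : R) :
  is_lim_seq u 0 -> (forall n, Rabs (s n) <= M) -> is_lim_seq (fun n => u n * s n) 0.
Proof.
  intros Hu Hs; apply is_lim_seq_abs_0.
  apply is_lim_seq_le_le with (fun _ => 0) (fun n => Rabs (u n) * M).
  - intros n; split; [apply Rabs_pos|].
    rewrite Rabs_mult; apply Rmult_le_compat_l; [apply Rabs_pos|apply Hs].
  - apply is_lim_seq_const.
  - replace (Finite 0) with (Finite (Rabs 0 * M)) by (rewrite Rabs_R0; f_equal; ring).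
    apply is_lim_seq_mult'; [|apply is_lim_seq_const].
    now apply (is_lim_seq_abs u 0).
Qed.

(** It tends to zero exactly when [z] satisfies asymptotically the boundary condition that
    the end values [al], [be] satisfy. *)
Definition end_defect (z : nat -> R) (al be : R) (n : nat) : R :=
  z (2 * n + 1)%nat * be - z (2 * n)%nat * al.

(** Two bounded sequences with the same boundary condition at infinity are
    asymptotically parallel, so their Casoratian vanishes there. *)
Lemma Wronsk_limit_0 (z z' : nat -> R) (al be M M' : R) :
  0 < al ^ 2 + be ^ 2 ->
  (forall j, Rabs (z j) <= M) -> (forall j, Rabs (z' j) <= M') ->
  is_lim_seq (end_defect z al be) 0 -> is_lim_seq (end_defect z' al be) 0 ->
  is_lim_seq (fun n => Wronsk z z' (2 * n)) 0.
Proof.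
  intros Hr HM HM' He He'.
  (* Rotate to the coordinates along and across [(al, be)]: the defect is the
     component across and [s] the one along; the Casoratian is bilinear in them. *)
  set (s := fun (y : nat -> R) n => y (2 * n + 1)%nat * al + y (2 * n)%nat * be).
  assert (Hs : forall y B n, (forall j, Rabs (y j) <= B) ->
    Rabs (s y n) <= B * Rabs al + B * Rabs be).
  { intros y B n HB; apply Rle_trans with (1 := Rabs_triang _ _).
    rewrite !Rabs_mult; apply Rplus_le_compat; apply Rmult_le_compat_r;
      try apply Rabs_pos; apply HB. }
  apply is_lim_seq_ext with (fun n => / (al ^ 2 + be ^ 2) *
    (end_defect z al be n * s z' n - end_defect z' al be n * s z n)).
  - intros n; unfold Wronsk, end_defect, s; rewrite sgn_even.
    replace (S (2 * n)) with (2 * n + 1)%nat by lia; field; lra.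
  - replace (Finite 0) with (Finite (/ (al ^ 2 + be ^ 2) * (0 - 0))) by (f_equal; ring).
    apply is_lim_seq_mult'; [apply is_lim_seq_const|].
    apply is_lim_seq_minus'.
    + apply lim0_mult_bounded with (M' * Rabs al + M' * Rabs be); auto.
    + apply lim0_mult_bounded with (M * Rabs al + M * Rabs be); auto.
Qed.

(** If [v] is orthogonal to all eigenfunctions, the resolvent applied to [v] extends
    over the whole real line: its left boundary data are the quotient [T] of the
    transform of [v] by [om], whose singularities are removable. Then
    [N x = <(L - x)^-1 v, v>] satisfies [N' = |(L - x)^-1 v|^2 >= N^2 / |v|^2] on all
    of the line, so it vanishes, and [v] with it. *)
Lemma no_orthogonal_complement (w p : nat -> R) (phi : R -> nat -> R)
    (al be k1 k2 : R) (v : nat -> R) :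
  admissible w p ->
  (forall x, recR w p x (fun _ => 0) (phi x)) ->
  (forall x, exists M, forall j, Rabs (phi x j) <= M) ->
  (forall x, is_lim_seq (fun n => phi x (2 * n)%nat) be) ->
  (forall x, is_lim_seq (fun n => phi x (2 * n + 1)%nat) al) ->
  0 < al ^ 2 + be ^ 2 ->
  let om := fun x => k1 * phi x 1%nat + k2 * phi x 0%nat in
  let Fv := fun x => ip w v (fun j => phi x (S j)) in
  (forall x, ex_derive om x) -> (forall x, ex_derive Fv x) ->
  (forall x, om x = 0 -> Fv x = 0 /\ Derive om x <> 0) ->
  l2 w v -> (k2 = 0 -> v 0%nat = 0) -> forall j, v j = 0.
Proof.
  intros Hadm Hphi HphiM Hbe Hal Hr om Fv Hom HFv Hzero Hv Hv0.
  assert (Hw := adm_pos Hadm).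
  set (V := ip w v v).
  destruct (Req_dec V 0) as [HV0|HV0]; [now apply ip_zero with w|].
  assert (HV : 0 < V) by (generalize (ip_pos w v Hw Hv); fold V; lra).
  (* Green's identity against [phi x] shows that [y x] meets the boundary condition at
     infinity exactly when [T x * om x = Fv x]. *)
  set (T := rquot Fv om).
  assert (HT : forall x, continuous T x) by now apply rquot_continuous.
  assert (HTom : forall x, T x * om x = Fv x).
  { intros x; unfold T, rquot; destruct (Req_EM_T (om x) 0) as [E|E].
    - destruct (Hzero x E) as [-> _]; rewrite E; ring.
    - field; exact E. }
  set (y := fun x => solR w p v x (- k1 * T x) (k2 * T x)).
  assert (Hy : forall x, recR w p x v (y x)) by (intros x; apply solR_rec).
  assert (Hyc : forall j x, continuous (fun t => y t j) x).
  { intros j x; apply solR_continuous; apply (continuous_scal_r (V := R_NormedModule)), HT. }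
  assert (Hyloc : forall x, exists B, 0 <= B /\ exists d, 0 < d /\
    forall t j, Rabs (t - x) < d -> Rabs (y t j) <= B).
  { intros x.
    assert (H1 := proj1 (filterlim_locally T (T x)) (HT x) (mkposreal 1 Rlt_0_1)).
    destruct H1 as [d Hd].
    set (A := (Rabs k1 + Rabs k2) * (Rabs (T x) + 1) + Series (fun j => w j * Rabs (v j))).
    assert (HA : 0 <= A).
    { unfold A; apply Rplus_le_le_0_compat.
      - generalize (Rabs_pos k1) (Rabs_pos k2) (Rabs_pos (T x)); nra.
      - apply Series_nonneg; [|now apply l2_l1 with p].
        intros j; apply Rmult_le_pos; [apply Rlt_le, Hw|apply Rabs_pos]. }
    exists (growth w p (Rabs x + 1) * A); split.
    { apply Rmult_le_pos; [apply Rlt_le, growth_pos|exact HA]. }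
    exists (Rmin 1 d); split; [apply Rmin_pos; [lra|apply cond_pos]|].
    intros t j Ht.
    assert (Ht1 := Rlt_le_trans _ _ _ Ht (Rmin_l _ _)).
    assert (Ht2 := Rlt_le_trans _ _ _ Ht (Rmin_r _ _)).
    assert (HTt : Rabs (T t) <= Rabs (T x) + 1).
    { assert (Hb : Rabs (T t - T x) < 1) by exact (Hd t Ht2).
      generalize (Rabs_triang_inv (T t) (T x)); lra. }
    assert (Htr : Rabs t <= Rabs x + 1) by (generalize (Rabs_triang_inv t x); lra).
    apply Rle_trans with (1 := recR_bound w p t _ v (y t) Hadm (Hy t) Htr
      (l2_l1 w p v Hadm Hv) j).
    apply Rmult_le_compat_l; [apply Rlt_le, growth_pos|].
    apply Rplus_le_compat_r.
    change (y t 0%nat) with (- k1 * T t); change (y t 1%nat) with (k2 * T t).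
    rewrite !Rabs_mult, Rabs_Ropp.
    generalize (Rabs_pos k1) (Rabs_pos k2); nra. }
  assert (HyB : forall x, exists B, forall j, Rabs (y x j) <= B).
  { intros x; destruct (Hyloc x) as [B [_ [d [Hd HB]]]]; exists B; intros j.
    apply HB; now rewrite Rminus_diag, Rabs_R0. }
  assert (Hyl2 : forall x, l2 w (fun j => y x (S j))).
  { intros x; destruct (HyB x) as [B HB]; apply l2_bounded with p B; auto. }
  assert (Hz0 : l2 w (fun _ => 0)).
  { apply l2_bounded with p 0; [exact Hadm|]; intros j; rewrite Rabs_R0; lra. }
  assert (Hip0 : forall f, ip w (fun _ => 0) f = 0).
  { intros f; apply is_series_unique, is_series_zero; intros n; ring. }
  assert (Hdef : forall x, is_lim_seq (end_defect (y x) al be) 0).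
  { intros x; destruct (HyB x) as [B HB]; destruct (HphiM x) as [M HM].
    assert (HWl : is_lim_seq (fun n => Wronsk (y x) (phi x) (2 * n)) 0).
    { apply (Green_limit w p x x 0 v (fun _ => 0) (y x) (phi x) B M); auto.
      rewrite Hip0, Rminus_diag.
      change (ip w v (fun j => phi x (S j))) with (Fv x); rewrite <- HTom.
      unfold Wronsk, sgn, om; change (y x 0%nat) with (- k1 * T x).
      change (y x 1%nat) with (k2 * T x); simpl; ring. }
    apply is_lim_seq_ext with (fun n => Wronsk (y x) (phi x) (2 * n) +
      ((be - phi x (2 * n)%nat) * y x (2 * n + 1)%nat
        - (al - phi x (2 * n + 1)%nat) * y x (2 * n)%nat)).
    { intros n; unfold Wronsk, end_defect; rewrite sgn_even.
      replace (S (2 * n)) with (2 * n + 1)%nat by lia; ring. }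
    replace (Finite 0) with (Finite (0 + (0 - 0))) by (f_equal; ring).
    apply is_lim_seq_plus'; [exact HWl|].
    apply is_lim_seq_minus'; apply lim0_mult_bounded with B; auto.
    - replace (Finite 0) with (Finite (be - be)) by (f_equal; ring).
      apply is_lim_seq_minus'; [apply is_lim_seq_const|apply Hbe].
    - replace (Finite 0) with (Finite (al - al)) by (f_equal; ring).
      apply is_lim_seq_minus'; [apply is_lim_seq_const|apply Hal]. }
  set (N := fun x => ip w v (fun j => y x (S j))).
  (* The resolvent identity: the Casoratian of [y t] and [y x] vanishes at both ends. *)
  assert (Hres : forall x t, N t - N x =
    (t - x) * ip w (fun j => y t (S j)) (fun j => y x (S j))).
  { intros x t; destruct (HyB x) as [B HB]; destruct (HyB t) as [B' HB'].
    assert (HWl : is_lim_seq (fun n => Wronsk (y t) (y x) (2 * n)) 0)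
      by (apply Wronsk_limit_0 with al be B' B; auto).
    apply (Green_limit w p t x 0 v v (y t) (y x) B' B) in HWl; auto.
    change (ip w v (fun j => y x (S j))) with (N x) in HWl.
    change (ip w v (fun j => y t (S j))) with (N t) in HWl.
    assert (E0 : Wronsk (y t) (y x) 0 = 0).
    { unfold Wronsk, y, solR; simpl; ring. }
    rewrite E0 in HWl; lra. }
  set (E := fun x => ip w (fun j => y x (S j)) (fun j => y x (S j))).
  assert (HN : forall x, is_derive N x (E x)).
  { intros x; unfold E.
    apply (is_derive_of_quotient N (fun t => ip w (fun j => y t (S j)) (fun j => y x (S j))));
      [apply Hres|].
    destruct (Hyloc x) as [B [HB0 [d [Hd HB]]]].
    apply Series_continuous with (b := fun j => B * B * w j) (d := d); [exact Hd| | |].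
    - intros j t Ht; assert (Hwj := Hw j).
      rewrite !Rabs_mult, (Rabs_pos_eq (w j)), Rmult_comm by lra.
      apply Rmult_le_compat_r; [lra|].
      apply Rmult_le_compat; try apply Rabs_pos; apply HB; [exact Ht|].
      now rewrite Rminus_diag, Rabs_R0.
    - apply (ex_series_scal (V := R_NormedModule) (B * B)), Hadm.
    - intros j; apply (continuous_scal_r (V := R_NormedModule)).
      apply (continuous_mult (K := R_AbsRing)); [apply Hyc|apply continuous_const]. }
  assert (HN0 := Riccati_zero N E V HV HN
    (fun x => Cauchy_Schwarz w v _ Hw Hv (Hyl2 x))).
  assert (HE0 : E 0 = 0).
  { assert (H1 := is_derive_unique _ _ _ (HN 0)).
    rewrite <- H1; rewrite (Derive_ext N (fun _ => 0)) by exact HN0.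
    apply Derive_const. }
  assert (Hy0 := ip_zero w _ Hw (Hyl2 0) HE0); simpl in Hy0.
  assert (Hvj : forall j, y 0 j = 0 -> v j = 0).
  { intros j Hj; assert (H := Hy 0 j); rewrite !Hy0, Hj in H.
    assert (H1 : sgn j * (w j * v j) = 0) by lra.
    assert (H2 : w j * v j = 0).
    { rewrite <- (Rmult_1_l (w j * v j)), <- (sgn_sqr j), Rmult_assoc, H1; ring. }
    specialize (Hw j); apply Rmult_integral in H2; destruct H2; lra. }
  intros [|j]; [|apply Hvj, Hy0].
  destruct (Req_dec k2 0) as [Hk|Hk]; [now apply Hv0|].
  apply Hvj; assert (H1 := Hy0 0%nat).
  change (y 0 0%nat) with (- k1 * T 0); change (y 0 1%nat) with (k2 * T 0) in H1.
  apply Rmult_integral in H1; destruct H1 as [H1|H1]; [easy|rewrite H1; ring].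
Qed.

(** * Eigenvalues and the characteristic function *)

(** The left boundary form of the fundamental solution; for the Dirac system this is [omega]. *)
Definition charfun (k1 k2 : R) (phi : C -> nat -> C) (lam : C) : C :=
  (RtoC k1 * phi lam 1%nat + RtoC k2 * phi lam 0%nat)%C.

(** The eigenvalue problem on the orbit, with its eigenvalues listed without repetition. *)
Record spectral (w p : nat -> R) (al be k1 k2 : R) (phi : C -> nat -> C)
    (ev : nat -> R) : Prop := {
  sp_adm : admissible w p;
  sp_fam : sol_family w p (RtoC al) (RtoC be) phi;
  sp_end : 0 < al ^ 2 + be ^ 2;
  sp_left : 0 < k1 ^ 2 + k2 ^ 2;
  sp_inj : forall m n, ev m = ev n -> m = n;
  sp_zero : forall mu, charfun k1 k2 phi mu = 0%C <-> exists n, mu = RtoC (ev n) }.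

Arguments sp_adm {w p al be k1 k2 phi ev} _.
Arguments sp_fam {w p al be k1 k2 phi ev} _.
Arguments sp_end {w p al be k1 k2 phi ev} _.
Arguments sp_left {w p al be k1 k2 phi ev} _.
Arguments sp_inj {w p al be k1 k2 phi ev} _.
Arguments sp_zero {w p al be k1 k2 phi ev} _.

Lemma Cconj_RtoC (x : R) : Cconj (RtoC x) = RtoC x.
Proof. unfold Cconj, RtoC; simpl; now rewrite Ropp_0. Qed.

(** The conjugate of a solution solves the same problem, so uniqueness applies. *)
Lemma family_real (w p : nat -> R) (al be : R) (phi : C -> nat -> C) (x : R) (j : nat) :
  admissible w p -> sol_family w p (RtoC al) (RtoC be) phi ->
  phi (RtoC x) j = RtoC (Re (phi (RtoC x) j)).
Proof.
  intros Hadm Hphi.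
  assert (H : phi (RtoC x) j = Cconj (phi (RtoC x) j)).
  { apply (recC_unique w p (RtoC x) _ (fun i => Cconj (phi (RtoC x) i))
      (RtoC al) (RtoC be) Hadm).
    - apply Hphi.
    - intros i; rewrite (fam_rec Hphi (RtoC x) i).
      rewrite Cplus_conj, !Cmult_conj, Cplus_conj, Cmult_conj, Cminus_conj.
      now rewrite !Cconj_RtoC.
    - apply Hphi.
    - destruct (fam_end Hphi (RtoC x)) as [H0 H1]; split.
      + apply is_lim_seq_ext with (2 := H0); intros n.
        now rewrite <- Cmod_conj, Cminus_conj, Cconj_RtoC.
      + apply is_lim_seq_ext with (2 := H1); intros n.
        now rewrite <- Cmod_conj, Cminus_conj, Cconj_RtoC. }
  destruct (phi (RtoC x) j) as [u v]; unfold Cconj, RtoC in *; simpl in *.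
  injection H; intros Hv; f_equal; lra.
Qed.

Definition phiR (phi : C -> nat -> C) (x : R) (j : nat) : R := Re (phi (RtoC x) j).

Lemma phiR_rec (w p : nat -> R) (al be : R) (phi : C -> nat -> C) (x : R) :
  admissible w p -> sol_family w p (RtoC al) (RtoC be) phi ->
  recR w p x (fun _ => 0) (phiR phi x).
Proof.
  intros Hadm Hphi j; unfold phiR.
  assert (Hr := fun i => family_real w p al be phi x i Hadm Hphi).
  rewrite (fam_rec Hphi (RtoC x) j), (Hr j), (Hr (S j)).
  simpl; ring.
Qed.

Lemma is_lim_seq_of_Cmod (u : nat -> C) (l : R) :
  is_lim_seq (fun n => Cmod (u n - RtoC l)) 0 -> is_lim_seq (fun n => Re (u n)) l.
Proof.
  intros H; apply is_lim_seq_ext with (fun n => Re (u n - RtoC l) + l).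
  - intros n; destruct (u n); simpl; ring.
  - replace (Finite l) with (Finite (0 + l)) by (f_equal; ring).
    apply is_lim_seq_plus'; [|apply is_lim_seq_const].
    apply is_lim_seq_abs_0, is_lim_seq_le_le with (fun _ => 0) (fun n => Cmod (u n - RtoC l)).
    + intros n; split; [apply Rabs_pos|apply re_le_Cmod].
    + apply is_lim_seq_const.
    + exact H.
Qed.

Lemma csum_ip (w : nat -> R) (f z : nat -> C) :
  (forall j, 0 < w j) ->
  l2 w (fun j => Re (f j)) -> l2 w (fun j => Im (f j)) ->
  l2 w (fun j => Re (z (S j))) -> l2 w (fun j => Im (z (S j))) ->
  csum w f z =
   (ip w (fun j => Re (f j)) (fun j => Re (z (S j)))
     - ip w (fun j => Im (f j)) (fun j => Im (z (S j))),
    ip w (fun j => Re (f j)) (fun j => Im (z (S j)))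
     + ip w (fun j => Im (f j)) (fun j => Re (z (S j)))).
Proof.
  intros Hw fr fi zr zi; unfold csum, CSeries, ip; f_equal.
  - rewrite <- Series_minus by now apply ip_ex.
    apply Series_ext; intros j; destruct (f j), (z (S j)); simpl; ring.
  - rewrite <- Series_plus by now apply ip_ex.
    apply Series_ext; intros j; destruct (f j), (z (S j)); simpl; ring.
Qed.

Lemma cl1_of_l2 (w p : nat -> R) (f : nat -> C) :
  admissible w p -> l2 w (fun j => Re (f j)) -> l2 w (fun j => Im (f j)) -> cl1 w f.
Proof.
  intros Hadm Hr Hi.
  apply ex_series_dom with (fun j => w j * Rabs (Re (f j)) + w j * Rabs (Im (f j))).
  - intros j; assert (Hw := adm_pos Hadm j).
    rewrite Rabs_pos_eq by (generalize (Cmod_ge_0 (f j)); nra).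
    rewrite <- Rmult_plus_distr_l; apply Rmult_le_compat_l; [lra|apply Cmod_le_Re_Im].
  - apply (ex_series_plus (V := R_NormedModule)); now apply l2_l1 with p.
Qed.

Lemma family_l2 (w p : nat -> R) (al be : C) (phi : C -> nat -> C) (r : R) (lam : C) :
  admissible w p -> sol_family w p al be phi -> Cmod lam <= r ->
  let M := growth w p r * (Cmod al + Cmod be) in
  l2 w (fun j => Re (phi lam (S j))) /\ l2 w (fun j => Im (phi lam (S j))) /\
  ip w (fun j => Re (phi lam (S j))) (fun j => Re (phi lam (S j))) <= M ^ 2 * Series w /\
  ip w (fun j => Im (phi lam (S j))) (fun j => Im (phi lam (S j))) <= M ^ 2 * Series w.
Proof.
  intros Hadm Hphi Hr M.
  assert (Hb := family_bound w p al be phi r lam Hadm Hphi Hr); fold M in Hb.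
  assert (H : forall f : nat -> R, (forall j, Rabs (f j) <= M) ->
    l2 w f /\ ip w f f <= M ^ 2 * Series w).
  { intros f Hf; split; [now apply l2_bounded with p M|].
    unfold ip; rewrite <- Series_scal_l; apply Series_le.
    - intros j; assert (Hw := adm_pos Hadm j).
      assert (Hsq : f j * f j <= M ^ 2).
      { replace (f j * f j) with (Rabs (f j) ^ 2) by (rewrite pow2_abs; ring).
        apply pow_incr; split; [apply Rabs_pos|apply Hf]. }
      generalize (pow2_ge_0 (f j)); nra.
    - apply (ex_series_scal (V := R_NormedModule) (M ^ 2)), Hadm. }
  destruct (H (fun j => Re (phi lam (S j)))) as [H1 H2].
  { intros j; apply Rle_trans with (1 := re_le_Cmod _), Hb. }
  destruct (H (fun j => Im (phi lam (S j)))) as [H3 H4].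
  { intros j; apply Rle_trans with (1 := Im_le_Cmod _), Hb. }
  now repeat split.
Qed.

(** Shifted by one, so that it is indexed like the weights and the function to be expanded. *)
Definition eigseq (phi : C -> nat -> C) (ev : nat -> R) (n j : nat) : R :=
  phiR phi (ev n) (S j).

Lemma eigseq_l2 (w p : nat -> R) (al be k1 k2 : R) (phi : C -> nat -> C)
    (ev : nat -> R) (n : nat) :
  spectral w p al be k1 k2 phi ev -> l2 w (eigseq phi ev n).
Proof.
  intros Hsp.
  apply (family_l2 w p (RtoC al) (RtoC be) phi (Cmod (RtoC (ev n))) (RtoC (ev n))
    (sp_adm Hsp) (sp_fam Hsp) (Rle_refl _)).
Qed.

(** A zero eigenfunction would have zero end values. *)
Lemma eigseq_norm_pos (w p : nat -> R) (al be k1 k2 : R) (phi : C -> nat -> C)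
    (ev : nat -> R) (n : nat) :
  spectral w p al be k1 k2 phi ev ->
  0 < ip w (eigseq phi ev n) (eigseq phi ev n).
Proof.
  intros Hsp; assert (Hw := adm_pos (sp_adm Hsp)).
  assert (Hl := eigseq_l2 w p al be k1 k2 phi ev n Hsp).
  destruct (ip_pos w _ Hw Hl) as [H|H]; [exact H|exfalso].
  assert (H0 := ip_zero w _ Hw Hl (eq_sym H)).
  destruct (fam_end (sp_fam Hsp) (RtoC (ev n))) as [He Ho].
  apply is_lim_seq_of_Cmod in He; apply is_lim_seq_of_Cmod in Ho.
  apply is_lim_seq_incr_1 in He.
  assert (E1 : is_lim_seq (fun _ => 0) be).
  { apply is_lim_seq_ext with (2 := He); intros k.
    replace (2 * S k)%nat with (S (2 * k + 1)) by lia; apply H0. }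
  assert (E2 : is_lim_seq (fun _ => 0) al).
  { apply is_lim_seq_ext with (2 := Ho); intros k.
    rewrite Nat.add_1_r; apply H0. }
  apply is_lim_seq_unique in E1; apply is_lim_seq_unique in E2.
  rewrite Lim_seq_const in E1, E2; injection E1; injection E2; intros <- <-.
  generalize (sp_end Hsp); lra.
Qed.

(** The boundary condition fixes the direction of [(phi 1, phi 0)]. The factor [d] is nonzero,
    because two consecutive zeros would propagate along the recurrence. *)
Lemma eigen_left (w p : nat -> R) (al be k1 k2 : R) (phi : C -> nat -> C)
    (ev : nat -> R) (n : nat) :
  spectral w p al be k1 k2 phi ev ->
  exists d : R, d <> 0 /\ phi (RtoC (ev n)) 1%nat = RtoC (d * k2) /\
    phi (RtoC (ev n)) 0%nat = RtoC (- d * k1).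
Proof.
  intros Hsp; assert (Hk := sp_left Hsp).
  assert (Hr := fun i => family_real w p al be phi (ev n) i
    (sp_adm Hsp) (sp_fam Hsp)).
  assert (H0 : charfun k1 k2 phi (RtoC (ev n)) = 0%C)
    by (apply (sp_zero Hsp); now exists n).
  unfold charfun in H0; rewrite (Hr 0%nat), (Hr 1%nat) in *.
  set (a := Re (phi (RtoC (ev n)) 1%nat)) in *.
  set (b := Re (phi (RtoC (ev n)) 0%nat)) in *.
  rewrite <- !RtoC_mult, <- RtoC_plus in H0.
  assert (E : k1 * a + k2 * b = 0) by (injection H0; auto).
  assert (Ha : a = (k2 * a - k1 * b) / (k1 ^ 2 + k2 ^ 2) * k2).
  { apply Rmult_eq_reg_r with (k1 ^ 2 + k2 ^ 2); [|lra].
    replace ((k2 * a - k1 * b) / (k1 ^ 2 + k2 ^ 2) * k2 * (k1 ^ 2 + k2 ^ 2))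
      with ((k2 * a - k1 * b) * k2) by (field; lra).
    replace (a * (k1 ^ 2 + k2 ^ 2))
      with (k1 * (k1 * a + k2 * b) + (k2 * a - k1 * b) * k2) by ring.
    rewrite E; ring. }
  assert (Hb : b = - ((k2 * a - k1 * b) / (k1 ^ 2 + k2 ^ 2)) * k1).
  { apply Rmult_eq_reg_r with (k1 ^ 2 + k2 ^ 2); [|lra].
    replace (- ((k2 * a - k1 * b) / (k1 ^ 2 + k2 ^ 2)) * k1 * (k1 ^ 2 + k2 ^ 2))
      with (- (k2 * a - k1 * b) * k1) by (field; lra).
    replace (b * (k1 ^ 2 + k2 ^ 2))
      with (k2 * (k1 * a + k2 * b) - (k2 * a - k1 * b) * k1) by ring.
    rewrite E; ring. }
  exists ((k2 * a - k1 * b) / (k1 ^ 2 + k2 ^ 2)); split; [|split; now f_equal].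
  intros Hd; rewrite Hd in Ha, Hb.
  assert (Hz : forall j, phiR phi (ev n) j = 0 /\ phiR phi (ev n) (S j) = 0).
  { induction j as [|j [IH1 IH2]].
    - split; [change (b = 0)|change (a = 0)]; lra.
    - split; [exact IH2|].
      rewrite (phiR_rec w p al be phi (ev n) (sp_adm Hsp)
        (sp_fam Hsp) j), IH1, IH2; ring. }
  generalize (eigseq_norm_pos w p al be k1 k2 phi ev n Hsp).
  unfold ip; rewrite (Series_ext _ (fun _ => 0 * 0)).
  - rewrite Series_scal_l; lra.
  - intros j; unfold eigseq; rewrite (proj2 (Hz j)); ring.
Qed.

(** The bilinear pairing of the [n]-th eigenfunction with [phi lam]; divided by the squared
    norm it is the sampling kernel. *)
Definition eigcoef (w : nat -> R) (phi : C -> nat -> C) (ev : nat -> R) (n : nat)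
    (lam : C) : C := csum w (fun j => RtoC (eigseq phi ev n j)) (phi lam).

Lemma eigseq_cl1 (w p : nat -> R) (al be k1 k2 : R) (phi : C -> nat -> C)
    (ev : nat -> R) (n : nat) :
  spectral w p al be k1 k2 phi ev -> cl1 w (fun j => RtoC (eigseq phi ev n j)).
Proof.
  intros Hsp; apply cl1_of_l2 with p; [apply Hsp|now apply (eigseq_l2 w p al be k1 k2)|].
  apply l2_bounded with p 0; [apply Hsp|]; intros j; simpl; rewrite Rabs_R0; lra.
Qed.

Lemma ip_zero_l (w f : nat -> R) : ip w (fun _ => 0) f = 0.
Proof. apply is_series_unique, is_series_zero; intros n; ring. Qed.

Lemma l2_zero (w : nat -> R) : l2 w (fun _ => 0).
Proof. exists 0; apply is_series_zero; intros n; ring. Qed.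

(** Green's identity at an eigenvalue, where the left boundary values of [phi] are known up to
    the factor [d], turns the Casoratian into a multiple of the characteristic function. *)
Lemma charfun_factor (w p : nat -> R) (al be k1 k2 : R) (phi : C -> nat -> C)
    (ev : nat -> R) (n : nat) :
  spectral w p al be k1 k2 phi ev ->
  exists d : R, d <> 0 /\ forall lam,
    charfun k1 k2 phi lam = ((lam - RtoC (ev n)) * (RtoC d * eigcoef w phi ev n lam))%C.
Proof.
  intros Hsp; destruct (eigen_left w p al be k1 k2 phi ev n Hsp) as [d [Hd [H1 H0]]].
  (* With [d] as in [eigen_left], the Casoratian at the left end is [- d * charfun]. *)
  exists (- / d); split.
  { apply Ropp_neq_0_compat; now apply Rinv_neq_0_compat. }
  intros lam.
  assert (HG := Green_family w p (RtoC al) (RtoC be) phi lam (RtoC (ev n))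
    (sp_adm Hsp) (sp_fam Hsp)).
  rewrite H1, H0 in HG.
  replace (csum w (fun j => phi (RtoC (ev n)) (S j)) (phi lam))
    with (eigcoef w phi ev n lam) in HG.
  2: { apply CSeries_ext; intros j; unfold eigseq, phiR.
       now rewrite <- (family_real w p al be phi (ev n) (S j)
         (sp_adm Hsp) (sp_fam Hsp)). }
  replace ((lam - RtoC (ev n)) * (RtoC (- / d) * eigcoef w phi ev n lam))%C
    with (RtoC (- / d) * ((lam - RtoC (ev n)) * eigcoef w phi ev n lam))%C by ring.
  rewrite <- HG; unfold charfun.
  assert (E : (RtoC (- / d) * RtoC d)%C = RtoC (-1))
    by (rewrite <- RtoC_mult; f_equal; field; exact Hd).
  set (c := RtoC (- / d)) in *.
  rewrite !RtoC_mult, (RtoC_opp d).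
  transitivity (- (c * RtoC d) * (RtoC k1 * phi lam 1%nat + RtoC k2 * phi lam 0%nat))%C.
  - rewrite E; replace (- RtoC (-1))%C with (RtoC 1) by (rewrite <- RtoC_opp; f_equal; ring).
    ring.
  - ring.
Qed.

Lemma eigcoef_eigenvalue (w p : nat -> R) (al be k1 k2 : R) (phi : C -> nat -> C)
    (ev : nat -> R) (n m : nat) :
  spectral w p al be k1 k2 phi ev ->
  eigcoef w phi ev n (RtoC (ev m)) = RtoC (ip w (eigseq phi ev n) (eigseq phi ev m)).
Proof.
  intros Hsp; unfold eigcoef.
  transitivity (csum w (fun j => RtoC (eigseq phi ev n j))
    (fun j => RtoC (phiR phi (ev m) j))).
  - apply CSeries_ext; intros j; unfold phiR.
    now rewrite <- (family_real w p al be phi (ev m) (S j)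
      (sp_adm Hsp) (sp_fam Hsp)).
  - rewrite csum_ip.
    + unfold RtoC; simpl; rewrite !ip_zero_l, (ip_sym w _ (fun _ => 0)), ip_zero_l.
      f_equal; unfold eigseq; ring.
    + apply Hsp.
    + now apply (eigseq_l2 w p al be k1 k2 phi ev).
    + apply l2_zero.
    + now apply (eigseq_l2 w p al be k1 k2 phi ev).
    + apply l2_zero.
Qed.

Lemma C_derive_continuity (G : C -> C) (x : C) (eps : R) :
  ex_derive (K := C_AbsRing) (V := C_NormedModule) G x -> 0 < eps ->
  exists d, 0 < d /\ forall y, Cmod (y - x) < d -> Cmod (G y - G x) < eps.
Proof.
  intros [l Hl] He.
  destruct (proj2 (C_derive_eps G x l) Hl 1 Rlt_0_1) as [d [Hd HG]].
  assert (Hl0 := Cmod_ge_0 l).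
  assert (Hq : 0 < eps / (2 + Cmod l)) by (apply Rdiv_lt_0_compat; lra).
  exists (Rmin d (eps / (2 + Cmod l))); split; [now apply Rmin_pos|].
  intros y Hy.
  assert (Hy1 := Rlt_le_trans _ _ _ Hy (Rmin_l _ _)).
  assert (Hy2 := Rlt_le_trans _ _ _ Hy (Rmin_r _ _)).
  replace (G y - G x)%C with ((G y - G x - (y - x) * l) + (y - x) * l)%C by ring.
  apply Rle_lt_trans with (1 := Cmod_triangle _ _); rewrite Cmod_mult.
  specialize (HG y Hy1); generalize (Cmod_ge_0 (y - x)); intros H0.
  apply Rle_lt_trans with (Cmod (y - x) * (1 + Cmod l)); [lra|].
  apply Rlt_le_trans with (eps / (2 + Cmod l) * (2 + Cmod l));
    [nra|apply Req_le; field; lra].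
Qed.

Lemma C_locally_Cmod (x : C) (P : C -> Prop) (d : R) :
  0 < d -> (forall y, Cmod (y - x) < d -> P y) -> locally x P.
Proof.
  intros Hd HP.
  assert (Hd2 : 0 < d / 2) by lra.
  exists (mkposreal _ Hd2); intros y Hy; apply HP.
  assert (Hs : Cmod (y - x) < sqrt 2 * (d / 2))
    by exact (C_NormedModule_mixin_compat2 x y (mkposreal _ Hd2) Hy).
  assert (sqrt 2 < 2) by (apply sqrt_less; lra); nra.
Qed.

Lemma C_sub_neq0 (x y : C) : x <> y -> (x - y)%C <> 0%C.
Proof.
  intros H E; apply H; replace x with ((x - y) + y)%C by ring; rewrite E; ring.
Qed.

Lemma eigcoef_derivable (w p : nat -> R) (al be k1 k2 : R) (phi : C -> nat -> C)
    (ev : nat -> R) (n : nat) (lam : C) :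
  spectral w p al be k1 k2 phi ev ->
  ex_derive (K := C_AbsRing) (V := C_NormedModule) (eigcoef w phi ev n) lam.
Proof.
  intros Hsp; apply csum_derivable with p (RtoC al) (RtoC be); try apply Hsp.
  now apply (eigseq_cl1 w p al be k1 k2).
Qed.

Lemma charfun_derive_eigenvalue (w p : nat -> R) (al be k1 k2 : R)
    (phi : C -> nat -> C) (ev : nat -> R) (n : nat) (d : R) :
  spectral w p al be k1 k2 phi ev ->
  (forall lam, charfun k1 k2 phi lam =
    ((lam - RtoC (ev n)) * (RtoC d * eigcoef w phi ev n lam))%C) ->
  is_derive (K := C_AbsRing) (V := C_NormedModule) (charfun k1 k2 phi) (RtoC (ev n))
    (RtoC d * eigcoef w phi ev n (RtoC (ev n)))%C.
Proof.
  intros Hsp Hf; apply C_derive_eps; intros eps He.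
  assert (He' : 0 < eps / (Rabs d + 1))
    by (apply Rdiv_lt_0_compat; generalize (Rabs_pos d); lra).
  destruct (C_derive_continuity (eigcoef w phi ev n) (RtoC (ev n)) _
    (eigcoef_derivable w p al be k1 k2 phi ev n _ Hsp) He') as [dl [Hdl Hc]].
  exists dl; split; [exact Hdl|]; intros y Hy; specialize (Hc y Hy).
  rewrite !Hf.
  set (Ky := eigcoef w phi ev n y) in *; set (K0 := eigcoef w phi ev n (RtoC (ev n))) in *.
  replace ((y - RtoC (ev n)) * (RtoC d * Ky) - (RtoC (ev n) - RtoC (ev n)) * (RtoC d * K0)
    - (y - RtoC (ev n)) * (RtoC d * K0))%C
    with (RtoC d * (Ky - K0) * (y - RtoC (ev n)))%C by ring.
  rewrite !Cmod_mult, Cmod_R; apply Rmult_le_compat_r; [apply Cmod_ge_0|].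
  apply Rle_trans with (Rabs d * (eps / (Rabs d + 1))).
  - apply Rmult_le_compat_l; [apply Rabs_pos|lra].
  - replace eps with ((Rabs d + 1) * (eps / (Rabs d + 1))) at 2
      by (field; generalize (Rabs_pos d); lra).
    generalize (Rabs_pos d); nra.
Qed.

(** The factorization of the characteristic function cancels the factor [lam - ev n], both
    in the quotient and in the derivative; the continuity of the remaining factor settles
    the value at [lam = ev n]. *)
Lemma sampling_kernel_eigcoef (w p : nat -> R) (al be k1 k2 : R)
    (phi : C -> nat -> C) (ev : nat -> R) (n : nat) (lam : C) :
  spectral w p al be k1 k2 phi ev ->
  sampling_kernel (charfun k1 k2 phi) (RtoC (ev n)) lam =
  (eigcoef w phi ev n lam / RtoC (ip w (eigseq phi ev n) (eigseq phi ev n)))%C.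
Proof.
  intros Hsp.
  destruct (charfun_factor w p al be k1 k2 phi ev n Hsp) as [d [Hd Hf]].
  assert (HD := charfun_derive_eigenvalue w p al be k1 k2 phi ev n d Hsp Hf).
  rewrite (eigcoef_eigenvalue w p al be k1 k2 phi ev n n Hsp) in HD.
  assert (HN := eigseq_norm_pos w p al be k1 k2 phi ev n Hsp).
  assert (HK := eigcoef_eigenvalue w p al be k1 k2 phi ev n n Hsp).
  set (N := ip w (eigseq phi ev n) (eigseq phi ev n)) in *.
  assert (HN0 : RtoC N <> 0%C) by (intros E; apply RtoC_inj in E; lra).
  assert (Hd0 : RtoC d <> 0%C) by (intros E; apply RtoC_inj in E; easy).
  unfold sampling_kernel; rewrite (is_C_derive_unique _ _ _ HD).
  assert (Hg : forall u, u <> RtoC (ev n) ->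
    (charfun k1 k2 phi u / ((u - RtoC (ev n)) * (RtoC d * RtoC N)))%C =
    (eigcoef w phi ev n u / RtoC N)%C).
  { intros u Hu; rewrite Hf; field; repeat split; auto; now apply C_sub_neq0. }
  destruct (Ceq_dec lam (RtoC (ev n))) as [->|Hne]; [|now apply Hg].
  rewrite HK; apply is_C_lim_unique.
  intros P [eps HP].
  assert (He : 0 < eps * N) by (apply Rmult_lt_0_compat; [apply cond_pos|lra]).
  destruct (C_derive_continuity (eigcoef w phi ev n) (RtoC (ev n)) _
    (eigcoef_derivable w p al be k1 k2 phi ev n _ Hsp) He) as [dl [Hdl Hc]].
  apply C_locally_Cmod with dl; [exact Hdl|]; intros y Hy Hyne.
  apply HP, C_ball_le; rewrite Hg by exact Hyne.
  rewrite HK in Hc.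
  replace (eigcoef w phi ev n y / RtoC N - RtoC N / RtoC N)%C
    with ((eigcoef w phi ev n y - RtoC N) / RtoC N)%C by (field; exact HN0).
  rewrite Cmod_div, Cmod_R, Rabs_pos_eq by (auto || lra).
  apply Rmult_lt_reg_r with N; [exact HN|].
  replace (Cmod _ / N * N) with (Cmod (eigcoef w phi ev n y - RtoC N)) by (field; lra).
  now apply Hc.
Qed.

(** The factorization of the characteristic function at one eigenvalue is evaluated at
    another one. *)
Lemma eigseq_orthogonal (w p : nat -> R) (al be k1 k2 : R)
    (phi : C -> nat -> C) (ev : nat -> R) (n m : nat) :
  spectral w p al be k1 k2 phi ev -> n <> m ->
  ip w (eigseq phi ev n) (eigseq phi ev m) = 0.
Proof.
  intros Hsp Hnm.
  destruct (charfun_factor w p al be k1 k2 phi ev n Hsp) as [d [Hd Hf]].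
  specialize (Hf (RtoC (ev m))).
  rewrite (eigcoef_eigenvalue w p al be k1 k2 phi ev n m Hsp) in Hf.
  rewrite (proj2 (sp_zero Hsp (RtoC (ev m)))) in Hf by now exists m.
  rewrite <- RtoC_minus, <- !RtoC_mult in Hf; apply RtoC_inj in Hf.
  assert (Hne : ev m - ev n <> 0).
  { intros E; apply Hnm, (sp_inj Hsp); lra. }
  symmetry in Hf; apply Rmult_integral in Hf; destruct Hf as [Hf|Hf]; [easy|].
  apply Rmult_integral in Hf; destruct Hf as [Hf|Hf]; [easy|exact Hf].
Qed.

Definition eigvec (w : nat -> R) (phi : C -> nat -> C) (ev : nat -> R) (n j : nat) : R :=
  / sqrt (ip w (eigseq phi ev n) (eigseq phi ev n)) * eigseq phi ev n j.

Lemma ip_scal_r (w f g : nat -> R) (c : R) :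
  ip w f (fun j => c * g j) = c * ip w f g.
Proof.
  unfold ip; rewrite <- Series_scal_l; apply Series_ext; intros j; ring.
Qed.

Lemma eigvec_orthonormal (w p : nat -> R) (al be k1 k2 : R)
    (phi : C -> nat -> C) (ev : nat -> R) :
  spectral w p al be k1 k2 phi ev -> orthonormal w (eigvec w phi ev).
Proof.
  intros Hsp; split.
  - intros k; assert (Hl := eigseq_l2 w p al be k1 k2 phi ev k Hsp).
    apply ex_series_ext with (2 := l2_lin w _ _ (/ sqrt (ip w (eigseq phi ev k)
      (eigseq phi ev k))) 0 (adm_pos (sp_adm Hsp)) Hl Hl).
    intros j; unfold eigvec; as_real; ring.
  - intros k m.
    assert (Hc : forall (f g : nat -> R) a b,
      ip w (fun j => a * f j) (fun j => b * g j) = a * b * ip w f g).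
    { intros f g a b; rewrite ip_scal_r, ip_sym, ip_scal_r, ip_sym; ring. }
    unfold eigvec; rewrite Hc.
    destruct (Nat.eqb_spec k m) as [<-|Hne].
    + assert (HN := eigseq_norm_pos w p al be k1 k2 phi ev k Hsp).
      set (N := ip w _ _) in *.
      assert (Hs : 0 < sqrt N) by now apply sqrt_lt_R0.
      rewrite <- (sqrt_sqrt N) at 3 by lra; field; lra.
    + rewrite (eigseq_orthogonal w p al be k1 k2 phi ev k m Hsp Hne); ring.
Qed.

Lemma ip_RtoC_csum (w p : nat -> R) (al be : C) (phi : C -> nat -> C) (v : nat -> R)
    (lam : C) :
  admissible w p -> sol_family w p al be phi -> l2 w v ->
  Re (csum w (fun j => RtoC (v j)) (phi lam)) = ip w v (fun j => Re (phi lam (S j))).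
Proof.
  intros Hadm Hphi Hv.
  destruct (family_l2 w p al be phi (Cmod lam) lam Hadm Hphi (Rle_refl _)) as [Hr [Hi _]].
  rewrite csum_ip.
  - transitivity (ip w v (fun j => Re (phi lam (S j))) - ip w (fun _ => 0) (fun j => Im (phi lam (S j))));
      [reflexivity|rewrite ip_zero_l; ring].
  - apply Hadm.
  - exact Hv.
  - apply l2_zero.
  - exact Hr.
  - exact Hi.
Qed.

(** If [k2 = 0], the boundary condition forces every eigenfunction to vanish at the first
    index, so the expansion can only reach functions that vanish there. *)
Lemma eigvec_Parseval (w p : nat -> R) (al be k1 k2 : R)
    (phi : C -> nat -> C) (ev : nat -> R) (f g : nat -> R) :
  spectral w p al be k1 k2 phi ev -> l2 w f -> l2 w g -> (k2 = 0 -> f 0%nat = 0) ->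
  ex_series (fun k => Rabs (ip w f (eigvec w phi ev k) * ip w g (eigvec w phi ev k))) /\
  Series (fun k => ip w f (eigvec w phi ev k) * ip w g (eigvec w phi ev k)) = ip w f g.
Proof.
  intros Hsp Hf Hg Hf0.
  assert (Hadm := sp_adm Hsp); assert (Hfam := sp_fam Hsp).
  assert (Hs : forall k, / sqrt (ip w (eigseq phi ev k) (eigseq phi ev k)) <> 0).
  { intros k; apply Rinv_neq_0_compat.
    assert (HN := sqrt_lt_R0 _ (eigseq_norm_pos w p al be k1 k2 phi ev k Hsp)); lra. }
  apply Parseval_of_complete; [apply Hadm| | exact Hf|exact Hg|].
  { now apply (eigvec_orthonormal w p al be k1 k2). }
  intros v Hv Hvo Hvf.
  assert (Hvo' : forall n, ip w v (eigseq phi ev n) = 0).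
  { intros n; specialize (Hvo n); unfold eigvec in Hvo; rewrite ip_scal_r in Hvo.
    apply Rmult_integral in Hvo; destruct Hvo as [H|H]; [now destruct (Hs n)|exact H]. }
  assert (Hom : forall x : R, k1 * phiR phi x 1%nat + k2 * phiR phi x 0%nat =
    Re (charfun k1 k2 phi (RtoC x))).
  { intros x; unfold phiR, charfun; destruct (phi (RtoC x) 1%nat), (phi (RtoC x) 0%nat); simpl; ring. }
  assert (HFv : forall x : R, ip w v (fun j => phiR phi x (S j)) =
    Re (csum w (fun j => RtoC (v j)) (phi (RtoC x)))).
  { intros x; symmetry; now apply (ip_RtoC_csum w p (RtoC al) (RtoC be)). }
  assert (Hdc : forall lam, ex_derive (K := C_AbsRing) (V := C_NormedModule)
    (charfun k1 k2 phi) lam).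
  { intros lam.
    assert (Hsc : forall (k : C) j, ex_derive (K := C_AbsRing) (V := C_NormedModule)
      (fun mu => k * phi mu j)%C lam).
    { intros k j; destruct (family_derivable w p _ _ phi j lam Hadm Hfam) as [l Hl].
      exists (k * l)%C.
      apply (filterdiff_ext_lin (K := C_AbsRing) (U := AbsRing_NormedModule C_AbsRing)
        (V := C_NormedModule) _ (fun y : C => (k * (y * l))%C)).
      - apply (filterdiff_scal_r_fct (K := C_AbsRing) (U := AbsRing_NormedModule C_AbsRing)
          (V := C_NormedModule) k (fun mu => phi mu j) (fun y => y * l)%C);
          [apply Cmult_comm|exact Hl].
      - intros y; change ((k * (y * l))%C = (y * (k * l))%C); ring. }
    exact (ex_derive_plus (K := C_AbsRing) (V := C_NormedModule) _ _ _
      (Hsc (RtoC k1) 1%nat) (Hsc (RtoC k2) 0%nat)). }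
  apply (no_orthogonal_complement w p (phiR phi) al be k1 k2 v Hadm).
  - intros x; now apply (phiR_rec w p al be).
  - intros x; exists (growth w p (Cmod (RtoC x)) * (Cmod (RtoC al) + Cmod (RtoC be))).
    intros j; apply Rle_trans with (1 := re_le_Cmod _).
    apply (family_bound w p _ _ phi _ _ Hadm Hfam (Rle_refl _)).
  - intros x; apply is_lim_seq_of_Cmod with (u := fun n => phi (RtoC x) (2 * n)%nat), Hfam.
  - intros x; apply is_lim_seq_of_Cmod with (u := fun n => phi (RtoC x) (2 * n + 1)%nat), Hfam.
  - apply Hsp.
  - intros x; apply ex_derive_ext with (fun x : R => Re (charfun k1 k2 phi (RtoC x))).
    { intros t; now rewrite Hom. }
    destruct (Hdc (RtoC x)) as [l Hl]; exists (Re l); now apply is_derive_Re.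
  - intros x; apply ex_derive_ext with
      (fun x : R => Re (csum w (fun j => RtoC (v j)) (phi (RtoC x)))).
    { intros t; now rewrite HFv. }
    destruct (csum_derivable w p _ _ phi (fun j => RtoC (v j)) (RtoC x) Hadm Hfam)
      as [l Hl].
    { apply cl1_of_l2 with p; [exact Hadm|exact Hv|apply l2_zero]. }
    exists (Re l); now apply (is_derive_Re (fun lam => csum w (fun j => RtoC (v j)) (phi lam))).
  - intros x Hx.
    assert (Hc0 : charfun k1 k2 phi (RtoC x) = 0%C).
    { rewrite Hom in Hx.
      assert (Hi : Im (charfun k1 k2 phi (RtoC x)) = 0).
      { unfold charfun; rewrite (family_real w p al be phi x 0 Hadm Hfam),
          (family_real w p al be phi x 1 Hadm Hfam); simpl; ring. }
      destruct (charfun k1 k2 phi (RtoC x)) as [u t]; simpl in *; now rewrite Hx, Hi. }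
    apply (sp_zero Hsp) in Hc0; destruct Hc0 as [n Hn].
    apply RtoC_inj in Hn; subst x; split; [apply Hvo'|].
    destruct (charfun_factor w p al be k1 k2 phi ev n Hsp) as [d [Hd Hcf]].
    assert (HD := charfun_derive_eigenvalue w p al be k1 k2 phi ev n d Hsp Hcf).
    rewrite (eigcoef_eigenvalue w p al be k1 k2 phi ev n n Hsp) in HD.
    apply is_derive_Re in HD.
    rewrite (Derive_ext _ _ _ Hom), (is_derive_unique _ _ _ HD).
    assert (HN := eigseq_norm_pos w p al be k1 k2 phi ev n Hsp).
    simpl; rewrite Rmult_0_l, Rminus_0_r; apply Rmult_integral_contrapositive; lra.
  - exact Hv.
  - intros Hk2; rewrite Hvf; [now apply Hf0|]; intros k; unfold eigvec, eigseq, phiR.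
    destruct (eigen_left w p al be k1 k2 phi ev k Hsp) as [d [_ [-> _]]].
    rewrite Hk2; simpl; ring.
Qed.

(** * The eigenfunction expansion *)

Definition expansion_term (w : nat -> R) (phi : C -> nat -> C) (ev : nat -> R)
    (f : nat -> C) (n : nat) (lam : C) : C :=
  (csum w f (phi (RtoC (ev n))) *
   (eigcoef w phi ev n lam / RtoC (ip w (eigseq phi ev n) (eigseq phi ev n))))%C.

(** Splits each term into real inner products, to which the real theory applies: the
    eigenfunctions are real, while [f] and [phi lam] are complex. *)
Lemma expansion_term_coords (w p : nat -> R) (al be k1 k2 : R)
    (phi : C -> nat -> C) (ev : nat -> R) (f : nat -> C) (n : nat) (lam : C) :
  spectral w p al be k1 k2 phi ev ->
  l2 w (fun j => Re (f j)) -> l2 w (fun j => Im (f j)) ->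
  expansion_term w phi ev f n lam =
  ((ip w (fun j => Re (f j)) (eigvec w phi ev n),
    ip w (fun j => Im (f j)) (eigvec w phi ev n)) *
   (ip w (fun j => Re (phi lam (S j))) (eigvec w phi ev n),
    ip w (fun j => Im (phi lam (S j))) (eigvec w phi ev n)))%C.
Proof.
  intros Hsp Hr Hi; unfold expansion_term.
  assert (Hadm := sp_adm Hsp); assert (Hfam := sp_fam Hsp).
  assert (Hw := adm_pos Hadm).
  assert (HN := eigseq_norm_pos w p al be k1 k2 phi ev n Hsp).
  assert (Hl := eigseq_l2 w p al be k1 k2 phi ev n Hsp).
  destruct (family_l2 w p _ _ phi (Cmod lam) lam Hadm Hfam (Rle_refl _)) as [Zr [Zi _]].
  replace (csum w f (phi (RtoC (ev n)))) with
    (csum w f (fun j => RtoC (phiR phi (ev n) j))).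
  2: { apply CSeries_ext; intros j; unfold phiR.
       now rewrite <- (family_real w p al be phi (ev n) (S j) Hadm Hfam). }
  rewrite (csum_ip w f (fun j => RtoC (phiR phi (ev n) j)) Hw Hr Hi Hl (l2_zero w)).
  unfold eigcoef; rewrite (csum_ip w (fun j => RtoC (eigseq phi ev n j)) (phi lam) Hw Hl
    (l2_zero w) Zr Zi).
  change (fun j => Re (RtoC (phiR phi (ev n) (S j)))) with (eigseq phi ev n).
  change (fun j => Re (RtoC (eigseq phi ev n j))) with (fun j => eigseq phi ev n j).
  change (fun j : nat => Im (RtoC (phiR phi (ev n) (S j)))) with (fun _ : nat => 0).
  change (fun j : nat => Im (RtoC (eigseq phi ev n j))) with (fun _ : nat => 0).
  rewrite !(ip_sym w _ (fun _ => 0)), !ip_zero_l.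
  unfold eigvec; rewrite !ip_scal_r.
  change (fun j => eigseq phi ev n j) with (eigseq phi ev n).
  rewrite !(ip_sym w (eigseq phi ev n) (fun j => _ (phi lam (S j)))).
  set (N := ip w (eigseq phi ev n) (eigseq phi ev n)) in *.
  assert (Hs : 0 < sqrt N) by now apply sqrt_lt_R0.
  set (X := ip w _ (eigseq phi ev n)); set (Y := ip w _ (eigseq phi ev n)).
  set (Z := ip w _ (eigseq phi ev n)); set (T := ip w _ (eigseq phi ev n)).
  assert (Hss : / N = / sqrt N * / sqrt N).
  { rewrite <- (sqrt_sqrt N) at 1 by lra; field; lra. }
  unfold Cdiv; rewrite <- RtoC_inv, Hss by lra.
  unfold Cmult, RtoC; simpl; f_equal; ring.
Qed.

(** The expansion of the transform in eigenfunctions is Parseval's identity; its tails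
    are small uniformly for bounded parameters, because the factor depending on the
    parameter is controlled by Bessel's inequality. *)
Lemma expansion_converges (w p : nat -> R) (al be k1 k2 : R)
    (phi : C -> nat -> C) (ev : nat -> R) (f : nat -> C) :
  spectral w p al be k1 k2 phi ev ->
  l2 w (fun j => Re (f j)) -> l2 w (fun j => Im (f j)) ->
  (k2 = 0 -> f 0%nat = 0%C) ->
  (forall lam, ex_series (fun n => Cmod (expansion_term w phi ev f n lam)) /\
     CSeries (fun n => expansion_term w phi ev f n lam) = csum w f (phi lam)) /\
  (forall r eps, 0 < eps -> exists N, forall lam, Cmod lam <= r ->
     Series (fun n => Cmod (expansion_term w phi ev f n lam))
       - sum_n (fun n => Cmod (expansion_term w phi ev f n lam)) N < eps).
Proof.
  intros Hsp Hr Hi Hf0.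
  assert (Hadm := sp_adm Hsp); assert (Hfam := sp_fam Hsp).
  assert (Hw := adm_pos Hadm).
  assert (Ho := eigvec_orthonormal w p al be k1 k2 phi ev Hsp).
  set (e := eigvec w phi ev) in *.
  set (fr := fun j => Re (f j)) in *; set (fi := fun j => Im (f j)) in *.
  set (zr := fun (lam : C) j => Re (phi lam (S j))).
  set (zi := fun (lam : C) j => Im (phi lam (S j))).
  assert (Hz : forall lam, l2 w (zr lam) /\ l2 w (zi lam)).
  { intros lam; destruct (family_l2 w p _ _ phi (Cmod lam) lam Hadm Hfam (Rle_refl _))
      as [Zr [Zi _]]; now split. }
  assert (Hu : forall n lam, expansion_term w phi ev f n lam =
    ((ip w fr (e n), ip w fi (e n)) * (ip w (zr lam) (e n), ip w (zi lam) (e n)))%C)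
    by (intros n lam; now apply (expansion_term_coords w p al be k1 k2)).
  destruct (Bessel w fr e Hw Ho Hr) as [SA _]; destruct (Bessel w fi e Hw Ho Hi) as [SB _].
  set (P := fun n => ip w fr (e n) ^ 2 + ip w fi (e n) ^ 2).
  set (Q := fun lam n => ip w (zr lam) (e n) ^ 2 + ip w (zi lam) (e n) ^ 2).
  assert (SP : ex_series P) by exact (ex_series_plus (V := R_NormedModule) _ _ SA SB).
  assert (SQ : forall lam, ex_series (Q lam) /\
    Series (Q lam) <= ip w (zr lam) (zr lam) + ip w (zi lam) (zi lam)).
  { intros lam; destruct (Hz lam) as [Zr Zi].
    destruct (Bessel w _ e Hw Ho Zr) as [S1 L1]; destruct (Bessel w _ e Hw Ho Zi) as [S2 L2].
    split; [exact (ex_series_plus (V := R_NormedModule) _ _ S1 S2)|].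
    unfold Q; rewrite Series_plus by assumption; lra. }
  assert (Hdom : forall del lam n, 0 < del ->
    Cmod (expansion_term w phi ev f n lam) <= / del * P n + del * Q lam n).
  { intros del lam n Hdel; rewrite Hu, Cmod_mult; unfold P, Q.
    set (A := ip w fr (e n)); set (B := ip w fi (e n)).
    set (C := ip w (zr lam) (e n)); set (D := ip w (zi lam) (e n)).
    assert (E1 : Cmod (A, B) ^ 2 = A ^ 2 + B ^ 2).
    { unfold Cmod; rewrite pow2_sqrt; simpl; [reflexivity|].
      generalize (pow2_ge_0 A) (pow2_ge_0 B); simpl; lra. }
    assert (E2 : Cmod (C, D) ^ 2 = C ^ 2 + D ^ 2).
    { unfold Cmod; rewrite pow2_sqrt; simpl; [reflexivity|].
      generalize (pow2_ge_0 C) (pow2_ge_0 D); simpl; lra. }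
    rewrite <- E1, <- E2.
    set (X := Cmod (A, B)); set (Y := Cmod (C, D)).
    apply Rmult_le_reg_l with del; [exact Hdel|].
    replace (del * (/ del * X ^ 2 + del * Y ^ 2)) with (X ^ 2 + (del * Y) ^ 2)
      by (field; lra).
    assert (HX : 0 <= X) by apply Cmod_ge_0; assert (HY : 0 <= Y) by apply Cmod_ge_0.
    assert (HdY : 0 <= del * Y) by nra.
    generalize (pow2_ge_0 (X - del * Y)); nra. }
  assert (Hdser : forall del lam, ex_series (fun n => / del * P n + del * Q lam n)).
  { intros del lam.
    assert (S1 := ex_series_scal (V := R_NormedModule) (/ del) _ SP).
    assert (S2 := ex_series_scal (V := R_NormedModule) del _ (proj1 (SQ lam))).
    exact (ex_series_plus (V := R_NormedModule) _ _ S1 S2). }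
  assert (Habs : forall lam, ex_series (fun n => Cmod (expansion_term w phi ev f n lam))).
  { intros lam; apply ex_series_dom with (2 := Hdser 1 lam); intros n.
    rewrite Rabs_pos_eq by apply Cmod_ge_0; apply Hdom; lra. }
  split; [intros lam; split; [apply Habs|]|].
  - destruct (Hz lam) as [Zr Zi].
    assert (Hfr0 : k2 = 0 -> fr 0%nat = 0) by (intros E; unfold fr; now rewrite Hf0).
    assert (Hfi0 : k2 = 0 -> fi 0%nat = 0) by (intros E; unfold fi; now rewrite Hf0).
    assert (HP : forall a b : nat -> R, l2 w a -> l2 w b -> (k2 = 0 -> a 0%nat = 0) ->
      ex_series (fun n => ip w a (e n) * ip w b (e n)) /\
      Series (fun n => ip w a (e n) * ip w b (e n)) = ip w a b).
    { intros a b Ha Hb Ha0.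
      destruct (eigvec_Parseval w p al be k1 k2 phi ev a b Hsp Ha Hb Ha0) as [S1 S2].
      split; [now apply ex_series_Rabs|exact S2]. }
    destruct (HP fr (zr lam) Hr Zr Hfr0) as [S1 E1]; destruct (HP fi (zi lam) Hi Zi Hfi0) as [S2 E2].
    destruct (HP fr (zi lam) Hr Zi Hfr0) as [S3 E3]; destruct (HP fi (zr lam) Hi Zr Hfi0) as [S4 E4].
    rewrite (csum_ip w f (phi lam) Hw Hr Hi Zr Zi).
    change (CSeries (fun n => expansion_term w phi ev f n lam) =
      (ip w fr (zr lam) - ip w fi (zi lam), ip w fr (zi lam) + ip w fi (zr lam))).
    rewrite <- E1, <- E2, <- E3, <- E4.
    unfold CSeries; f_equal.
    + rewrite <- Series_minus by assumption.
      apply Series_ext; intros n; rewrite Hu; simpl; ring.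
    + rewrite <- Series_plus by assumption.
      apply Series_ext; intros n; rewrite Hu; simpl; ring.
  - intros r eps Heps.
    set (M := growth w p r * (Cmod (RtoC al) + Cmod (RtoC be))).
    set (B := 2 * (M ^ 2 * Series w) + 1).
    assert (HB : 0 < B).
    { unfold B; assert (0 <= Series w).
      { apply Series_nonneg; [intros j; apply Rlt_le, Hw|apply Hadm]. }
      generalize (pow2_ge_0 M); nra. }
    (* The weight of Young's inequality: the part that depends on [lam] costs at most
       [del * B = eps / 2]. *)
    set (del := eps / (2 * B)).
    assert (Hdel : 0 < del) by (unfold del; apply Rdiv_lt_0_compat; lra).
    assert (He2 : 0 < del * (eps / 2)) by (apply Rmult_lt_0_compat; lra).
    destruct (Series_tail_small P _ SP He2) as [N HN]; specialize (HN N (le_n N)).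
    exists N; intros lam Hlam.
    assert (HT := Series_tail_le (fun n => Cmod (expansion_term w phi ev f n lam)) _ N
      (fun n => Rle_trans _ _ _ (Req_le _ _ (Rabs_pos_eq _ (Cmod_ge_0 _)))
         (Hdom del lam n Hdel)) (Hdser del lam)).
    assert (EP : Series (fun n => / del * P n + del * Q lam n) =
      / del * Series P + del * Series (Q lam)).
    { rewrite Series_plus, !Series_scal_l; [reflexivity| |].
      - exact (ex_series_scal (V := R_NormedModule) (/ del) _ SP).
      - exact (ex_series_scal (V := R_NormedModule) del _ (proj1 (SQ lam))). }
    assert (ES : sum_n (fun n => / del * P n + del * Q lam n) N =
      / del * sum_n P N + del * sum_n (Q lam) N).
    { rewrite <- !(sum_n_mult_l (K := R_AbsRing)).
      exact (sum_n_plus (fun n => / del * P n) (fun n => del * Q lam n) N). }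
    rewrite EP, ES in HT.
    assert (HQ0 : 0 <= sum_n (Q lam) N).
    { assert (HQ : forall n, 0 <= Q lam n)
        by (intros n; apply Rplus_le_le_0_compat; apply pow2_ge_0).
      apply Rle_trans with (sum_n (Q lam) 0); [rewrite sum_O; apply HQ|].
      apply sum_n_nonneg_mono; [exact HQ|lia]. }
    destruct (family_l2 w p _ _ phi r lam Hadm Hfam Hlam) as [_ [_ [L1 L2]]].
    fold M in L1, L2; fold (zr lam) in L1; fold (zi lam) in L2.
    assert (HQB : Series (Q lam) < B).
    { apply Rle_lt_trans with (1 := proj2 (SQ lam)); unfold B; lra. }
    apply Rabs_def2 in HN; apply Rabs_le_between in HT.
    assert (H1 : / del * (Series P - sum_n P N) < eps / 2).
    { apply Rmult_lt_reg_l with del; [exact Hdel|].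
      rewrite <- Rmult_assoc, Rinv_r, Rmult_1_l by lra; lra. }
    assert (H2 : del * Series (Q lam) < eps / 2).
    { replace (eps / 2) with (del * B) by (unfold del; field; lra).
      now apply Rmult_lt_compat_l. }
    assert (H3 : 0 <= del * sum_n (Q lam) N) by (apply Rmult_le_pos; lra).
    lra.
Qed.

(** * Bilateral series *)

Lemma Re_sum_n (u : nat -> C) (N : nat) : Re (sum_n u N) = sum_n (fun n => Re (u n)) N.
Proof.
  induction N as [|N IH]; [now rewrite !sum_O|].
  rewrite !sum_Sn, <- IH; reflexivity.
Qed.

Lemma Im_sum_n (u : nat -> C) (N : nat) : Im (sum_n u N) = sum_n (fun n => Im (u n)) N.
Proof.
  induction N as [|N IH]; [now rewrite !sum_O|].
  rewrite !sum_Sn, <- IH; reflexivity.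
Qed.

Lemma CSeries_tail (u : nat -> C) (N : nat) :
  ex_series (fun n => Cmod (u n)) ->
  Cmod (sum_n u N - CSeries u) <=
    2 * (Series (fun n => Cmod (u n)) - sum_n (fun n => Cmod (u n)) N).
Proof.
  intros Hu.
  assert (H1 := Series_tail_le _ _ N (fun n => re_le_Cmod (u n)) Hu).
  assert (H2 := Series_tail_le _ _ N (fun n => Im_le_Cmod (u n)) Hu).
  rewrite <- Re_sum_n in H1; rewrite <- Im_sum_n in H2.
  rewrite <- Cmod_opp; apply Rle_trans with (1 := Cmod_le_Re_Im _).
  replace (Re (- (sum_n u N - CSeries u))) with (Series (fun n => Re (u n)) - Re (sum_n u N))
    by (simpl; unfold Re; simpl; ring).
  replace (Im (- (sum_n u N - CSeries u))) with (Series (fun n => Im (u n)) - Im (sum_n u N))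
    by (simpl; unfold Im; simpl; ring).
  lra.
Qed.

Lemma CSeries_parity (u : nat -> C) :
  ex_series (fun n => Cmod (u n)) ->
  CSeries u = (CSeries (fun n => u (2 * n)%nat) + CSeries (fun n => u (2 * n + 1)%nat))%C.
Proof.
  intros Hu.
  assert (H : forall P : C -> R, (forall c, Rabs (P c) <= Cmod c) ->
    ex_series (fun n => Rabs (P (u n)))).
  { intros P HP; apply ex_series_dom with (2 := Hu); intros n.
    rewrite Rabs_Rabsolu; apply HP. }
  destruct (Series_parity _ (H Re re_le_Cmod)) as [_ [_ E1]].
  destruct (Series_parity _ (H Im Im_le_Cmod)) as [_ [_ E2]].
  unfold CSeries; rewrite E1, E2; reflexivity.
Qed.

(** Lists [0, -1, 1, -2, 2, ...], so that the two parities of a series are the two halves of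
    a bilateral one. *)
Definition zenum : nat -> Z := interleave Z.of_nat (fun m => - Z.of_nat (S m))%Z.

Lemma zenum_inj (m n : nat) : zenum m = zenum n -> m = n.
Proof.
  unfold zenum; revert m; apply (parity_case (fun m => _ -> _)); intros m;
    revert n; apply (parity_case (fun n => _ -> _)); intros n;
    rewrite ?interleave_even, ?interleave_odd; lia.
Qed.

Lemma zenum_surj (z : Z) : exists n, z = zenum n.
Proof.
  unfold zenum; destruct (Z_lt_le_dec z 0) as [H|H].
  - exists (2 * Z.to_nat (- z - 1) + 1)%nat; rewrite interleave_odd; lia.
  - exists (2 * Z.to_nat z)%nat; rewrite interleave_even; lia.
Qed.

Lemma Zpartial_bound (u : Z -> C) (N0 M N : nat) :
  ex_series (fun n => Cmod (u (zenum n))) -> (N0 <= M)%nat -> (N0 <= N)%nat ->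
  Cmod (Zpartial u M N - CSeries (fun n => u (zenum n))) <=
    2 * (Series (fun n => Cmod (u (zenum n))) - sum_n (fun n => Cmod (u (zenum n))) (2 * N0 + 1)).
Proof.
  intros Hu HM HN.
  set (a := fun n => Cmod (u (zenum n))) in *.
  assert (Ha0 : forall n, 0 <= a n) by (intros n; apply Cmod_ge_0).
  assert (Habs : ex_series (fun n => Rabs (a n))).
  { apply ex_series_ext with (2 := Hu); intros n; now rewrite Rabs_pos_eq by apply Ha0. }
  destruct (Series_parity a Habs) as [H0 [H1 E]].
  assert (He : forall n, Rabs (a (2 * n)%nat) = Cmod (u (Z.of_nat n))).
  { intros n; rewrite Rabs_pos_eq by apply Ha0; unfold a, zenum; now rewrite interleave_even. }
  assert (Ho : forall n, Rabs (a (2 * n + 1)%nat) = Cmod (u (- Z.of_nat (S n))%Z)).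
  { intros n; rewrite Rabs_pos_eq by apply Ha0; unfold a, zenum; now rewrite interleave_odd. }
  apply (ex_series_ext _ _ He) in H0; apply (ex_series_ext _ _ Ho) in H1.
  assert (Hsplit : CSeries (fun n => u (zenum n)) =
    (CSeries (fun n => u (Z.of_nat n)) + CSeries (fun n => u (- Z.of_nat (S n))%Z))%C).
  { rewrite CSeries_parity by exact Hu; f_equal; apply CSeries_ext; intros n;
      unfold zenum; now rewrite ?interleave_even, ?interleave_odd. }
  assert (Ee : Series (fun n => a (2 * n)%nat) = Series (fun n => Cmod (u (Z.of_nat n)))).
  { apply Series_ext; intros n; rewrite <- He; now rewrite Rabs_pos_eq by apply Ha0. }
  assert (Eo : Series (fun n => a (2 * n + 1)%nat) = Series (fun n => Cmod (u (- Z.of_nat (S n))%Z))).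
  { apply Series_ext; intros n; rewrite <- Ho; now rewrite Rabs_pos_eq by apply Ha0. }
  assert (Es : sum_n a (2 * N0 + 1) = sum_n (fun n => Cmod (u (Z.of_nat n))) N0 +
    sum_n (fun n => Cmod (u (- Z.of_nat (S n))%Z)) N0).
  { rewrite sum_n_double.
    rewrite (sum_n_ext _ (fun n => plus (Cmod (u (Z.of_nat n))) (Cmod (u (- Z.of_nat (S n))%Z)))).
    - exact (sum_n_plus (G := R_AbelianMonoid) _ _ N0).
    - intros n; rewrite <- He, <- Ho, !Rabs_pos_eq by apply Ha0; reflexivity. }
  rewrite E, Ee, Eo, Es, Hsplit; unfold Zpartial.
  assert (T0 := CSeries_tail (fun n => u (Z.of_nat n)) N H0).
  assert (T1 := CSeries_tail (fun n => u (- Z.of_nat (S n))%Z) M H1).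
  assert (M0 := sum_n_nonneg_mono (fun n => Cmod (u (Z.of_nat n))) N0 N
    (fun n => Cmod_ge_0 _) HN).
  assert (M1 := sum_n_nonneg_mono (fun n => Cmod (u (- Z.of_nat (S n))%Z)) N0 M
    (fun n => Cmod_ge_0 _) HM).
  match goal with |- Cmod ?X <= _ => replace X with
    ((sum_n (fun n => u (Z.of_nat n)) N - CSeries (fun n => u (Z.of_nat n))) +
     (sum_n (fun n => u (- Z.of_nat (S n))%Z) M - CSeries (fun n => u (- Z.of_nat (S n))%Z)))%C
    by ring end.
  apply Rle_trans with (1 := Cmod_triangle _ _); lra.
Qed.

(** A finite subcover by the balls of integer radius about the origin. *)
Lemma compactC_bounded (K : C -> Prop) :
  compactC K -> exists r, forall z, K z -> Cmod z <= r.
Proof.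
  intros HK.
  destruct (HK nat (fun i z => Cmod z < INR i)) as [s Hs].
  - intros i z Hz; apply C_locally_Cmod with (INR i - Cmod z); [lra|]; intros y Hy.
    replace y with ((y - z) + z)%C by ring.
    apply Rle_lt_trans with (1 := Cmod_triangle _ _); lra.
  - intros z _; destruct (INR_unbounded (Cmod z)) as [i Hi]; exists i; lra.
  - exists (INR (list_max s)); intros z Hz; destruct (Hs z Hz) as [i [Hi Hlt]].
    apply Rlt_le, Rlt_le_trans with (1 := Hlt), le_INR.
    assert (Hm := proj1 (list_max_le s (list_max s)) (le_n _)).
    rewrite Forall_forall in Hm; now apply Hm.
Qed.

(** Summability along the enumeration of the integers, with uniform tails on balls,
    gives each mode of convergence of the bilateral series. *)
Lemma Zseries_of_enumeration (S : Z -> C -> C) (F : C -> C) :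
  (forall mu, ex_series (fun n => Cmod (S (zenum n) mu)) /\
     CSeries (fun n => S (zenum n) mu) = F mu) ->
  (forall r eps, 0 < eps -> exists N, forall mu, Cmod mu <= r ->
     Series (fun n => Cmod (S (zenum n) mu)) - sum_n (fun n => Cmod (S (zenum n) mu)) N < eps) ->
  (forall mu, is_Zseries (fun n => S n mu) (F mu)) /\
  (forall mu, Zseries_abs_cv (fun n => S n mu)) /\
  (forall K, compactC K -> Zseries_unif_cv_on K S F).
Proof.
  intros Hsum Hunif.
  assert (HZ : forall r eps, 0 < eps -> exists N0, forall M N, (N0 <= M)%nat -> (N0 <= N)%nat ->
    forall mu, Cmod mu <= r -> Cmod (Zpartial (fun n => S n mu) M N - F mu) < eps).
  { intros r eps He; destruct (Hunif r (eps / 2)) as [N0 HN0]; [lra|].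
    exists N0; intros M N HM HN mu Hmu; destruct (Hsum mu) as [Habs <-].
    apply Rle_lt_trans with (1 := Zpartial_bound (fun n => S n mu) N0 M N Habs HM HN).
    specialize (HN0 mu Hmu).
    assert (Hm := sum_n_nonneg_mono (fun n => Cmod (S (zenum n) mu)) N0 (2 * N0 + 1)
      (fun n => Cmod_ge_0 _) ltac:(lia)).
    lra. }
  split; [|split].
  - intros mu P [eps HP].
    destruct (HZ (Cmod mu) eps (cond_pos eps)) as [N0 HN0].
    apply (Filter_prod _ _ _ (fun M => (N0 <= M)%nat) (fun N => (N0 <= N)%nat)).
    + exists N0; auto.
    + exists N0; auto.
    + intros M N HM HN; apply HP, C_ball_le; simpl; apply HN0; auto; lra.
  - intros mu; destruct (Hsum mu) as [Habs _].
    assert (Habs' : ex_series (fun n => Rabs (Cmod (S (zenum n) mu)))).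
    { apply ex_series_ext with (2 := Habs); intros n; now rewrite Rabs_pos_eq by apply Cmod_ge_0. }
    destruct (Series_parity _ Habs') as [H0 [H1 _]]; split.
    + apply ex_series_ext with (2 := H0); intros n; unfold zenum.
      now rewrite interleave_even, Rabs_pos_eq by apply Cmod_ge_0.
    + apply ex_series_ext with (2 := H1); intros n; unfold zenum.
      now rewrite interleave_odd, Rabs_pos_eq by apply Cmod_ge_0.
  - intros K HK eps; destruct (compactC_bounded K HK) as [r Hr].
    destruct (HZ r eps (cond_pos eps)) as [N0 HN0]; exists N0; intros M N HM HN z Hz.
    apply HN0; auto.
Qed.

(** * Orbits of the q-Dirac system *)

(** The sequence [y2 (x / q), y1 x, y2 x, y1 (x * q), ...], in which each equation of the
    system links three consecutive entries. *)
Definition orbit (q x : R) (y1 y2 : R -> C) : nat -> C :=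
  interleave (fun n => y2 (x / q * q ^ n)) (fun n => y1 (x * q ^ n)).

Definition orbit_weight (q x : R) : nat -> R :=
  interleave (fun n => x * (1 - q) * q ^ n) (fun n => x * (1 - q) * q ^ n).

Definition orbit_coef {T : Type} (q x : R) (p r : R -> T) : nat -> T :=
  interleave (fun n => p (x * q ^ n)) (fun n => r (x * q ^ n)).

Lemma orbit_point (q a x : R) (n : nat) :
  0 < q < 1 -> 0 < x <= a -> 0 < x * q ^ n <= a.
Proof.
  intros Hq Hx; assert (H := pow_lt q n (proj1 Hq)).
  assert (H1 : q ^ n <= 1) by (rewrite <- (pow1 n); apply pow_incr; lra).
  split; [now apply Rmult_lt_0_compat|nra].
Qed.

Lemma orbit_weight_pos (q x : R) (j : nat) : 0 < q < 1 -> 0 < x -> 0 < orbit_weight q x j.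
Proof.
  intros Hq Hx; unfold orbit_weight.
  assert (H : forall n, 0 < x * (1 - q) * q ^ n).
  { intros n; apply Rmult_lt_0_compat; [nra|now apply pow_lt]. }
  revert j; apply parity_case; intros n; rewrite ?interleave_even, ?interleave_odd; apply H.
Qed.

Lemma ex_series_pow_q (q c : R) : 0 < q < 1 -> ex_series (fun n => c * q ^ n).
Proof.
  intros Hq; apply (ex_series_scal (V := R_NormedModule) c).
  apply ex_series_geom; rewrite Rabs_pos_eq; lra.
Qed.

(** Continuity at zero bounds the coefficient near the end of every orbit, which makes
    it summable against the geometric weight. *)
Lemma coefficient_summable (q a x : R) (p : R -> R) :
  0 < q < 1 -> 0 < x <= a -> continuous_at_zero a p ->
  ex_series (fun n => x * (1 - q) * q ^ n * Rabs (p (x * q ^ n))).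
Proof.
  intros Hq Hx Hp.
  destruct (proj1 (filterlim_locally p (p 0)) Hp (mkposreal 1 Rlt_0_1)) as [d Hd].
  assert (Hlim : is_lim_seq (fun n => x * q ^ n) (x * 0)).
  { apply is_lim_seq_mult'; [apply is_lim_seq_const|].
    apply is_lim_seq_geom; rewrite Rabs_pos_eq; lra. }
  rewrite Rmult_0_r in Hlim; apply is_lim_seq_spec in Hlim; destruct (Hlim d) as [N HN].
  apply (ex_series_incr_n _ N).
  apply ex_series_dom with (fun n => (Rabs (p 0) + 1) * (x * (1 - q) * q ^ (N + n))).
  - intros n.
    assert (HX := orbit_point q a x (N + n) Hq Hx).
    assert (Hpn : Rabs (p (x * q ^ (N + n))) <= Rabs (p 0) + 1).
    { assert (Hb : Rabs (p (x * q ^ (N + n)) - p 0) < 1).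
      { apply Hd; [|lra].
        specialize (HN (N + n)%nat ltac:(lia)); exact HN. }
      generalize (Rabs_triang_inv (p (x * q ^ (N + n))) (p 0)); lra. }
    assert (Hh : 0 < x * (1 - q) * q ^ (N + n)).
    { apply Rmult_lt_0_compat; [nra|apply pow_lt; lra]. }
    rewrite Rabs_pos_eq by (generalize (Rabs_pos (p (x * q ^ (N + n)))); nra).
    rewrite Rmult_comm; apply Rmult_le_compat_r; lra.
  - apply (ex_series_scal (V := R_NormedModule) (Rabs (p 0) + 1)
      (fun n => x * (1 - q) * q ^ (N + n))).
    apply (ex_series_incr_n (fun n => x * (1 - q) * q ^ n) N); now apply ex_series_pow_q.
Qed.

Lemma orbit_admissible (q a x : R) (p r : R -> R) :
  0 < q < 1 -> 0 < x <= a -> continuous_at_zero a p -> continuous_at_zero a r ->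
  admissible (orbit_weight q x) (orbit_coef q x p r).
Proof.
  intros Hq Hx Hp Hr.
  assert (H : forall n, 0 <= x * (1 - q) * q ^ n).
  { intros n; apply Rlt_le, Rmult_lt_0_compat; [nra|now apply pow_lt]. }
  split.
  - intros j; now apply orbit_weight_pos.
  - apply ex_series_interleave; auto using ex_series_pow_q.
  - apply ex_series_ext with (interleave
      (fun n => x * (1 - q) * q ^ n * Rabs (p (x * q ^ n)))
      (fun n => x * (1 - q) * q ^ n * Rabs (r (x * q ^ n)))).
    + apply parity_case; intros n; unfold orbit_weight, orbit_coef;
        now rewrite ?interleave_even, ?interleave_odd.
    + apply ex_series_interleave.
      * intros n; apply Rmult_le_pos; [apply H|apply Rabs_pos].
      * intros n; apply Rmult_le_pos; [apply H|apply Rabs_pos].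
      * now apply coefficient_summable with a.
      * now apply coefficient_summable with a.
Qed.

Lemma orbit_even (q x : R) (y1 y2 : R -> C) (n : nat) :
  orbit q x y1 y2 (2 * n) = y2 (x / q * q ^ n).
Proof. exact (interleave_even _ _ n). Qed.

Lemma orbit_odd (q x : R) (y1 y2 : R -> C) (n : nat) :
  orbit q x y1 y2 (2 * n + 1) = y1 (x * q ^ n).
Proof. exact (interleave_odd _ _ n). Qed.

Lemma orbit_even_S (q x : R) (y1 y2 : R -> C) (n : nat) :
  0 < q -> orbit q x y1 y2 (S (2 * n + 1)) = y2 (x * q ^ n).
Proof.
  intros Hq; replace (S (2 * n + 1)) with (2 * S n)%nat by lia.
  rewrite orbit_even; f_equal; simpl; field; lra.
Qed.

(** Along an orbit the two first-order equations are the two parities of one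
    second-order recurrence. *)
Lemma orbit_rec (q a x : R) (p r : R -> R) (lam : C) (y1 y2 : R -> C) :
  0 < q < 1 -> 0 < x <= a -> q_dirac_solution q a p r lam y1 y2 ->
  recC (orbit_weight q x) (orbit_coef q x p r) lam (fun _ => RtoC 0) (orbit q x y1 y2).
Proof.
  intros Hq Hx [_ [_ Hsol]].
  unfold recC; match goal with |- forall j, @?P j => apply (parity_case P) end;
    cbv beta; intros n; unfold orbit_weight, orbit_coef;
    destruct (orbit_point q a x n Hq Hx) as [HX1 HX2];
    destruct (Hsol (x * q ^ n) ltac:(lra)) as [d1 [d2 [[Hd1 _] [[Hd2 _] [E1 E2]]]]];
    specialize (Hd1 ltac:(lra)); specialize (Hd2 ltac:(lra)).
  - rewrite !interleave_even, sgn_even.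
    replace (S (S (2 * n))) with (S (2 * n + 1)) by lia.
    replace (S (2 * n)) with (2 * n + 1)%nat by lia.
    rewrite orbit_even_S, orbit_odd, orbit_even by lra.
    replace (x / q * q ^ n) with (x * q ^ n / q) by (field; lra).
    replace (1 * (x * (1 - q) * q ^ n)) with (x * q ^ n * (1 - q)) by ring.
    set (X := x * q ^ n) in *.
    assert (HE : (y2 X - y2 (X / q)%R = - RtoC (1 / q) * d2 * RtoC (X * (1 - q)))%C).
    { rewrite Hd2.
      replace (X * (1 - q)) with (- q * (X * (1 - / q))) by (field; lra).
      rewrite (RtoC_mult (- q)).
      assert (Hne : RtoC (X * (1 - / q)) <> 0%C).
      { intros E; apply RtoC_inj in E; apply Rmult_integral in E.
        assert (1 < / q) by (rewrite <- Rinv_1 at 1; apply Rinv_lt_contravar; lra); lra. }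
      assert (Hqq : (- RtoC (1 / q) * RtoC (- q) = 1)%C).
      { rewrite <- RtoC_opp, <- RtoC_mult; f_equal; field; lra. }
      set (Y := RtoC (X * (1 - / q))) in *.
      transitivity ((- RtoC (1 / q) * RtoC (- q)) * (y2 X - y2 (X / q)%R))%C;
        [rewrite Hqq; ring|field; exact Hne]. }
    replace (y2 X) with ((y2 X - y2 (X / q)%R) + y2 (X / q)%R)%C by ring; rewrite HE.
    replace ((lam - RtoC (p X)) * y1 X + RtoC 0)%C
      with (lam * y1 X - RtoC (p X) * y1 X)%C by ring.
    rewrite <- E1; ring.
  - rewrite !interleave_odd, sgn_odd.
    replace (S (S (2 * n + 1))) with (2 * S n + 1)%nat by lia.
    rewrite orbit_even_S, !orbit_odd by lra.
    replace (x * q ^ S n) with (q * (x * q ^ n)) by (simpl; ring).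
    replace (-1 * (x * (1 - q) * q ^ n)) with (- (x * q ^ n * (1 - q))) by ring.
    set (X := x * q ^ n) in *.
    assert (Hne : RtoC (X * (1 - q)) <> 0%C).
    { intros E; apply RtoC_inj in E; apply Rmult_integral in E; lra. }
    assert (HE : (y1 X - y1 (q * X)%R = d1 * RtoC (X * (1 - q)))%C)
      by (rewrite Hd1; field; exact Hne).
    replace (y1 (q * X)%R) with (y1 X - (y1 X - y1 (q * X)%R))%C by ring; rewrite HE.
    replace ((lam - RtoC (r X)) * y2 X + RtoC 0)%C
      with (lam * y2 X - RtoC (r X) * y2 X)%C by ring.
    rewrite <- E2, RtoC_opp; ring.
Qed.

Lemma orbit_end (q a x : R) (p r : R -> R) (lam : C) (y1 y2 : R -> C) :
  0 < q < 1 -> 0 < x <= a -> q_dirac_solution q a p r lam y1 y2 ->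
  end_values (orbit q x y1 y2) (y1 0) (y2 0).
Proof.
  intros Hq Hx [H1 [H2 _]]; split.
  - apply is_lim_seq_ext with (fun n => Cmod (y2 (x / q * q ^ n) - y2 0)).
    { intros n; now rewrite orbit_even. }
    apply C_filterlim_seq, H2; split.
    + apply Rlt_le, Rdiv_lt_0_compat; lra.
    + apply Rmult_le_compat_r; [apply Rlt_le, Rinv_0_lt_compat|]; lra.
  - apply is_lim_seq_ext with (fun n => Cmod (y1 (x * q ^ n) - y1 0)).
    { intros n; now rewrite orbit_odd. }
    apply C_filterlim_seq, H1; lra.
Qed.

Lemma orbit_l2 (q a : R) (f1 f2 : R -> C) (P : C -> R) :
  0 < q < 1 -> 0 < a -> Hq q a f1 f2 -> (forall c, Rabs (P c) <= Cmod c) ->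
  l2 (orbit_weight q a) (fun j => P (orbit_coef q a f1 f2 j)).
Proof.
  intros Hq Ha [Hf1 Hf2] HP.
  assert (Hc : forall f, Lq2 q a f -> ex_series (fun n => a * (1 - q) * q ^ n * Cmod (f (a * q ^ n)) ^ 2)).
  { intros f Hf.
    apply ex_series_ext with (fun n => a * (1 - q) * (q ^ n * Cmod (f (a * q ^ n)) ^ 2)).
    - intros n; as_real; ring.
    - exact (ex_series_scal (V := R_NormedModule) (a * (1 - q)) _ Hf). }
  assert (H0 : forall (f : R -> C) n, 0 <= a * (1 - q) * q ^ n * Cmod (f (a * q ^ n)) ^ 2).
  { intros f n; apply Rmult_le_pos; [|apply pow2_ge_0].
    apply Rmult_le_pos; [nra|apply pow_le; lra]. }
  apply ex_series_dom with (interleave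
    (fun n => a * (1 - q) * q ^ n * Cmod (f1 (a * q ^ n)) ^ 2)
    (fun n => a * (1 - q) * q ^ n * Cmod (f2 (a * q ^ n)) ^ 2)).
  - assert (HPsq : forall c, P c ^ 2 <= Cmod c ^ 2).
    { intros c; rewrite <- pow2_abs; apply pow_incr; split; [apply Rabs_pos|apply HP]. }
    intros j; assert (Hw := orbit_weight_pos q a j Hq Ha).
    rewrite Rabs_pos_eq by (apply Rmult_le_pos; [lra|apply pow2_ge_0]).
    apply Rle_trans with (orbit_weight q a j * Cmod (orbit_coef q a f1 f2 j) ^ 2).
    { apply Rmult_le_compat_l; [lra|apply HPsq]. }
    apply Req_le; revert j Hw; unfold orbit_weight, orbit_coef.
    match goal with |- forall j, @?P j => apply (parity_case P) end; cbv beta;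
      intros n _; now rewrite ?interleave_even, ?interleave_odd.
  - apply ex_series_interleave; auto.
Qed.

(** The Jackson integral pairs the two components at each point of the orbit. *)
Lemma jackson_csum (q a M : R) (p r : R -> R) (f1 f2 y1 y2 : R -> C) :
  0 < q < 1 -> 0 < a ->
  admissible (orbit_weight q a) (orbit_coef q a p r) ->
  cl1 (orbit_weight q a) (orbit_coef q a f1 f2) ->
  (forall j, Cmod (orbit q a y1 y2 j) <= M) ->
  ex_jackson q (fun x => f1 x * y1 x + f2 x * y2 x)%C a /\
  jackson q (fun x => f1 x * y1 x + f2 x * y2 x)%C a =
    csum (orbit_weight q a) (orbit_coef q a f1 f2) (orbit q a y1 y2).
Proof.
  intros Hq Ha Hadm Hf HM.
  destruct (csum_bound _ _ _ _ M Hadm Hf HM) as [Hs _].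
  set (t := fun j => (RtoC (orbit_weight q a j) *
    (orbit_coef q a f1 f2 j * orbit q a y1 y2 (S j)))%C) in *.
  set (s := fun n => (RtoC (q ^ n) * (f1 (a * q ^ n)%R * y1 (a * q ^ n)%R +
    f2 (a * q ^ n)%R * y2 (a * q ^ n)%R))%C).
  assert (Ht : forall n, (t (2 * n)%nat + t (2 * n + 1)%nat = RtoC (a * (1 - q)) * s n)%C).
  { intros n; unfold t, s, orbit_weight, orbit_coef.
    rewrite orbit_even_S, !interleave_even, !interleave_odd by lra.
    replace (S (2 * n)) with (2 * n + 1)%nat by lia; rewrite orbit_odd.
    rewrite (RtoC_mult (a * (1 - q))); ring. }
  assert (Hs' : ex_series (fun j => Rabs (Cmod (t j)))).
  { apply ex_series_ext with (2 := Hs); intros j; now rewrite Rabs_pos_eq by apply Cmod_ge_0. }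
  destruct (Series_parity _ Hs') as [Se [So _]].
  assert (Se' : ex_series (fun n => Cmod (t (2 * n)%nat))).
  { apply ex_series_ext with (2 := Se); intros n; now rewrite Rabs_pos_eq by apply Cmod_ge_0. }
  assert (So' : ex_series (fun n => Cmod (t (2 * n + 1)%nat))).
  { apply ex_series_ext with (2 := So); intros n; now rewrite Rabs_pos_eq by apply Cmod_ge_0. }
  assert (Hc : 0 < a * (1 - q)) by (apply Rmult_lt_0_compat; lra).
  assert (Hsc : forall n, Cmod (s n) <=
    / (a * (1 - q)) * (Cmod (t (2 * n)%nat) + Cmod (t (2 * n + 1)%nat))).
  { intros n; apply Rmult_le_reg_l with (1 := Hc).
    rewrite <- Rmult_assoc, Rinv_r, Rmult_1_l by lra.
    apply Rle_trans with (2 := Cmod_triangle _ _); rewrite Ht, Cmod_mult, Cmod_R.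
    rewrite Rabs_pos_eq by lra; lra. }
  assert (Hsd : ex_series (fun n => / (a * (1 - q)) *
    (Cmod (t (2 * n)%nat) + Cmod (t (2 * n + 1)%nat)))).
  { assert (S1 := ex_series_plus (V := R_NormedModule) _ _ Se' So').
    exact (ex_series_scal (V := R_NormedModule) (/ (a * (1 - q))) _ S1). }
  split.
  - apply (ex_series_le (V := C_CompleteNormedModule) s _ Hsc Hsd).
  - change (jackson q (fun x => f1 x * y1 x + f2 x * y2 x)%C a)
      with (RtoC (a * (1 - q)) * CSeries s)%C.
    change (csum (orbit_weight q a) (orbit_coef q a f1 f2) (orbit q a y1 y2)) with (CSeries t).
    rewrite (CSeries_parity t) by exact Hs.
    transitivity (1 * CSeries (fun n => t (2 * n)%nat) + 1 * CSeries (fun n => t (2 * n + 1)%nat))%C;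
      [|ring].
    rewrite <- CSeries_lin by assumption.
    transitivity (RtoC (a * (1 - q)) * CSeries s + 0 * CSeries s)%C; [ring|].
    assert (Hss : ex_series (fun n => Cmod (s n))).
    { apply ex_series_dom with (2 := Hsd); intros n.
      rewrite Rabs_pos_eq by apply Cmod_ge_0; apply Hsc. }
    rewrite <- CSeries_lin by assumption.
    apply CSeries_ext; intros n.
    transitivity (t (2 * n)%nat + t (2 * n + 1)%nat)%C; [rewrite Ht|]; ring.
Qed.

Lemma q_omega_charfun (q a k21 k22 : R) (phi1 phi2 : R -> C -> C) :
  q_omega q a k21 k22 phi1 phi2 =
  charfun k21 k22 (fun lam => orbit q a (fun x => phi1 x lam) (fun x => phi2 x lam)).
Proof.
  apply functional_extensionality; intros lam; unfold q_omega, charfun.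
  set (z := orbit q a (fun x => phi1 x lam) (fun x => phi2 x lam)).
  transitivity (RtoC k21 * z (2 * 0 + 1)%nat + RtoC k22 * z (2 * 0)%nat)%C; [|reflexivity].
  unfold z; rewrite orbit_even, orbit_odd, pow_O; now rewrite !Rmult_1_r.
Qed.

(** A nontrivial solution of the boundary condition at zero is a nonzero multiple of
    the fundamental solution on every orbit. *)
Lemma eigenvalue_charfun (q a k11 k12 k21 k22 : R) (p r : R -> R)
    (phi1 phi2 : R -> C) (mu : C) :
  0 < q < 1 -> 0 < a -> continuous_at_zero a p -> continuous_at_zero a r ->
  0 < k12 ^ 2 + (- k11) ^ 2 ->
  q_dirac_solution q a p r mu phi1 phi2 ->
  phi1 0 = RtoC k12 -> phi2 0 = RtoC (- k11) ->
  (q_dirac_eigenvalue q a p r k11 k12 k21 k22 mu <->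
   (RtoC k21 * phi1 a + RtoC k22 * phi2 (a / q)%R = 0)%C).
Proof.
  intros Hq Ha Hp Hr Hk Hphi H1 H2.
  assert (Hk' : RtoC (k12 ^ 2 + (- k11) ^ 2) <> 0%C)
    by (intros E; apply RtoC_inj in E; lra).
  split.
  - intros [y1 [y2 [Hy [Hbc0 [Hbca Hnt]]]]].
    (* The boundary condition makes [(y1 0, y2 0)] parallel to [(k12, - k11)]; [c] is the
       factor of proportionality. *)
    set (c := ((RtoC k12 * y1 0 - RtoC k11 * y2 0) / RtoC (k12 ^ 2 + (- k11) ^ 2))%C).
    assert (HK : RtoC (k12 ^ 2 + (- k11) ^ 2) = (RtoC k12 * RtoC k12 + RtoC k11 * RtoC k11)%C).
    { rewrite <- !RtoC_mult, <- RtoC_plus; f_equal; ring. }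
    assert (Hc1 : y1 0 = (c * RtoC k12)%C).
    { unfold c; rewrite HK in *.
      transitivity (((RtoC k12 * y1 0 - RtoC k11 * y2 0) * RtoC k12 +
        RtoC k11 * (RtoC k11 * y1 0 + RtoC k12 * y2 0)) /
        (RtoC k12 * RtoC k12 + RtoC k11 * RtoC k11))%C; [|rewrite Hbc0]; field; exact Hk'. }
    assert (Hc2 : y2 0 = (c * RtoC (- k11))%C).
    { unfold c; rewrite RtoC_opp, HK in *.
      transitivity ((- (RtoC k12 * y1 0 - RtoC k11 * y2 0) * RtoC k11 +
        RtoC k12 * (RtoC k11 * y1 0 + RtoC k12 * y2 0)) /
        (RtoC k12 * RtoC k12 + RtoC k11 * RtoC k11))%C; [|rewrite Hbc0]; field; exact Hk'. }
    assert (Horb : forall x j, 0 < x <= a ->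
      orbit q x y1 y2 j = (c * orbit q x phi1 phi2 j)%C).
    { intros x j Hx.
      apply (recC_unique (orbit_weight q x) (orbit_coef q x p r) mu (orbit q x y1 y2)
        (fun j => (c * orbit q x phi1 phi2 j)%C) (y1 0) (y2 0)).
      - now apply orbit_admissible with a.
      - now apply orbit_rec with a.
      - intros i; rewrite (orbit_rec q a x p r mu phi1 phi2 Hq Hx Hphi i); ring.
      - now apply orbit_end with a p r mu.
      - assert (He := orbit_end q a x p r mu phi1 phi2 Hq Hx Hphi).
        assert (Hl := end_values_lin _ _ _ _ _ _ c 0%C He He).
        rewrite H1, H2 in Hl; rewrite Hc1, Hc2.
        replace (c * RtoC k12 + 0 * RtoC k12)%C with (c * RtoC k12)%C in Hl by ring.
        replace (c * RtoC (- k11) + 0 * RtoC (- k11))%C with (c * RtoC (- k11))%C in Hl by ring.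
        replace (fun j => (c * orbit q x phi1 phi2 j)%C) with
          (fun j => (c * orbit q x phi1 phi2 j + 0 * orbit q x phi1 phi2 j)%C); [exact Hl|].
        apply functional_extensionality; intros i; ring. }
    assert (Hy1 : forall x, 0 < x <= a -> y1 x = (c * phi1 x)%C).
    { intros x Hx; assert (E := Horb x (2 * 0 + 1)%nat Hx); rewrite !orbit_odd in E.
      now rewrite pow_O, Rmult_1_r in E. }
    assert (Hy2 : forall x, 0 < x <= a / q -> y2 x = (c * phi2 x)%C).
    { intros x Hx.
      assert (Hqx : 0 < q * x <= a).
      { split; [apply Rmult_lt_0_compat; lra|].
        replace a with (q * (a / q)) by (field; lra).
        apply Rmult_le_compat_l; lra. }
      assert (E := Horb (q * x) (2 * 0)%nat Hqx); rewrite !orbit_even in E.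
      rewrite pow_O, Rmult_1_r in E.
      now replace (q * x / q) with x in E by (field; lra). }
    assert (Hcne : c <> 0%C).
    { intros Hc; rewrite Hc in *.
      assert (E1 : y1 0 = 0%C) by (rewrite Hc1; ring).
      assert (E2 : y2 0 = 0%C) by (rewrite Hc2; ring).
      destruct Hnt as [[x [Hx Hne]]|[x [Hx Hne]]]; apply Hne;
        (destruct (Req_dec x 0) as [->|Hx0]; [assumption|]).
      - rewrite Hy1 by lra; ring.
      - rewrite Hy2 by lra; ring. }
    assert (Haq : 0 < a / q) by (apply Rdiv_lt_0_compat; lra).
    rewrite (Hy1 a), (Hy2 (a / q)) in Hbca by lra.
    assert (E : (c * (RtoC k21 * phi1 a + RtoC k22 * phi2 (a / q)%R) = 0)%C)
      by (rewrite <- Hbca; ring).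
    destruct (Ceq_dec (RtoC k21 * phi1 a + RtoC k22 * phi2 (a / q)%R)%C 0%C) as [H|H];
      [exact H|destruct (Cmult_neq_0 _ _ Hcne H E)].
  - intros Hbca; exists phi1, phi2; split; [exact Hphi|split; [|split; [exact Hbca|]]].
    + rewrite H1, H2, RtoC_opp; ring.
    + destruct (Req_dec k12 0) as [E|E].
      * right; exists 0; split.
        { split; [lra|apply Rlt_le, Rdiv_lt_0_compat; lra]. }
        rewrite H2; intros E'; apply RtoC_inj in E'; rewrite E, E' in Hk; lra.
      * left; exists 0; split; [lra|].
        rewrite H1; intros E'; now apply RtoC_inj in E'.
Qed.

(* Hypothesis Hdir: when k22 = 0 the right boundary condition is y1(a) = 0 and
   omega(lambda) = k21 * phi1(a, lambda); the q-transform of f = (1_{x=a}, 0) is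
   then a nonzero multiple of omega and vanishes at every eigenvalue, so the
   expansion holds only if f1(a) = 0.  Nothing is required when k22 <> 0. *)
Theorem theorem1
  (q a k11 k12 k21 k22 : R) (p r : R -> R)
  (Hq01 : 0 < q < 1) (Ha : 0 < a)
  (Hp0 : continuous_at_zero a p) (Hr0 : continuous_at_zero a r)
  (Hp1 : Lq1 q a p) (Hr1 : Lq1 q a r)
  (lam : Z -> R)
  (Hlam_inj : forall m n : Z, lam m = lam n -> m = n)
  (Hlam : forall mu : C,
     q_dirac_eigenvalue q a p r k11 k12 k21 k22 mu <->
     exists n : Z, mu = RtoC (lam n))
  (phi1 phi2 : R -> C -> C)
  (Hphi : forall mu : C,
     q_dirac_solution q a p r mu (fun x => phi1 x mu) (fun x => phi2 x mu) /\
     phi1 0 mu = RtoC k12 /\ phi2 0 mu = RtoC (- k11))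
  (f1 f2 : R -> C)
  (Hf : Hq q a f1 f2)
  (Hdir : k22 = 0 -> f1 a = RtoC 0) :
  let w := q_omega q a k21 k22 phi1 phi2 in
  let F := q_transform q a phi1 phi2 f1 f2 in
  let S := fun (n : Z) (mu : C) =>
    (F (RtoC (lam n)) * sampling_kernel w (RtoC (lam n)) mu)%C in
  (forall mu : C,
     ex_jackson q (fun x => f1 x * phi1 x mu + f2 x * phi2 x mu)%C a) /\
  entire F /\
  (forall mu : C, is_Zseries (fun n => S n mu) (F mu)) /\
  (forall mu : C, Zseries_abs_cv (fun n => S n mu)) /\
  (forall K : C -> Prop, compactC K -> Zseries_unif_cv_on K S F).
Proof.
  intros w F S.
  set (phi := fun mu => orbit q a (fun x => phi1 x mu) (fun x => phi2 x mu)).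
  set (W := orbit_weight q a); set (P := orbit_coef q a p r); set (f := orbit_coef q a f1 f2).
  assert (Hadm : admissible W P) by (apply orbit_admissible with a; auto; lra).
  assert (Hw : forall j, 0 < W j) by apply Hadm.
  assert (Hfam : sol_family W P (RtoC k12) (RtoC (- k11)) phi).
  { split; intros mu; destruct (Hphi mu) as [Hs [H1 H2]].
    - apply orbit_rec with a; auto; lra.
    - rewrite <- H1, <- H2; apply orbit_end with a p r mu; auto; lra. }
  assert (Hfr : l2 W (fun j => Re (f j))) by (apply orbit_l2; auto using re_le_Cmod).
  assert (Hfi : l2 W (fun j => Im (f j))) by (apply orbit_l2; auto using Im_le_Cmod).
  assert (Hf1 : cl1 W f) by now apply cl1_of_l2 with P.
  assert (Hjack : forall mu, ex_jackson q (fun x => f1 x * phi1 x mu + f2 x * phi2 x mu)%C a /\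
    F mu = csum W f (phi mu)).
  { intros mu; eapply (jackson_csum q a _ p r); auto.
    apply (family_bound W P _ _ phi (Cmod mu) mu Hadm Hfam (Rle_refl _)). }
  assert (HF : F = fun mu => csum W f (phi mu))
    by (apply functional_extensionality; intros mu; apply Hjack).
  split; [intros mu; apply Hjack|split].
  { intros mu; rewrite HF; now apply csum_derivable with P (RtoC k12) (RtoC (- k11)). }
  destruct (Req_dec (k12 ^ 2 + (- k11) ^ 2) 0) as [Hk0|Hk0].
  { (* Zero initial data: the fundamental solution and the transform vanish. *)
    assert (Ek12 : k12 = 0) by (generalize (pow2_ge_0 k12) (pow2_ge_0 (- k11)); nra).
    assert (Ek11 : - k11 = 0) by (generalize (pow2_ge_0 k12) (pow2_ge_0 (- k11)); nra).
    assert (Hz : forall mu j, phi mu j = 0%C).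
    { intros mu j; apply Cmod_eq_0, Rle_antisym; [|apply Cmod_ge_0].
      assert (Hb := family_bound W P _ _ phi (Cmod mu) mu Hadm Hfam (Rle_refl _) j).
      rewrite Ek12, Ek11, Cmod_0, Rplus_0_r, Rmult_0_r in Hb; exact Hb. }
    assert (HF0 : forall mu, F mu = 0%C).
    { intros mu; rewrite HF; apply CSeries_zero; intros n; rewrite Hz; ring. }
    assert (HS0 : forall n mu, Cmod (S n mu) = 0).
    { intros n mu; unfold S; rewrite HF0, Cmult_0_l; apply Cmod_0. }
    apply Zseries_of_enumeration.
    - intros mu; split; [exists 0; apply is_series_zero; intros n; apply HS0|].
      rewrite HF0; apply CSeries_zero; intros n; apply Cmod_eq_0, HS0.
    - intros r0 eps He; exists 0%nat; intros mu _.
      rewrite sum_O, HS0, (is_series_unique _ 0); [lra|].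
      apply is_series_zero; intros n; apply HS0. }
  assert (Hk : 0 < k12 ^ 2 + (- k11) ^ 2)
    by (generalize (pow2_ge_0 k12) (pow2_ge_0 (- k11)); lra).
  assert (Hw0 : w = charfun k21 k22 phi) by apply q_omega_charfun.
  assert (Hev : forall mu, charfun k21 k22 phi mu = 0%C <-> exists n, mu = RtoC (lam n)).
  { intros mu; rewrite <- Hw0, <- Hlam; destruct (Hphi mu) as [Hs [H1 H2]].
    symmetry; exact (eigenvalue_charfun q a k11 k12 k21 k22 p r (fun x => phi1 x mu)
      (fun x => phi2 x mu) mu Hq01 Ha Hp0 Hr0 Hk Hs H1 H2). }
  (* A vanishing right boundary condition would make [Ci] an eigenvalue. *)
  assert (Hleft : 0 < k21 ^ 2 + k22 ^ 2).
  { destruct (Req_dec (k21 ^ 2 + k22 ^ 2) 0) as [E|E];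
      [|generalize (pow2_ge_0 k21) (pow2_ge_0 k22); lra].
    assert (E1 : k21 = 0) by (generalize (pow2_ge_0 k21) (pow2_ge_0 k22); nra).
    assert (E2 : k22 = 0) by (generalize (pow2_ge_0 k21) (pow2_ge_0 k22); nra).
    destruct (proj1 (Hev Ci)) as [n Hn].
    - unfold charfun; rewrite E1, E2; ring.
    - injection Hn; lra. }
  set (ev := fun n => lam (zenum n)).
  assert (Hsp : spectral W P k12 (- k11) k21 k22 phi ev).
  { split; auto.
    - intros m n E; now apply zenum_inj, Hlam_inj.
    - intros mu; rewrite Hev; split; intros [n Hn].
      + destruct (zenum_surj n) as [m Hm]; exists m; unfold ev; now rewrite <- Hm.
      + now exists (zenum n). }
  assert (Hf0 : k22 = 0 -> f 0%nat = 0%C).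
  { intros E; rewrite <- (Hdir E); change 0%nat with (2 * 0)%nat.
    unfold f, orbit_coef; rewrite interleave_even; simpl; now rewrite Rmult_1_r. }
  destruct (expansion_converges W P k12 (- k11) k21 k22 phi ev f Hsp Hfr Hfi Hf0)
    as [Hexp Hunif].
  assert (HS : forall n mu, S (zenum n) mu = expansion_term W phi ev f n mu).
  { intros n mu; unfold S, expansion_term; rewrite Hw0, HF.
    now rewrite <- (sampling_kernel_eigcoef W P k12 (- k11) k21 k22 phi ev n mu Hsp). }
  apply Zseries_of_enumeration.
  - intros mu; destruct (Hexp mu) as [He1 He2]; split.
    + apply ex_series_ext with (2 := He1); intros n; now rewrite HS.
    + rewrite HF, <- He2; apply CSeries_ext; intros n; apply HS.
  - intros r0 eps He; destruct (Hunif r0 eps He) as [N HN]; exists N; intros mu Hmu.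
    specialize (HN mu Hmu).
    rewrite (Series_ext _ _ (fun n => f_equal Cmod (HS n mu))).
    now rewrite (sum_n_ext _ _ N (fun n => f_equal Cmod (HS n mu))).
Qed.
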